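(* Let $n \ge 1$ and let $\equiv$ be a simple essential lattice congruence of the weak order on $\mathfrak{S}_n$. Then the Hasse diagrams of the $\equiv$-preposets are precisely the $\equiv$-admissible Schröder separating trees.
   Context: Notation: $[n]=\{1,\dots,n\}$ and $]i,j[\,=\{i+1,\dots,j-1\}$ for $i<j$. The weak order on the permutations $\mathfrak{S}_n$ of $[n]$ is the lattice defined by $\sigma\le\tau$ iff $\mathrm{inv}(\sigma)\subseteq\mathrm{inv}(\tau)$, where $\mathrm{inv}(\sigma)=\{(\sigma_p,\sigma_q) : p<q,\ \sigma_p>\sigma_q\}$. A lattice congruence is an equivalence relation $\equiv$ on $\mathfrak{S}_n$ compatible with meets and joins; its classes are intervals. Arcs. An arc is a quadruple $(i,j,A,B)$ with $1\le i<j\le n$ and $A\sqcup B={]i,j[}$; $\mathcal{A}_n$ is the set of all arcs. The up arc is $u(i,j)=(i,j,]i,j[,\varnothing)$ and the down arc is $d(i,j)=(i,j,\varnothing,]i,j[)$. The arc $(i,j,A,B)$ is a subarc of $(i',j',A',B')$ if $i'\le i<j\le j'$, $A\subseteq A'$ and $B\subseteq B'$. For an arc $\alpha=(i,j,A,B)$ let $\sigma_\alpha$ be the permutation with a single descent whose one-line notation is $1,\dots,i-1$, then the elements of $A$ in increasing order, then $j$, then $i$, then the elements of $B$ in increasing order, then $j+1,\dots,n$. For a lattice congruence $\equiv$, let $\mathcal{A}_\equiv$ be the set of arcs $\alpha$ such that $\sigma_\alpha$ is the minimum of its $\equiv$-class. (The map $\equiv\ \mapsto\mathcal{A}_\equiv$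 is a bijection from the lattice congruences of the weak order on $\mathfrak{S}_n$ to the subsets of $\mathcal{A}_n$ closed under taking subarcs.) The congruence $\equiv$ is essential if $\mathcal{A}_\equiv$ contains all arcs $(i,i+1,\varnothing,\varnothing)$, $i\in[n-1]$. It is simple if every arc of $\mathcal{A}_n\setminus\mathcal{A}_\equiv$ having no strict subarc in $\mathcal{A}_n\setminus\mathcal{A}_\equiv$ is an up arc or a down arc. Quotient fan and $\equiv$-preposets. For a permutation $\sigma$, let $C(\sigma)=\{x\in\mathbb{R}^n : x_{\sigma_1}\le\dots\le x_{\sigma_n}\}$. The quotient fan $\mathcal{F}_\equiv$ is the complete fan in $\mathbb{R}^n$ whose maximal cones are the unions $\bigcup_{\sigma\in X}C(\sigma)$ over the $\equiv$-classes $X$ (and whose cones are all the faces of these). A preposet $\preccurlyeq$ on $[n]$ is a reflexive and transitive binary relation; its cone is $C(\preccurlyeq)=\{x\in\mathbb{R}^n : x_i\le x_j\text{ for all } i\preccurlyeq j\}$. Its associated equivalence relation is $i\simeq j$ iff $i\preccurlyeq j$ and $j\preccurlyeq i$, and its Hasse diagram is the directed graph on the $\simeq$-classes with an edge $I\to J$ for each cover relation $I\prec J$ of the quotient poset ${\preccurlyeq}/{\simeq}$. The $\equiv$-preposets are the preposets $\preccurlyeq$ on $[n]$ such that $C(\preccurlyeq)$ is a cone of $\mathcal{F}_\equiv$. Schröder separating trees. In a directed tree $S$ (an orientation of a tree) whose nodes are the parts of a set partition of $[n]$, the parents (resp. children) of a node $J$ are the targets of its outgoing edges (resp. the sources of its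 incoming edges), and the ancestor (resp. descendant) subtrees of $J$ are the connected components of $S\setminus J$ containing its parents (resp. children). A Schröder separating tree is a directed tree on the parts of a set partition of $[n]$ such that any two distinct ancestor (resp. descendant) subtrees of a node $J$ are separated by some integer $j\in J$, meaning that all integers appearing in nodes of one of the two subtrees are smaller than $j$ while all integers appearing in nodes of the other are larger than $j$. For subtrees, $L<R$ means that every integer appearing in $L$ is smaller than every integer appearing in $R$, and $\max L$, $\min R$ refer to these integers. Admissibility. The mandatory arcs of a Schröder separating tree $S$ are the arcs $(i,k,A,B)$ such that the nodes $I\ni i$ and $K\ni k$ of $S$ either coincide or form an edge of $S$ (in either direction), ${]i,k[}\cap(I\cup K)=\varnothing$, and $A$ (resp. $B$) is the set of integers $j\in{]i,k[}$ contained in a node $J$ of $S$ such that there is a directed path in $S$ from $J$ to $I$ or $K$ (resp. from $I$ or $K$ to $J$). The forbidden up (resp. down) arcs of $S$ are the arcs $u(\max L,\min R)$ (resp. $d(\max L,\min R)$) where $L<R$ are two ancestor (resp. descendant) subtrees of a node of $S$. The tree $S$ is $\equiv$-admissible if $\mathcal{A}_\equiv$ contains all mandatory arcs of $S$ and none of the forbidden (up or down) arcs of $S$. *)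

(* Defs.v *)
From mathcomp Require Import classical_sets reals.
From mathcomp Require Import all_boot all_order all_fingroup all_algebra.
From mathcomp Require Import zify.

Set Implicit Arguments.
Unset Strict Implicit.
Unset Printing Implicit Defensive.

Import GRing.Theory Num.Theory.

(* The set [n] = {1, ..., n} is represented by 'I_n = {0, ..., n-1}, both for
   positions and for values: the one-line notation of s : 'S_n is
   s 0, s 1, ..., s (n-1). *)

Section WeakOrder.

Variable n : nat.
Implicit Types (s t m : 'S_n) (e : rel 'S_n).

Definition inversions s : {set 'I_n * 'I_n} :=
  [set (s pq.1, s pq.2) | pq : 'I_n * 'I_n & (pq.1 < pq.2) && (s pq.2 < s pq.1)].

Definition weak_le s t : bool := inversions s \subset inversions t.

Definition is_meet s t m : Prop :=
  [/\ weak_le m s, weak_le m t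
    & forall m', weak_le m' s -> weak_le m' t -> weak_le m' m].

Definition is_join s t m : Prop :=
  [/\ weak_le s m, weak_le t m
    & forall m', weak_le s m' -> weak_le t m' -> weak_le m m'].

Definition lattice_congruence e : Prop :=
  [/\ equivalence_rel e,
      forall s s' t t' m m', e s s' -> e t t' ->
        is_meet s t m -> is_meet s' t' m' -> e m m'
    & forall s s' t t' m m', e s s' -> e t t' ->
        is_join s t m -> is_join s' t' m' -> e m m'].

Definition is_class_min e s : bool := [forall t, e s t ==> weak_le s t].

End WeakOrder.

Section Arcs.

Variable n : nat.

Definition between (i j : 'I_n) : {set 'I_n} := [set k : 'I_n | i < k < j].

Definition quadruple : Type := ('I_n * 'I_n * {set 'I_n} * {set 'I_n})%type.

Definition arcs : {set quadruple} :=
  [set a : quadruple | let: (i, j, A, B) := a in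
    [&& i < j, A :|: B == between i j & [disjoint A & B]]].

Definition up_arc (i j : 'I_n) : quadruple := (i, j, between i j, set0).
Definition down_arc (i j : 'I_n) : quadruple := (i, j, set0, between i j).

Definition subarc (a a' : quadruple) : bool :=
  let: (i, j, A, B) := a in let: (i', j', A', B') := a' in
  [&& i' <= i, i < j, j <= j', A \subset A' & B \subset B'].

(* [enum A] lists the elements of A : {set 'I_n} in increasing order. *)
Definition arc_word (a : quadruple) : seq 'I_n :=
  let: (i, j, A, B) := a in
  enum [set k : 'I_n | k < i] ++ enum A ++ [:: j; i] ++ enum B
    ++ enum [set k : 'I_n | j < k].

(* [codom s] is the one-line notation of s. The default value 1 is never used
   on arcs, see [codom_arc_perm]. *)
Definition arc_perm (a : quadruple) : 'S_n :=
  odflt 1%g [pick s : 'S_n | codom s == arc_word a].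

Lemma codom_arc_perm (a : quadruple) :
  a \in arcs -> codom (arc_perm a) = arc_word a.
Proof.
move=> Ha; rewrite /arc_perm; case: pickP => [s /eqP //|nos]; exfalso.
have [uw mw] : uniq (arc_word a) /\ forall k, k \in arc_word a.
  move: Ha {nos}; case: a => [[[i j] A] B]; rewrite inE /=.
  case/and3P=> lt_ij /eqP AB dAB.
  have memAB k : (k \in A) || (k \in B) = (i < k < j).
    by move/setP/(_ k): AB; rewrite !inE.
  have inA k : k \in A -> i < k < j by rewrite -memAB => ->.
  have inB k : k \in B -> i < k < j by rewrite -memAB orbC => ->.
  split=> [|k]; last first.
    rewrite !(mem_cat, mem_enum, inE).
    case: (ltngtP k i) => //= [lt_ik|/val_inj->]; last by rewrite eqxx !orbT.
    case: (ltngtP j k) => [||/val_inj->]; rewrite ?orbT ?eqxx ?orbT // => lt_kj.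
    by have := memAB k; rewrite lt_ik lt_kj; case/orP=> ->; rewrite ?orbT.
  rewrite !(cat_uniq, cons_uniq, enum_uniq) /= !andbT inE.
  apply/and5P; split.
  - apply/hasPn=> k; rewrite !(mem_cat, mem_enum, inE) -leqNgt.
    case/or4P=> [/inA|/eqP->|/eqP->|/orP[/inB|]]; try by [|lia]; lia.
  - rewrite !mem_enum !negb_or; apply/and3P; split.
    + by apply/negP=> jA; have := inA j jA; lia.
    + by apply/negP=> iA; have := inA i iA; lia.
    + apply/hasPn=> k; rewrite !(mem_cat, mem_enum, inE) => kBj.
      apply/negP=> kA; case/orP: kBj => [kB|]; last by have := inA k kA; lia.
      by rewrite (disjointFr dAB kA) in kB.
  - rewrite !(mem_cat, mem_enum, inE) -val_eqE /=.
    by apply/negP=> /orP[|/orP[/inB|]]; lia.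
  - by rewrite !(mem_cat, mem_enum, inE); apply/negP=> /orP[/inB|]; lia.
  - apply/hasPn=> k; rewrite !mem_enum inE => lt_jk.
    by apply/negP=> /inB; lia.
have sw : size (arc_word a) == n.
  rewrite -[X in _ == X]card_ord -(card_uniqP uw); apply/eqP/eq_card=> k.
  by rewrite mw.
have injw : injective (tnth (Tuple sw)) by apply/tuple_uniqP.
move: (nos (perm injw)); rewrite (_ : codom _ = arc_word a) ?eqxx //.
apply: etrans (map_tnth_enum (Tuple sw)).
by rewrite /codom /image_mem; apply: eq_map => k; rewrite permE.
Qed.

Definition congruence_arcs (e : rel 'S_n) : {set quadruple} :=
  [set a in arcs | is_class_min e (arc_perm a)].

Definition essential (e : rel 'S_n) : Prop :=
  forall i j : 'I_n, j = i.+1 :> nat -> (i, j, set0, set0) \in congruence_arcs e.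

Definition simple_congruence (e : rel 'S_n) : Prop :=
  forall a, a \in arcs :\: congruence_arcs e ->
    (forall b, b \in arcs :\: congruence_arcs e -> subarc b a -> b = a) ->
    exists i j : 'I_n, a = up_arc i j \/ a = down_arc i j.

End Arcs.

(* A directed graph whose nodes are sets of elements of 'I_n; the pair (I, J)
   stands for the edge I -> J. *)
Record digraph (n : nat) := Digraph {
  nodes : {set {set 'I_n}};
  edges : {set {set 'I_n} * {set 'I_n}} }.

Section QuotientFan.

Variables (R : realType) (n : nat).
Local Open Scope ring_scope.
Implicit Types (C F : set 'rV[R]_n) (e : rel 'S_n) (p : rel 'I_n).

Definition perm_cone (s : 'S_n) : set 'rV[R]_n :=
  [set x | forall a b : 'I_n, (a <= b)%N -> x 0 (s a) <= x 0 (s b)]%classic.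

Definition class_cone e (t : 'S_n) : set 'rV[R]_n :=
  [set x | exists2 s, e t s & perm_cone s x]%classic.

(* Faces are cut out by supporting hyperplanes; l = 0 gives C itself. *)
Definition is_face F C : Prop :=
  exists2 l : 'rV[R]_n,
    forall x, C x -> 0 <= \sum_i l 0 i * x 0 i
  & F = [set x | C x /\ \sum_i l 0 i * x 0 i = 0]%classic.

Definition quotient_fan e : set (set 'rV[R]_n) :=
  [set F | exists t, is_face F (class_cone e t)]%classic.

Definition preposet p : Prop := reflexive p /\ transitive p.

Definition preposet_cone p : set 'rV[R]_n :=
  [set x | forall i j, p i j -> x 0 i <= x 0 j]%classic.

Definition congruence_preposet e p : Prop :=
  preposet p /\ quotient_fan e (preposet_cone p).

End QuotientFan.

Section Hasse.

Variables (n : nat) (p : rel 'I_n).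
Implicit Types I J K : {set 'I_n}.

Definition preposet_classes : {set {set 'I_n}} :=
  equivalence_partition (fun i j => p i j && p j i) [set: 'I_n].

Definition class_lt I J : bool :=
  (I != J) && [exists i in I, exists j in J, p i j].

Definition class_cover I J : bool :=
  class_lt I J
    && ~~ [exists K in preposet_classes, class_lt I K && class_lt K J].

Definition hasse : digraph n :=
  Digraph preposet_classes
    [set IJ in setX preposet_classes preposet_classes
      | class_cover IJ.1 IJ.2].

End Hasse.

Section SchroederTrees.

Variables (n : nat) (S : digraph n).
Implicit Types (I J K L M : {set 'I_n}) (i j k : 'I_n).

Definition edge : rel {set 'I_n} := fun I J => (I, J) \in edges S.
Definition adjacent : rel {set 'I_n} := fun I J => edge I J || edge J I.

(* An orientation of a connected graph without cycles: the asymmetry of [edge]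
   rules out loops and pairs of opposite edges, so that a cycle of the
   underlying simple graph is a cyclic sequence of at least 3 distinct nodes. *)
Definition directed_tree : Prop :=
  [/\ forall I J, edge I J -> I \in nodes S /\ J \in nodes S,
      forall I J, edge I J -> ~~ edge J I,
      {in nodes S &, forall I J, connect adjacent I J}
    & forall c : seq {set 'I_n}, path.cycle adjacent c -> uniq c -> size c <= 2].

(* The connected component of M in the graph obtained by deleting J. *)
Definition component_without J M : {set {set 'I_n}} :=
  [set K in nodes S :\ J |
    connect (fun I I' => [&& I != J, I' != J & adjacent I I']) M K].

Definition ancestor_subtrees J : {set {set {set 'I_n}}} :=
  [set component_without J M | M in nodes S & edge J M].

Definition descendant_subtrees J : {set {set {set 'I_n}}} :=
  [set component_without J M | M in nodes S & edge M J].

Definition subtree_lt (T1 T2 : {set {set 'I_n}}) : bool :=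
  [forall x in cover T1, forall y in cover T2, x < y].

Definition separated_by j (T1 T2 : {set {set 'I_n}}) : bool :=
  [forall x in cover T1, x < j] && [forall y in cover T2, j < y].

Definition separated J (T1 T2 : {set {set 'I_n}}) : bool :=
  [exists j in J, separated_by j T1 T2 || separated_by j T2 T1].

Definition schroeder_separating_tree : Prop :=
  [/\ partition (nodes S) [set: 'I_n],
      directed_tree
    & forall J, J \in nodes S ->
        {in ancestor_subtrees J &, forall T1 T2, T1 != T2 -> separated J T1 T2}
        /\
        {in descendant_subtrees J &, forall T1 T2, T1 != T2 -> separated J T1 T2}].

Definition is_max (X : {set 'I_n}) i : bool :=
  (i \in X) && [forall x in X, x <= i].

Definition is_min (X : {set 'I_n}) i : bool :=
  (i \in X) && [forall x in X, i <= x].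

Definition mandatory_arc (a : quadruple n) : Prop :=
  let: (i, k, A, B) := a in
  a \in arcs n /\
  exists I K, [/\ [&& I \in nodes S, K \in nodes S, i \in I & k \in K],
    (I == K) || adjacent I K,
    between i k :&: (I :|: K) = set0,
    A = [set j in between i k | [exists J in nodes S, (j \in J)
          && (connect edge J I || connect edge J K)]]
  & B = [set j in between i k | [exists J in nodes S, (j \in J)
          && (connect edge I J || connect edge K J)]]].

Definition forbidden_up_arc (a : quadruple n) : Prop :=
  exists J (L M : {set {set 'I_n}}) i k, [/\ J \in nodes S,
    L \in ancestor_subtrees J /\ M \in ancestor_subtrees J,
    subtree_lt L M,
    is_max (cover L) i /\ is_min (cover M) k
  & a = up_arc i k].

Definition forbidden_down_arc (a : quadruple n) : Prop :=
  exists J (L M : {set {set 'I_n}}) i k, [/\ J \in nodes S,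
    L \in descendant_subtrees J /\ M \in descendant_subtrees J,
    subtree_lt L M,
    is_max (cover L) i /\ is_min (cover M) k
  & a = down_arc i k].

Definition admissible (e : rel 'S_n) : Prop :=
  [/\ forall a, mandatory_arc a -> a \in congruence_arcs e,
      forall a, forbidden_up_arc a -> a \notin congruence_arcs e
    & forall a, forbidden_down_arc a -> a \notin congruence_arcs e].

End SchroederTrees.

(* Main.v *)
Require Import Defs.
From mathcomp Require Import classical_sets reals.
From mathcomp Require Import all_boot all_order all_fingroup all_algebra.
From mathcomp Require Import zify.

(** Both directions read the quotient fan through one order per congruence
class. A class is an interval of the weak order, hence the set of linear
extensions of the intersection [class_order e t] of the linear orders in it
(lemma [class_linear_extension]), and its cone is the cone of this order. The
congruence enters only through the rule [cover_contracted]: exchanging two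
adjacent letters i < k of a permutation stays in the class iff the arc that
joins i to k, passing above the letters that precede them and below those that
follow them, is missing, that is, does not belong to the arcs of the congruence.
All superarcs of a missing arc are missing ([congruence_arcs_superarc]), so a
single missing arc contracts many exchanges.

From preposets to trees. Let C(p) be a face of the cone of a class. By
simplicity, every missing arc contains a missing up or down arc; call the pair
(a, b) of its ends an up wall or a down wall. If all integers strictly between
a and b lie in a down-set D of p, then, for a missing up arc, no element outside
of D and at most a is comparable to an element outside of D and at least b: all
exchanges between these two sides are contracted, so a point of C(p) that is
constant outside of D can be moved in two opposite directions within the cone of
the class, hence within its face C(p) ([wall_splits]). Conversely, two elements
incomparable in p and adjacent in some linear extension are separated by a wall,
because exchanging them stays in the class ([incomparable_arc]). These two facts,
and their images under reversal of p, form the notion of [wall_system], from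
which the tree is built by pure order theory: two upper covers of a class J of p
are separated by an up wall that meets J and whose interior lies below J
([upper_covers_wall]). Such walls cannot be crossed outside of the elements
below J, which excludes cycles in the Hasse diagram, separates the ancestor
subtrees of J, and shows that the forbidden arcs are missing. A mandatory arc
cannot be missing, since the wall inside it would disconnect an edge or a node
([no_wall_across_cover]). The Hasse diagram is connected because i and i+1 are
comparable in p, the arc that joins them being present in an essential
congruence.

From trees to preposets. Let S be admissible, p its reachability preorder and t
a linear extension of S. In a Schroeder separating tree the simple path between
two incomparable nodes turns at some node J, and all integers between two
consecutive subtrees at this turn lie beyond J ([forbidden_between]). The
forbidden arc between these subtrees is therefore passed by every exchange of
adjacent letters from the two nodes, in any linear extension. Hence all linear
extensions of S that order each node like t lie in the class of t
([linear_extension_congruent]), and the order of this class is contained in p.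
Conversely the mandatory arcs make neighboring values of a node, or of two
adjacent nodes, comparable in the order of the class
([class_order_comparable]). So p is obtained from the order of the class by
reversing some of its relations, which means that C(p) is a face
([preposet_face]). *)

Set Implicit Arguments.
Unset Strict Implicit.
Unset Printing Implicit Defensive.

(** * Permutations as linear orders *)
Section Positions.
Variable n : nat.
Implicit Types (s t u : 'S_n) (a b i j k x y : 'I_n).

Definition pos s i : nat := (s^-1%g : 'S_n) i.

Definition before s i j : bool := pos s i < pos s j.

Lemma pos_inj s i j : pos s i = pos s j -> i = j.
Proof. by move/val_inj/perm_inj. Qed.

Lemma pos_perm s (a : 'I_n) : pos s (s a) = a.
Proof. by rewrite /pos permK. Qed.

Lemma pos_lt s i : pos s i < n.
Proof. exact: ltn_ord. Qed.

Lemma before_total s i j : i != j -> ~~ before s i j -> before s j i.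
Proof.
move=> ne; rewrite /before -leqNgt leq_eqVlt => /orP[/eqP/pos_inj eji|//].
by rewrite eji eqxx in ne.
Qed.

Lemma before_trans s j i k : before s i j -> before s j k -> before s i k.
Proof. exact: ltn_trans. Qed.

Lemma before_irr s i : before s i i = false.
Proof. exact: ltnn. Qed.

Lemma before_asym s i j : before s i j -> before s j i = false.
Proof. by rewrite /before; lia. Qed.

Lemma before_neq s i j : before s i j -> i != j.
Proof. by apply: contraTneq => ->; rewrite before_irr. Qed.

Lemma before_flip s i j : i != j -> before s j i = ~~ before s i j.
Proof.
move=> ne; apply/idP/idP => [/before_asym->//|]; exact: before_total.
Qed.

Lemma count_lt_iota (m k : nat) : k <= m -> count (fun c : nat => c < k) (iota 0 m) = k.
Proof.
move=> km; rewrite -(subnKC km) iotaD count_cat add0n.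
rewrite (@eq_in_count _ _ predT) ?count_predT ?size_iota; last first.
  by move=> x; rewrite mem_iota /=; lia.
rewrite (@eq_in_count _ _ pred0) ?count_pred0 ?addn0 //.
by move=> x; rewrite mem_iota /=; lia.
Qed.

Lemma card_before s i : #|[set j | before s j i]| = pos s i.
Proof.
have -> : [set j | before s j i] = s @: [set a : 'I_n | a < pos s i].
  apply/setP=> j; rewrite inE /before; apply/idP/imsetP => [lt|[a]].
    by exists ((s^-1)%g j); rewrite ?inE ?permKV.
  by rewrite inE => lt ->; rewrite pos_perm.
rewrite card_imset; last exact: perm_inj.
rewrite cardsE cardE size_filter -enumT -(count_map val (fun c : nat => c < pos s i)) val_enum_ord.
by rewrite count_lt_iota // ltnW // pos_lt.
Qed.

Lemma perm_before_inj s t : (forall i j, before s i j -> before t i j) -> s = t.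
Proof.
move=> st; have eqb i j : before s i j = before t i j.
  apply/idP/idP=> [|tij]; first exact: st.
  apply: contraT => nij; have := before_asym tij.
  by rewrite st // before_total // (before_neq tij).
apply: invg_inj; apply/permP=> i; apply: val_inj; change (pos s i = pos t i).
by rewrite -!card_before; apply: eq_card => j; rewrite !inE eqb.
Qed.

(** Permutations are built from strict total orders: the position of i is the
    number of elements before i. *)
Lemma perm_of_order (r : rel 'I_n) :
  irreflexive r -> transitive r -> (forall i j, i != j -> r i j || r j i) ->
  exists s, forall i j, before s i j = r i j.
Proof.
move=> irr tr tot.
pose c i := #|[set j | r j i]|.
have cmono i j : r i j -> c i < c j.
  move=> rij; apply: proper_card; rewrite properE; apply/andP; split.
    by apply/subsetP=> k; rewrite !inE => /tr->.
  by apply/subsetPn; exists i; rewrite inE ?irr.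
have cn i : c i < n.
  rewrite -[X in _ < X]card_ord -cardsT; apply: proper_card; rewrite properE subsetT.
  by apply/subsetPn; exists i; rewrite ?inE ?irr.
have cinj : injective (fun i => Ordinal (cn i)).
  move=> i j [eqc]; apply/eqP; apply: contraT => /tot.
  by case/orP=> /cmono; rewrite eqc ltnn.
exists (perm cinj)^-1%g => i j; rewrite /before /pos invgK !permE /=.
apply/idP/idP=> [lt|]; last exact: cmono.
have ne : i != j by apply: contraTneq lt => ->; rewrite ltnn.
by case/orP: (tot _ _ ne) => // /cmono; lia.
Qed.

(** The chamber next to a point with coordinates f, in the direction of the
    chamber of t. *)
Lemma refinement (f : 'I_n -> nat) t :
  exists s, forall i j,
    before s i j = (f i < f j) || (f i == f j) && before t i j.
Proof.
apply: perm_of_order => [i|j i k|i j ne].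
- by rewrite before_irr ltnn andbF.
- case/orP=> [l1|/andP[/eqP e1 b1]]; case/orP=> [l2|/andP[/eqP e2 b2]].
  + by rewrite (ltn_trans l1 l2).
  + by rewrite -e2 l1.
  + by rewrite e1 l2.
  + by rewrite e1 e2 eqxx (before_trans b1 b2) orbT.
- by rewrite (before_flip t ne); case: (ltngtP (f i)) => //=; case: before.
Qed.

(** A cover relation of the weak order, read in either direction. *)
Definition swapped s s' x y : Prop :=
  [/\ before s x y, before s' y x &
    forall a b, ~~ ((a == x) && (b == y)) -> ~~ ((a == y) && (b == x)) ->
      before s a b = before s' a b].

Lemma swappedC s s' x y : swapped s s' x y -> swapped s' s y x.
Proof. by case=> h1 h2 h3; split=> // a b h h'; rewrite h3. Qed.

Lemma swap_exists s x y : before s x y ->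
  (forall q, before s x q -> before s q y -> False) ->
  exists s', swapped s s' x y.
Proof.
move=> bxy adj.
have eqy : pos s y = (pos s x).+1.
  move: bxy; rewrite /before leq_eqVlt => /orP[/eqP<-//|lt].
  have ltn' : (pos s x).+1 < n by apply: ltn_trans lt (pos_lt _ _).
  by case: (adj (s (Ordinal ltn'))); rewrite /before pos_perm /=.
exists (s * tperm x y)%g.
have posE a : pos (s * tperm x y)%g a = pos s (tperm x y a).
  by rewrite /pos invMg permM tpermV.
split=> //; first by rewrite /before !posE tpermL tpermR.
move=> a b; rewrite /before !posE.
have P c : c != x -> c != y -> pos s c <> pos s x /\ pos s c <> pos s y.
  by move=> /eqP h1 /eqP h2; split=> /pos_inj.
case: tpermP => [->|->|/eqP ax /eqP ay]; case: tpermP => [->|->|/eqP bx /eqP by'];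
  rewrite ?eqxx //=; move=> _ _; lazymatch goal with
  | h1 : is_true (?c != x), h2 : is_true (?c != y) |- _ => case: (P c h1 h2)
  | _ => idtac end; lia.
Qed.

(** * The weak order is a lattice *)
Lemma inversionsE s a b : ((b, a) \in inversions s) = (a < b) && before s b a.
Proof.
apply/imsetP/andP=> [[[p q]]|[ab bba]].
  by rewrite inE /= => /andP[pq lt] [-> ->]; rewrite /before !pos_perm.
by exists ((s^-1)%g b, (s^-1)%g a); rewrite ?inE /= ?permKV ?ab ?andbT.
Qed.

Lemma weak_leP s t :
  reflect (forall a b, a < b -> before s b a -> before t b a) (weak_le s t).
Proof.
apply: (iffP subsetP) => [sub a b ab sba|h [b a]].
  by have := sub (b, a); rewrite !inversionsE ab sba => /(_ isT).
by rewrite !inversionsE => /andP[ab sba]; rewrite ab (h _ _ ab).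
Qed.

Lemma weak_le_refl s : weak_le s s.
Proof. exact: subxx. Qed.

Lemma weak_le_trans t s u : weak_le s t -> weak_le t u -> weak_le s u.
Proof. exact: fintype.subset_trans. Qed.

(** The inversions of the join are the transitive closure of the union of the two
    inversion sets. This closure is an inversion set because it is also
    co-transitive: a chain from c down to a steps over any b between them, and the
    step over b is an inversion of s or of t, which is split at b. *)
Lemma join_exists s t : exists m, is_join s t m.
Proof.
pose r b a := (a < b) && (before s b a || before t b a).
pose T b a := (a < b) && connect r b a.
have Ttr (b a c : 'I_n) : T c b -> T b a -> T c a.
  by case/andP=> h1 h2 /andP[h3 h4]; rewrite /T (ltn_trans h3 h1) (connect_trans h2 h4).
have Tco (a b c : 'I_n) : a < b -> b < c -> T c a -> T c b || T b a.
  move=> ab bc /andP[_ /connectP[p]].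
  elim: p c bc => [|d p IH] c bc /=; first by move=> _ ea; exfalso; rewrite ea in ab; lia.
  case/andP=> rcd pth ea.
  have cd : T c d by case/andP: (rcd) => lt _; rewrite /T lt connect1.
  case: (ltngtP b d) => [bd|db|/val_inj ebd].
  - case/orP: (IH d bd pth ea) => [dT|->]; last by rewrite orbT.
    by rewrite (Ttr _ _ _ cd dT).
  - have da : connect r d a by apply/connectP; exists p.
    case/andP: rcd => _ bcd.
    have [u uin ucd] : exists2 u, (u = s \/ u = t) & before u c d.
      by case/orP: bcd; [exists s|exists t]; auto.
    have rI (x y : 'I_n) : y < x -> before u x y -> r x y.
      by rewrite /r => -> h; case: uin => <-; rewrite h ?orbT.
    case: (boolP (before u c b)) => [cb|ncb]; first by rewrite /T bc connect1 ?rI.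
    have bu : before u b d.
      by apply: before_trans ucd; apply: before_total ncb; rewrite -val_eqE /=; lia.
    by rewrite {2}/T ab (connect_trans _ da) ?orbT // connect1 ?rI.
  - by rewrite ebd cd.
have [m mE] : exists m, forall i j, before m i j = if i < j then ~~ T j i else T i j.
  apply: perm_of_order => [i|j i k|i j].
  - by rewrite ltnn /T ltnn.
  - have T0 (x y : 'I_n) : T x y -> y < x by case/andP.
    case: (ltngtP i j) => [ij|ji|/val_inj->]; case: (ltngtP j k) => [jk|kj|/val_inj<-] //.
    + rewrite (ltn_trans ij jk) => nji nkj; apply: contraNN nji => Tki.
      by case/orP: (Tco _ _ _ ij jk Tki) => // Tkj; rewrite Tkj in nkj.
    + move=> nji Tjk; case: (ltngtP i k) => [ik|ki|/val_inj eik].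
      * by apply: contraNN nji => Tki; apply: Ttr Tjk Tki.
      * by case/orP: (Tco _ _ _ ki ij Tjk) => // Tji; rewrite Tji in nji.
      * by move: nji; rewrite eik Tjk.
    + by move=> _ /T0; rewrite ltnn.
    + move=> Tij nkj; case: (ltngtP i k) => [ik|ki|/val_inj eik].
      * by apply: contraNN nkj => Tki; apply: Ttr Tki Tij.
      * by case/orP: (Tco _ _ _ jk ki Tij) => // Tkj; rewrite Tkj in nkj.
      * by move: nkj; rewrite -eik Tij.
    + move=> Tij Tjk; have := Ttr _ _ _ Tij Tjk => Tik.
      by rewrite ltnNge (ltnW (T0 _ _ Tik)).
    + by move=> _ /T0; rewrite ltnn.
  - rewrite -val_eqE /= neq_ltn => /orP[lt|lt].
      by rewrite lt [j < i]ltnNge (ltnW lt) /= orNb.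
    by rewrite lt [i < j]ltnNge (ltnW lt) /= orbN.
exists m; split.
- apply/weak_leP=> a b ab h; rewrite mE [b < a]ltnNge (ltnW ab) /= /T ab connect1 //.
  by rewrite /r ab h.
- apply/weak_leP=> a b ab h; rewrite mE [b < a]ltnNge (ltnW ab) /= /T ab connect1 //.
  by rewrite /r ab h orbT.
- move=> m' /weak_leP sm /weak_leP tm; apply/weak_leP=> a b ab.
  rewrite mE [b < a]ltnNge (ltnW ab) /= => /andP[_ /connectP[p]].
  elim: p b ab => [|d p IH] b ab /=; first by move=> _ e; rewrite e ltnn in ab.
  case/andP=> /andP[db h] pth ea.
  have bd : before m' b d by case/orP: h => h; [apply: sm|apply: tm].
  case: (ltngtP a d) => [ad|da|/val_inj->] //; last first.
    have : d <= d by []. 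
    move=> _. exfalso. move: da pth ea. elim: p d {IH db h bd} => [|d' p IH'] d da /=.
      by move=> _ e; move: da; rewrite e ltnn.
    by case/andP=> /andP[lt _] pth; apply: IH' => //; apply: ltn_trans lt da.
  exact: before_trans bd (IH _ ad pth ea).
Qed.

(** Reversing words is an anti-automorphism of the weak order, so it turns joins
    into meets. *)
Definition reversal s : 'S_n := (perm (@rev_ord_inj n) * s)%g.

Lemma before_reversal s i j : before (reversal s) i j = before s j i.
Proof.
have E v : pos (reversal s) v = n - (pos s v).+1.
  rewrite /pos /reversal invMg permM.
  set x := (s^-1%g v); have -> : (perm (@rev_ord_inj n))^-1%g x = rev_ord x.
    by apply: (canLR (permK _)); rewrite permE rev_ordK.
  by [].
by rewrite /before !E; have := pos_lt s i; have := pos_lt s j; lia.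
Qed.

Lemma weak_le_reversal s t : weak_le (reversal s) (reversal t) = weak_le t s.
Proof.
apply/weak_leP/weak_leP=> h a b ab; [move=> tba|rewrite !before_reversal => tba].
  have ne : a != b by rewrite -val_eqE /=; lia.
  rewrite before_flip //; apply/negP=> sab; have := h a b ab.
  by rewrite !before_reversal sab => /(_ isT); rewrite (before_asym tba).
have ne : a != b by rewrite -val_eqE /=; lia.
rewrite before_flip 1?eq_sym //; apply/negP=> /(h _ _ ab).
by rewrite (before_asym tba).
Qed.

Lemma reversalK : involutive reversal.
Proof. by move=> s; apply: perm_before_inj => i j; rewrite !before_reversal. Qed.

Lemma meet_exists s t : exists m, is_meet s t m.
Proof.
have [m [sm tm mP]] := join_exists (reversal s) (reversal t).
exists (reversal m); split; try by rewrite -weak_le_reversal reversalK.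
move=> m' ms mt; rewrite -weak_le_reversal reversalK.
by apply: mP; rewrite weak_le_reversal.
Qed.

End Positions.

(** * Classes of a lattice congruence *)
Section Congruence.
Variable n : nat.
Implicit Types (s t u : 'S_n) (a b i j k q v w x y z : 'I_n) (A B D : {set 'I_n}).

Variable e : rel 'S_n.
Hypothesis he : lattice_congruence e.

Lemma congr_refl s : e s s.
Proof. by case: he => /(_ s s s)[]. Qed.

Lemma congr_sym s t : e s t = e t s.
Proof. by case: he => /equivalence_relP[_ h] _ _; apply/idP/idP=> /h <-; apply: congr_refl. Qed.

Lemma congr_trans s t u : e s t -> e t u -> e s u.
Proof. by case: he => /equivalence_relP[_ h] _ _ /h->. Qed.

Lemma congr_meet s s' t m m' : e s s' ->
  is_meet s t m -> is_meet s' t m' -> e m m'.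
Proof. by case: he => _ h _ /h; apply; apply: congr_refl. Qed.

Lemma congr_join s s' t m m' : e s s' ->
  is_join s t m -> is_join s' t m' -> e m m'.
Proof. by case: he => _ _ h /h; apply; apply: congr_refl. Qed.

Lemma meet_le s t : weak_le s t -> is_meet s t s.
Proof. by split=> //; apply: weak_le_refl. Qed.

Lemma join_le s t : weak_le s t -> is_join s t t.
Proof. by split=> //; apply: weak_le_refl. Qed.

Lemma meetC s t m : is_meet s t m -> is_meet t s m.
Proof. by case=> h1 h2 h3; split=> // m' a b; apply: h3. Qed.

Lemma joinC s t m : is_join s t m -> is_join t s m.
Proof. by case=> h1 h2 h3; split=> // m' a b; apply: h3. Qed.

Lemma congr_convex s t u : weak_le s t -> weak_le t u -> e s u -> e s t.
Proof.
move=> st tu /congr_meet h; apply: (h t s t); first exact: meet_le.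
exact: meetC (meet_le tu).
Qed.

Lemma class_min_exists s : exists2 m, e s m & forall u, e s u -> weak_le m u.
Proof.
case: (arg_minnP (fun u => #|inversions u|) (congr_refl s)) => m sm mmin.
exists m => // u su; have [v [vm vu vP]] := meet_exists m u.
have ev : e s v.
  apply: (congr_trans sm); apply: (congr_meet (t := m) (s := m) (s' := u)).
  - by apply: congr_trans su; rewrite congr_sym.
  - exact/meet_le/weak_le_refl.
  - by apply: meetC.
have /eqP e1 : inversions v == inversions m by rewrite eqEcard -/(weak_le v m) vm mmin.
by rewrite /weak_le -e1.
Qed.

Lemma class_max_exists s : exists2 m, e s m & forall u, e s u -> weak_le u m.
Proof.
case: (arg_maxnP (fun u => #|inversions u|) (congr_refl s)) => m sm mmax.
exists m => // u su; have [v [vm vu vP]] := join_exists m u.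
have ev : e s v.
  apply: (congr_trans sm); apply: (congr_join (t := m) (s := m) (s' := u)).
  - by apply: congr_trans su; rewrite congr_sym.
  - exact/join_le/weak_le_refl.
  - by apply: joinC.
have /eqP e1 : inversions m == inversions v by rewrite eqEcard -/(weak_le m v) vm; apply: mmax.
by rewrite /weak_le e1.
Qed.

(** The intersection of the linear orders in the class of t. *)
Definition class_order t : rel 'I_n :=
  fun i j => [forall s, e t s ==> (pos s i <= pos s j)].

Lemma class_orderP t i j :
  reflect (forall s, e t s -> pos s i <= pos s j) (class_order t i j).
Proof. by apply: (iffP forallP) => h s; apply/implyP; apply: h. Qed.

(** A class is an interval of the weak order, and the inversions of a linear
    extension of [class_order t] lie between those of the two ends. *)
Lemma class_linear_extension t s :
  (forall i j, class_order t i j -> pos s i <= pos s j) -> e t s.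
Proof.
move=> lin; have [lo tlo loP] := class_min_exists t.
have [hi thi hiP] := class_max_exists t.
have los : weak_le lo s.
  apply/weak_leP=> a b ab lob; rewrite /before ltn_neqAle lin ?andbT.
    by apply/eqP=> /pos_inj eba; rewrite eba before_irr in lob.
  apply/class_orderP=> u tu; apply/ltnW.
  by move/weak_leP: (loP u tu); apply.
have shi : weak_le s hi.
  apply/weak_leP=> a b ab sba; apply: contraT => nhi.
  have ne : b != a by apply: before_neq sba.
  have /lin : class_order t a b.
    apply/class_orderP=> u tu; rewrite leqNgt; apply: contra nhi => uba.
    by move/weak_leP: (hiP u tu); apply.
  by rewrite leqNgt -/(before s b a) sba.
apply: (congr_trans tlo); apply: (congr_convex los shi).
by apply: congr_trans thi; rewrite congr_sym.
Qed.

Lemma class_order_trans t : transitive (class_order t).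
Proof.
move=> j i k /class_orderP h1 /class_orderP h2; apply/class_orderP=> s ts.
exact: leq_trans (h1 s ts) (h2 s ts).
Qed.

Lemma class_order_anti t i j : class_order t i j -> class_order t j i -> i = j.
Proof.
move=> /class_orderP h1 /class_orderP h2; apply: (@pos_inj _ t).
by apply/eqP; rewrite eqn_leq h1 ?h2 ?congr_refl.
Qed.

Lemma class_order_before t s i j :
  e t s -> class_order t i j -> i != j -> before s i j.
Proof.
move=> ts /class_orderP/(_ s ts) h ne; rewrite /before ltn_neqAle h andbT.
by apply: contra ne => /eqP/pos_inj->.
Qed.

(** * Arcs and contracted cover relations *)
Definition arc_at s i k : quadruple n :=
  (i, k, [set q in between i k | before s q i],
         [set q in between i k | before s k q]).

Lemma arcsP i k A B : reflect
  [/\ i < k, forall q, (q \in A) || (q \in B) = (i < q < k)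
    & forall q, q \in A -> q \notin B] ((i, k, A, B) \in arcs n).
Proof.
rewrite inE; apply: (iffP and3P) => [[ik /eqP AB dAB]|[ik AB dAB]]; split=> //.
- by move=> q; move/setP/(_ q): AB; rewrite !inE.
- by move=> q qA; rewrite (disjointFr dAB qA).
- by apply/eqP/setP=> q; rewrite !inE AB.
- by rewrite disjoint_subset; apply/subsetP=> q /dAB; rewrite inE.
Qed.

Lemma pairwise_codom s (r : rel 'I_n) :
  pairwise r (codom s) -> forall i j, before s i j -> r i j.
Proof.
move=> pw i j bij; have sz : size (codom s) = n by rewrite size_codom card_ord.
have nth_s v : nth i (codom s) (pos s v) = v.
  rewrite (nth_map (s^-1%g v)); last by rewrite size_enum_ord pos_lt.
  by rewrite nth_ord_enum permKV.
move/(pairwiseP i): pw => /(_ (pos s i) (pos s j)).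
by rewrite !inE sz !pos_lt !nth_s; apply.
Qed.

(** The word of an arc concatenates the increasing blocks of the values below i, of A,
    of k, of i, of B and of the values above k, so an inversion has its larger value
    in A or equal to k and its smaller value in B or equal to i. *)
Lemma arc_perm_inversions i k A B : (i, k, A, B) \in arcs n ->
  forall a b, a < b -> before (arc_perm (i, k, A, B)) b a =
    ((b == k) || (b \in A)) && ((a == i) || (a \in B)).
Proof.
move=> aA; have := codom_arc_perm aA; set s := arc_perm _ => cod.
case/arcsP: aA => ik AB dAB.
(* The rank of the block of the word that contains v. *)
pose f v := if v < i then 0 else if v \in A then 1 else if v == k then 2 else
  if v == i then 3 else if v \in B then 4 else 5.
pose r v w := (f v < f w) || (f v == f w) && (v < w).
have inA v : v \in A -> i < v < k by rewrite -AB => ->.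
have inB v : v \in B -> i < v < k by rewrite -AB orbC => ->.
have f0 v : v < i -> f v = 0 by rewrite /f => ->.
have f1 v : v \in A -> f v = 1.
  by move=> vA; rewrite /f vA; have := inA v vA; case: (ltnP v i) => //; lia.
have f2 : f k = 2.
  rewrite /f eqxx; case: (ltnP k i) => [|_]; first by lia.
  by case: (boolP (k \in A)) => // /inA; lia.
have f3 : f i = 3.
  rewrite /f ltnn eqxx; case: (boolP (i \in A)) => [/inA|_]; first by lia.
  by case: (eqVneq i k) => [eik|_ //]; rewrite eik ltnn in ik.
have f4 v : v \in B -> f v = 4.
  move=> vB; rewrite /f vB; have := inB v vB; case: (ltnP v i) => [|_]; first by lia.
  case: (boolP (v \in A)) => [/dAB|_]; first by rewrite vB.
  case: eqP => [->|_]; first by lia.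
  by case: eqP => [->|_]; first by lia.
have f5 v : k < v -> f v = 5.
  move=> kv; rewrite /f; case: (ltnP v i) => [|_]; first by lia.
  case: (boolP (v \in A)) => [/inA|_]; first by lia.
  case: eqP => [e1|_]; first by rewrite e1 ltnn in kv.
  case: eqP => [e1|_]; first by rewrite e1 in kv; lia.
  by case: (boolP (v \in B)) => [/inB|_]; first by lia.
have pwE D : pairwise (fun v w => v < w) (enum D).
  rewrite /enum_mem; apply: pairwise_filter; rewrite -enumT.
  have := iota_ltn_sorted 0 n; rewrite sorted_pairwise; last exact: ltn_trans.
  by rewrite -val_enum_ord pairwise_map.
have pwf D c : (forall v, v \in D -> f v = c) -> pairwise r (enum D).
  move=> fD; apply: (sub_in_pairwise (P := mem D)) (pwE D); last first.
    by apply/allP=> v; rewrite mem_enum.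
  by move=> v w /fD e1 /fD e2 vw; rewrite /r e1 e2 eqxx vw orbT.
have rP : forall v w, before s v w -> r v w.
  apply: pairwise_codom; rewrite cod /=.
  have all_r D l c : (forall v, v \in D -> f v = c) ->
     (forall v, v \in l -> c < f v) -> allrel r (enum D) l.
    move=> fD fl; apply/allrelP=> v w; rewrite mem_enum => /fD e1 /fl.
    by rewrite /r e1 => ->.
  rewrite !pairwise_cat /= !pairwise_cat ?andbT.
  have tail v : v \in enum B ++ enum [set q : 'I_n | k < q] -> 3 < f v.
    by rewrite mem_cat !mem_enum inE => /orP[/f4->|/f5->].
  rewrite (all_r _ _ 0) ?(all_r A _ 1) ?(all_r B _ 4) //=; first last.
  - move=> v; rewrite mem_cat mem_enum !inE.
    case/or4P=> [/f1->|/eqP->|/eqP->|/tail]; rewrite ?f2 ?f3 //.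
    by apply: leq_trans.
  - by move=> v; rewrite inE => /f0.
  - move=> v; rewrite !inE => /or3P[/eqP->|/eqP->|/tail]; rewrite ?f2 ?f3 //.
    by apply: leq_trans.
  - by move=> v; rewrite mem_enum inE => /f5->.
  rewrite (pwf _ 0) ?(pwf A 1) ?(pwf B 4) ?(pwf _ 5) //; try by [move=> v; rewrite inE; auto].
  rewrite {1}/r f2 f3 /= !andbT; apply/andP; split; apply/allP=> v /tail fv.
    by rewrite /r f2 (leq_trans _ fv).
  by rewrite /r f3 fv.
move=> a b ab; have ne : b != a by rewrite -val_eqE /=; lia.
have -> : before s b a = r b a.
  apply/idP/idP=> [/rP//|rba]; apply: contraT => /(before_total ne)/rP.
  by move: rba; rewrite /r; lia.
have cl v : v < i \/ v \in A \/ v = k \/ v = i \/ v \in B \/ k < v.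
  case: (ltngtP v i) => [vi|iv|/val_inj->]; [by left| |by do 3 right; left].
  case: (ltngtP v k) => [vk|kv|/val_inj->]; [|by do 5 right|by do 2 right; left].
  have := AB v; rewrite iv vk /= => /orP[]; [by right; left|by do 4 right; left].
have spec v : [/\ ((v == k) || (v \in A)) = (0 < f v < 3),
    ((v == i) || (v \in B)) = (2 < f v < 5),
    (f v = 0 -> v < i) /\ (f v = 5 -> k < v), f v <= 5 &
    0 < f v < 5 -> (i <= v <= k) /\
      (f v = 2 -> v = k :> nat) /\ (f v = 3 -> v = i :> nat)].
  have nA w : w \in A -> (w \in B) = false by move/dAB/negbTE.
  have nB w : ~~ (i < w < k) -> ((w \in A) = false) * ((w \in B) = false).
    by rewrite -AB negb_or => /andP[/negbTE-> /negbTE->].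
  case: (cl v) => [vi|[vA|[ev|[ev|[vB|kv]]]]].
  - have [|hA hB] := nB v; first by lia.
    rewrite f0 // hA hB.
    by split=> //=; rewrite -?val_eqE /=; lia.
  - have := inA v vA; rewrite f1 // vA (nA _ vA).
    by split=> //=; rewrite -?val_eqE /=; lia.
  - have [|hA hB] := nB k; first by lia.
    rewrite ev f2 hA hB.
    by split=> //=; rewrite -?val_eqE /=; lia.
  - have [|hA hB] := nB i; first by lia.
    rewrite ev f3 hA hB.
    by split=> //=; rewrite -?val_eqE /=; lia.
  - have := inB v vB; rewrite f4 // vB.
    rewrite (contraTF (@dAB v) vB).
    by split=> //=; rewrite -?val_eqE /=; lia.
  - have [|hA hB] := nB v; first by lia.
    rewrite f5 // hA hB.
    by split=> //=; rewrite -?val_eqE /=; lia.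
have [-> _ [b0 b5] bb bm] := spec b; have [_ -> [a0 a5] ba am] := spec a.
rewrite /r; apply/idP/idP; last by lia.
case/orP=> [lt|]; last by lia.
by apply/andP; split; lia.
Qed.

End Congruence.

Section Contraction.
Variable n : nat.
Implicit Types (s t u m : 'S_n) (a b i j k q v w x y z : 'I_n) (A B D : {set 'I_n}).

Lemma ord_lt_neq (a b : 'I_n) : a < b -> b != a.
Proof. by rewrite -val_eqE /=; lia. Qed.

Lemma swapped_adjacent s s' x y q :
  swapped s s' x y -> before s x q -> before s q y -> False.
Proof.
case=> _ yx h xq qy; have nq : (q != x) && (q != y).
  by rewrite eq_sym (before_neq xq) (before_neq qy).
case/andP: nq => qx qy'.
have := before_asym yx; rewrite (@before_trans _ _ q) //.
  by rewrite -h // ?(negbTE qx) ?(negbTE qy') ?andbF.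
by rewrite -h // ?(negbTE qx) ?(negbTE qy') ?andbF.
Qed.

Section Ascent.
Variables (s s' : 'S_n) (i k : 'I_n).
Hypotheses (ik : i < k) (sw : swapped s s' i k).

Lemma swapped_le : weak_le s s'.
Proof.
case: sw => b1 b2 h; apply/weak_leP=> a b ab.
case: (boolP ((b == k) && (a == i))) => [/andP[/eqP-> /eqP->] //|n1].
rewrite h //; apply: contraL ab => /andP[/eqP-> /eqP->]; lia.
Qed.

Lemma swapped_join m : weak_le s m -> before m k i -> weak_le s' m.
Proof.
case: sw => b1 b2 h /weak_leP sm mki; apply/weak_leP=> a b ab.
case: (boolP ((b == k) && (a == i))) => [/andP[/eqP-> /eqP->] //|n1].
rewrite -h //; first exact: sm.
by apply: contraL ab => /andP[/eqP-> /eqP->]; lia.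
Qed.

Lemma swapped_meet m : weak_le m s' -> ~~ before m k i -> weak_le m s.
Proof.
case: sw => b1 b2 h /weak_leP ms mki; apply/weak_leP=> a b ab mba.
rewrite h ?ms //.
  by apply: contraL ab => /andP[/eqP-> /eqP->]; lia.
by apply: contra mki => /andP[/eqP<- /eqP<-].
Qed.

Lemma arc_at_arcs : arc_at s i k \in arcs n.
Proof.
have [bik _ _] := sw; apply/arcsP; split=> // q; rewrite !inE.
  rewrite -andb_orr andb_idr // => lt; apply: contraT; rewrite negb_or => /andP[n1 n2].
  by case: (@swapped_adjacent s s' i k q sw); apply: before_total => //; apply: ord_lt_neq; lia.
case/andP=> -> qi /=; apply/negP=> kq.
by have := before_asym bik; rewrite (before_trans kq qi).
Qed.

End Ascent.

(** The permutation of an arc is join-irreducible: this is its only lower cover. *)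
Lemma arc_perm_cover i k A B : (i, k, A, B) \in arcs n ->
  exists c, swapped c (arc_perm (i, k, A, B)) i k.
Proof.
move=> arcA; have inv := arc_perm_inversions arcA; case/arcsP: arcA => ik AB dAB.
have [|q kq qi|c sw] := @swap_exists _ (arc_perm (i, k, A, B)) k i.
- by rewrite inv // !eqxx.
- case: (ltngtP q k) => [qk|kq'|/val_inj eqk].
  + move: kq; rewrite inv // eqxx /= => /orP[/eqP eqi|qB].
      by rewrite eqi before_irr in qi.
    have := AB q; rewrite qB orbT => /esym/andP[iq _].
    move: qi; rewrite inv // eqxx andbT => /orP[/eqP eqk|/dAB].
      by rewrite eqk ltnn in qk.
    by rewrite qB.
  + move: qi; rewrite inv ?(ltn_trans ik) // => /andP[/orP[/eqP eqk|qA] _].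
      by rewrite eqk ltnn in kq'.
    by have := AB q; rewrite qA /=; lia.
  + by rewrite eqk before_irr in kq.
- by exists c; apply: swappedC.
Qed.

Variable e : rel 'S_n.
Hypothesis he : lattice_congruence e.

(** A join-irreducible is the minimum of its class iff it is not congruent to the
    element c that it covers: any strictly smaller element is below c, and
    classes are convex. *)
Lemma mem_congruence_arcs i k A B c : (i, k, A, B) \in arcs n ->
  swapped c (arc_perm (i, k, A, B)) i k ->
  ((i, k, A, B) \in congruence_arcs e) = ~~ e c (arc_perm (i, k, A, B)).
Proof.
move=> arcA sw; rewrite inE arcA /=; set p := arc_perm _.
have inv := arc_perm_inversions arcA; case/arcsP: arcA => ik AB dAB.
have cp : weak_le c p by apply: swapped_le sw.
apply/idP/idP => [/forallP/(_ c)/implyP minp|ncp].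
  apply/negP=> cep; have [b1 b2 _] := sw.
  have /weak_leP/(_ _ _ ik b2) := minp (etrans (congr_sym he _ _) cep).
  by rewrite (before_asym b1).
apply/forallP=> t; apply/implyP=> pt; have [m [mp mt mP]] := meet_exists p t.
have epm : e p m.
  apply: (congr_meet he pt (meet_le (weak_le_refl _))).
  by apply: meetC.
apply: weak_le_trans mt; case: (boolP (before m k i)) => [mki|nmki]; last first.
  have mc := swapped_meet ik sw mp nmki.
  case/negP: ncp; rewrite (congr_sym he); apply: (congr_trans he epm).
  by apply: congr_convex mc cp _ => //; rewrite (congr_sym he).
move/weak_leP: mp => mp; apply/weak_leP=> a b ab; rewrite inv //.
have bk : (b == k) || (b \in A) -> (b == k) || before m b k.
  case/orP=> [->//|bA]; apply/orP; right; have := AB b; rewrite bA => /esym/andP[ib bk].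
  apply: before_total; first exact: ord_lt_neq.
  apply/negP=> /(mp _ _ bk); rewrite inv // eqxx /= => /orP[/eqP ebi|].
    by rewrite ebi ltnn in ib.
  exact/negP/dAB.
have ia : (a == i) || (a \in B) -> (a == i) || before m i a.
  case/orP=> [->//|aB]; apply/orP; right; have := AB a; rewrite aB orbT => /esym/andP[ia ak].
  apply: before_total; first exact: ord_lt_neq.
  apply/negP=> /(mp _ _ ia); rewrite inv // eqxx andbT => /orP[/eqP eak|/dAB].
    by rewrite eak ltnn in ak.
  by rewrite aB.
case/andP=> /bk/orP[/eqP->|bbk] /ia/orP[/eqP->|bia] //.
- exact: before_trans bia.
- exact: before_trans mki.
- exact: before_trans (before_trans bbk mki) bia.
Qed.

(** All cover relations with the same arc behave alike: with p the join-irreducible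
    of the arc and c its lower cover, joining c and p with s gives s and s', and
    meeting s and s' with p gives c and p. *)
Lemma cover_contracted s s' i k : i < k -> swapped s s' i k ->
  e s s' = (arc_at s i k \notin congruence_arcs e).
Proof.
move=> ik sw; have arcA := arc_at_arcs ik sw.
have [c swc] := arc_perm_cover arcA.
rewrite (mem_congruence_arcs arcA swc) negbK.
have inv := arc_perm_inversions arcA.
set p := arc_perm _ in swc inv *.
have [bs bs' hs] := sw; have [bc bp hc] := swc.
have cp := swapped_le ik swc; have ss' := swapped_le ik sw.
have ps' : weak_le p s'.
  apply/weak_leP=> a b ab; rewrite inv // !inE => h.
  case: (boolP ((b == k) && (a == i))) => [/andP[/eqP-> /eqP->] //|nki].
  rewrite -hs //; last by apply: contraL ab => /andP[/eqP-> /eqP->]; lia.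
  case/andP: h nki => /orP[/eqP->|/andP[_ bi]] /orP[/eqP->|/andP[_ ka]] //.
  - by rewrite !eqxx.
  - by move=> _; apply: before_trans bi (before_trans bs ka).
have cs : weak_le c s.
  apply: (swapped_meet ik sw); first exact: weak_le_trans cp ps'.
  by rewrite (before_asym bc).
apply/idP/idP => h.
  apply: (congr_meet he h (m := c) (t := p)).
    split=> // m' m's m'p; apply: (swapped_meet ik swc) => //.
    apply/negP=> mki; have /weak_leP/(_ _ _ ik mki) := m's.
    by rewrite (before_asym bs).
  by apply: meetC; apply: meet_le.
apply: (congr_join he h (t := s)); first exact: join_le.
split=> // m' /weak_leP pm sm; apply: (swapped_join ik sw) => //.
exact: pm.
Qed.

End Contraction.

(** * Subarcs force superarcs *)
Section Forcing.
Variable n : nat.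
Implicit Types (s t u m : 'S_n) (a b i j k q v w x y z : 'I_n) (A B D : {set 'I_n}).
Variable e : rel 'S_n.
Hypothesis he : lattice_congruence e.

(** The weak order on the three consecutive letters x < y < z is a hexagon. With
    letters written in order, s0 .. s5 are xyz, yxz, xzy, yzx, zxy, zyx. Contracting
    one of the two edges at the bottom contracts the two edges that exchange x and
    z: join with the other atom, then meet with the opposite coatom. *)
Section Hexagon.
Variables (x y z : 'I_n) (s0 s1 s2 s3 s4 s5 : 'S_n).
Hypotheses (xy : x < y) (yz : y < z).
Hypotheses (s01 : swapped s0 s1 x y) (s02 : swapped s0 s2 y z).
Hypotheses (s13 : swapped s1 s3 x z) (s24 : swapped s2 s4 x z).
Hypotheses (s35 : swapped s3 s5 y z) (s45 : swapped s4 s5 x y).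

Let xz : x < z. Proof. exact: ltn_trans xy yz. Qed.

Lemma hexagon_join : is_join s1 s2 s5.
Proof.
split.
- exact: weak_le_trans (swapped_le xz s13) (swapped_le yz s35).
- exact: weak_le_trans (swapped_le xz s24) (swapped_le xy s45).
move=> m s1m s2m.
have myx : before m y x by move/weak_leP: s1m; apply=> //; case: s01.
have mzy : before m z y by move/weak_leP: s2m; apply=> //; case: s02.
apply: (swapped_join yz s35) => //; apply: (swapped_join xz s13) => //.
exact: before_trans mzy myx.
Qed.

Lemma hexagon_meet23 : is_meet s2 s3 s0.
Proof.
split.
- exact: swapped_le s02.
- exact: weak_le_trans (swapped_le xy s01) (swapped_le xz s13).
move=> m /weak_leP ms2 ms3; have [_ s1yx _] := s01; have [b24 _ _] := s24.
have nzx : ~~ before m z x by apply/negP=> /(ms2 _ _ xz); rewrite (before_asym b24).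
have nyx : ~~ before m y x.
  apply/negP=> /(ms2 _ _ xy); have [b45 _ h45] := s45; have [_ _ h24] := s24.
  rewrite h24 ?(before_asym b45) // -!val_eqE /=; move: xy yz; lia.
exact: (swapped_meet xy s01) (swapped_meet xz s13 ms3 nzx) nyx.
Qed.

Lemma hexagon_meet14 : is_meet s1 s4 s0.
Proof.
split.
- exact: swapped_le s01.
- exact: weak_le_trans (swapped_le yz s02) (swapped_le xz s24).
move=> m /weak_leP ms1 ms4; have [b13 _ _] := s13.
have nzx : ~~ before m z x by apply/negP=> /(ms1 _ _ xz); rewrite (before_asym b13).
have nzy : ~~ before m z y.
  apply/negP=> /(ms1 _ _ yz); have [b35 _ h35] := s35; have [_ _ h13] := s13.
  rewrite h13 ?(before_asym b35) // -!val_eqE /=; move: xy yz; lia.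
exact: (swapped_meet yz s02) (swapped_meet xz s24 ms4 nzx) nzy.
Qed.

Lemma hexagon_left : e s0 s1 -> e s1 s3 /\ e s2 s4.
Proof.
move=> h; have h25 : e s2 s5.
  exact: (congr_join he h (join_le (swapped_le yz s02)) hexagon_join).
have le35 := swapped_le yz s35; split; last first.
  exact: (congr_convex he (swapped_le xz s24) (swapped_le xy s45)).
have h03 := congr_meet he h25 hexagon_meet23 (meetC (meet_le le35)).
by apply: (congr_trans he) h03; rewrite (congr_sym he).
Qed.

Lemma hexagon_right : e s0 s2 -> e s1 s3 /\ e s2 s4.
Proof.
move=> h; have h15 : e s1 s5.
  exact: (congr_join he h (join_le (swapped_le xy s01)) (joinC hexagon_join)).
have le45 := swapped_le xy s45; split.
  exact: (congr_convex he (swapped_le xz s13) (swapped_le yz s35)).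
have h04 := congr_meet he h15 hexagon_meet14 (meetC (meet_le le45)).
by apply: (congr_trans he) h04; rewrite (congr_sym he).
Qed.

End Hexagon.

Definition restrict_arc i k A B : quadruple n :=
  (i, k, A :&: between i k, B :&: between i k).

(** One step of forcing: an arc is extended on one side. The hexagon is placed
    after the values of A and before those of B, so that its two middle edges carry
    the arcs from x to z with y in A or with y in B. *)
Lemma arc_extension x y z A B : x < y -> y < z -> (x, z, A, B) \in arcs n ->
  (restrict_arc x y A B \notin congruence_arcs e) \/
  (restrict_arc y z A B \notin congruence_arcs e) ->
  (x, z, A, B) \notin congruence_arcs e.
Proof.
move=> xy yz /arcsP[xz AB dAB] hyp.
(* Keys for the six orders of x, y, z, after A and before the other values. *)
pose f (kx ky kz : nat) v := if v == x then kx else if v == y then ky else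
  if v == z then kz else if v \in A then 0 else 4.
have W kx ky kz : exists s, forall v w, before s v w =
    (f kx ky kz v < f kx ky kz w) ||
    (f kx ky kz v == f kx ky kz w) && before 1%g v w.
  exact: refinement.
have [s0 b0] := W 1 2 3. have [s1 b1] := W 2 1 3. have [s2 b2] := W 1 3 2.
have [s3 b3] := W 3 1 2. have [s4 b4] := W 2 3 1. have [s5 b5] := W 3 2 1.
have ne : ((x == y) = false) * ((x == z) = false) * ((y == z) = false)
        * ((y == x) = false) * ((z == x) = false) * ((z == y) = false).
  by rewrite -!val_eqE /=; do !split; lia.
have fE kx ky kz : (f kx ky kz x = kx) * (f kx ky kz y = ky) * (f kx ky kz z = kz).
  by rewrite /f !eqxx !ne.
have swap_keys s s' (g g' : 'I_n -> nat) v w :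
  (forall a b, before s a b = (g a < g b) || (g a == g b) && before 1%g a b) ->
  (forall a b, before s' a b = (g' a < g' b) || (g' a == g' b) && before 1%g a b) ->
  g v < g w -> g' w < g' v ->
  (forall a b, ~~ ((a == v) && (b == w)) -> ~~ ((a == w) && (b == v)) ->
     ((g a < g b) = (g' a < g' b)) /\ ((g a == g b) = (g' a == g' b))) ->
  swapped s s' v w.
  move=> bs bs' lt gt h; split; rewrite ?bs ?bs' ?lt ?gt //.
  by move=> a b h1 h2; rewrite bs bs'; case: (h a b h1 h2) => -> ->.
Ltac compare_keys f x y z ne :=
  let a := fresh "a" in let b := fresh "b" in
  move=> a b; rewrite /f;
  case: (eqVneq a x) => [?|_]; [subst a|case: (eqVneq a y) => [?|_]; [subst a|case: (eqVneq a z) => [?|_]; [subst a|]]];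
  (case: (eqVneq b x) => [?|_]; [subst b|case: (eqVneq b y) => [?|_]; [subst b|case: (eqVneq b z) => [?|_]; [subst b|]]]);
  rewrite ?eqxx ?ne //=; by [case: (_ \in _) | do 2 case: (_ \in _)].
have s01 : swapped s0 s1 x y by apply: (swap_keys _ _ _ _ _ _ b0 b1); rewrite ?fE //; compare_keys f x y z ne.
have s02 : swapped s0 s2 y z by apply: (swap_keys _ _ _ _ _ _ b0 b2); rewrite ?fE //; compare_keys f x y z ne.
have s13 : swapped s1 s3 x z by apply: (swap_keys _ _ _ _ _ _ b1 b3); rewrite ?fE //; compare_keys f x y z ne.
have s24 : swapped s2 s4 x z by apply: (swap_keys _ _ _ _ _ _ b2 b4); rewrite ?fE //; compare_keys f x y z ne.
have s35 : swapped s3 s5 y z by apply: (swap_keys _ _ _ _ _ _ b3 b5); rewrite ?fE //; compare_keys f x y z ne.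
have s45 : swapped s4 s5 x y by apply: (swap_keys _ _ _ _ _ _ b4 b5); rewrite ?fE //; compare_keys f x y z ne.
have fq kx ky kz q : x < q < z -> q != y -> f kx ky kz q = if q \in A then 0 else 4.
  move=> lt nqy; rewrite /f (negbTE nqy).
  case: (eqVneq q x) => [eq|_]; first by rewrite eq in lt; lia.
  by case: (eqVneq q z) => [eq|_]; first by rewrite eq in lt; lia.
have inB q : x < q < z -> (q \in B) = (q \notin A).
  by rewrite -AB; case: (boolP (q \in A)) => [/dAB/negbTE->|].
have [h13 h24] : e s1 s3 /\ e s2 s4.
  case: hyp => hyp.
    apply: (hexagon_left xy yz s01 s02 s13 s24 s35 s45).
    rewrite (cover_contracted he xy s01).
    suff <- : restrict_arc x y A B = arc_at s0 x y by [].
    rewrite /restrict_arc /arc_at; congr (_, _, _, _); apply/setP=> q; rewrite !inE;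
      case: (boolP (x < q < y)) => lt; rewrite ?andbF ?andbT //=;
      have lt' : x < q < z by [lia]; have nqy : q != y by rewrite -val_eqE /=; lia.
      by rewrite b0 fE fq //; case: ifP.
    by rewrite b0 fE fq // inB //; case: ifP.
  apply: (hexagon_right xy yz s01 s02 s13 s24 s35 s45).
  rewrite (cover_contracted he yz s02).
    suff <- : restrict_arc y z A B = arc_at s0 y z by [].
  rewrite /restrict_arc /arc_at; congr (_, _, _, _); apply/setP=> q; rewrite !inE;
      case: (boolP (y < q < z)) => lt; rewrite ?andbF ?andbT //=;
      have lt' : x < q < z by [lia]; have nqy : q != y by rewrite -val_eqE /=; lia.
    by rewrite b0 fE fq //; case: ifP.
  by rewrite b0 fE fq // inB //; case: ifP.
case: (boolP (y \in A)) => yA.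
  move: h13; rewrite (cover_contracted he xz s13).
  suff <- : arc_at s1 x z = (x, z, A, B) by [].
  congr (_, _, _, _); apply/setP=> q; rewrite !inE b1 fE.
    case: (boolP (x < q < z)) => [lt|]; last by rewrite -AB negb_or => /andP[/negbTE->].
    case: (eqVneq q y) => [->|nqy]; first by rewrite fE yA.
    by rewrite fq //; case: ifP.
  case: (boolP (x < q < z)) => [lt|]; last by rewrite -AB negb_or => /andP[_ /negbTE->].
  rewrite inB //; case: (eqVneq q y) => [->|nqy]; first by rewrite fE yA.
  by rewrite fq //; case: ifP.
move: h24; rewrite (cover_contracted he xz s24).
suff <- : arc_at s2 x z = (x, z, A, B) by [].
congr (_, _, _, _); apply/setP=> q; rewrite !inE b2 fE.
  case: (boolP (x < q < z)) => [lt|]; last by rewrite -AB negb_or => /andP[/negbTE->].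
  case: (eqVneq q y) => [->|nqy]; first by rewrite fE (negbTE yA).
  by rewrite fq //; case: ifP.
case: (boolP (x < q < z)) => [lt|]; last by rewrite -AB negb_or => /andP[_ /negbTE->].
rewrite inB //; case: (eqVneq q y) => [->|nqy]; first by rewrite fE yA.
by rewrite fq //; case: ifP.
Qed.

Lemma congruence_arcs_superarc c c' : c \in arcs n -> c' \in arcs n -> subarc c c' ->
  c \notin congruence_arcs e -> c' \notin congruence_arcs e.
Proof.
case: c => [[[i j] A] B]; case: c' => [[[i' j'] A'] B'] arcA arcA' /=.
case/and5P=> ii ij jj /subsetP sA /subsetP sB.
case/arcsP: (arcA) => _ AB dAB; case/arcsP: (arcA') => ij' AB' dAB'.
have restrA v w : i' <= v -> v < w -> w <= j' -> restrict_arc v w A' B' \in arcs n.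
  move=> iv vw wj; apply/arcsP; split=> // q; rewrite !inE.
    by rewrite -andb_orl AB'; lia.
  by case/andP=> /dAB'/negbTE->.
have restr_restr v w v' w' : v <= v' -> w' <= w ->
  restrict_arc v' w' (A' :&: between v w) (B' :&: between v w) = restrict_arc v' w' A' B'.
  by move=> vv ww; congr (_, _, _, _); apply/setP=> q; rewrite !inE; case: (_ \in _) => //=; lia.
have full : restrict_arc i' j' A' B' = (i', j', A', B').
  congr (_, _, _, _); apply/setP=> q; rewrite !inE -AB';
  by case: (q \in A'); case: (q \in B').
have <- : restrict_arc i j A' B' = (i, j, A, B).
  congr (_, _, _, _); apply/setP=> q; rewrite !inE.
    rewrite -AB; apply/andP/idP=> [[qA']|qA]; last by rewrite sA qA.
    by case/orP=> // /sB qB'; move: (dAB' q qA'); rewrite qB'.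
  rewrite -AB; apply/andP/idP=> [[qB']|qB]; last by rewrite sB ?qB ?orbT.
  by case/orP=> // /sA /dAB'; rewrite qB'.
move=> h1; rewrite -full.
have h2 : restrict_arc i j' A' B' \notin congruence_arcs e.
  move: jj; case: (ltngtP j j') => // [jj _|/val_inj<- //].
  apply: (arc_extension ij jj); first by apply: restrA => //; apply: ltn_trans jj.
  by left; rewrite restr_restr ?(ltnW jj).
move: ii; case: (ltngtP i' i) => // [ii _|/val_inj-> //].
apply: (arc_extension ii (leq_trans ij jj)); first by rewrite restrA.
by right; rewrite restr_restr ?(ltnW ii).
Qed.

End Forcing.

(** * Exchanges of letters inside a congruence class *)
Section ClassOrder.
Variable n : nat.
Implicit Types (s t u m : 'S_n) (a b i j k q v w x y z : 'I_n) (A B D : {set 'I_n}).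
Variable e : rel 'S_n.
Hypothesis he : lattice_congruence e.

(** It suffices that a missing arc is passed correctly by the two letters, because
    the arc of the exchange is then one of its superarcs. *)
Lemma swap_across_arc u u' x y i k A B : swapped u u' x y ->
  (i, k, A, B) \in arcs n -> (i, k, A, B) \notin congruence_arcs e ->
  (x <= i) && (k <= y) || (y <= i) && (k <= x) ->
  (forall q, q \in A -> before u q x) -> (forall q, q \in B -> before u y q) ->
  e u u'.
Proof.
move=> sw arcA bad cases uA uB; have [ik AB dAB] := arcsP _ _ _ _ arcA.
have [bxy byx hsw] := sw.
have inA q : q \in A -> i < q < k by rewrite -AB => ->.
have inB q : q \in B -> i < q < k by rewrite -AB orbC => ->.
case/orP: cases => /andP[h1 h2].
  have xy : x < y by lia.
  rewrite (cover_contracted he xy sw).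
  apply: (congruence_arcs_superarc he arcA) bad; first exact: arc_at_arcs sw.
  rewrite /= h1 ik h2 /=; apply/andP; split; apply/subsetP=> q qA; rewrite !inE.
    by rewrite uA // andbT; have := inA q qA; lia.
  by rewrite uB // andbT; have := inB q qA; lia.
have yx : y < x by lia.
rewrite (congr_sym he) (cover_contracted he yx (swappedC sw)).
apply: (congruence_arcs_superarc he arcA) bad.
  exact: arc_at_arcs (swappedC sw).
rewrite /= h1 ik h2 /=; apply/andP; split; apply/subsetP=> q qA; rewrite !inE.
  have qx := uA q qA; have := inA q qA => lt.
  rewrite -hsw ?(before_trans qx bxy) ?andbT; first by lia.
    by rewrite (negbTE (before_neq qx)).
  by rewrite -!val_eqE /=; lia.
have qx := uB q qA; have := inB q qA => lt.
rewrite -hsw ?(before_trans bxy qx) ?andbT; first by lia.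
  by rewrite -!val_eqE /=; lia.
by rewrite -!val_eqE /=; lia.
Qed.

(** Sorting by adjacent exchanges: a pair ordered differently in u and s' and at
    minimal distance in u is adjacent, and exchanging it decreases the number of
    such pairs. *)
Lemma sort_by_swaps (Q : 'S_n -> Prop) s' :
  (forall u u' x y, Q u -> swapped u u' x y -> before s' y x -> e u u' /\ Q u') ->
  forall u, Q u -> e u s'.
Proof.
move=> step u; pose N u := #|[set ab : 'I_n * 'I_n | before u ab.1 ab.2 && before s' ab.2 ab.1]|.
have [m] := ubnP (N u); elim: m u => // m IH u ltm Qu.
pose dis (c : nat) := [exists a, exists b, [&& before u a b, before s' b a & pos u b - pos u a == c]].
case: (boolP [exists a, exists b, before u a b && before s' b a]) => [|none]; last first.
  suff -> : u = s' by apply: congr_refl.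
  apply: perm_before_inj => a b uab; apply: before_total; first by rewrite eq_sym (before_neq uab).
  apply: contra none => s'ba; apply/existsP; exists a; apply/existsP; exists b.
  by rewrite uab.
case/existsP=> a /existsP[b /andP[uab sba]].
have ex : exists c, dis c.
  exists (pos u b - pos u a); apply/existsP; exists a; apply/existsP; exists b.
  by rewrite uab sba eqxx.
case: (ex_minnP ex) => c /existsP[x /existsP[y /and3P[uxy syx /eqP ec]]] cmin.
have [q xq qy|u' sw] := @swap_exists _ u x y uxy.
  have cle v w : before u v w -> before s' w v -> c <= pos u w - pos u v.
    move=> uvw swv; apply: cmin; apply/existsP; exists v; apply/existsP; exists w.
    by rewrite uvw swv eqxx.
  case: (boolP (before s' q x)) => [h|]; first by have := cle _ _ xq h; rewrite /before in xq qy; lia.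
  have qx : q != x by rewrite eq_sym (before_neq xq).
  move/(before_total qx)=> h.
  have := cle _ _ qy (before_trans syx h); rewrite /before in xq qy; lia.
have [euu' Qu'] := step _ _ _ _ Qu sw syx.
apply: (congr_trans he euu'); apply: IH => //; rewrite -ltnS; apply: leq_trans ltm; rewrite ltnS.
have [_ u'yx hsw] := sw.
apply: proper_card; rewrite properE; apply/andP; split.
  apply/subsetP=> [[v w]]; rewrite !inE /= => /andP[uvw]; rewrite andbC.

  case: (boolP ((v == x) && (w == y))) => [/andP[/eqP ev /eqP ew]|n1].
    by move: uvw; rewrite ev ew (before_asym u'yx).
  case: (boolP ((v == y) && (w == x))) => [/andP[/eqP-> /eqP->]|n2]; last by rewrite hsw // uvw andbT.
  by rewrite (before_asym syx).
apply/subsetPn; exists (x, y); rewrite !inE /= ?uxy ?syx //.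
by rewrite (before_asym u'yx).
Qed.

Lemma refinement_linear t u (f : 'I_n -> nat) :
  (forall i j, class_order e t i j -> f i <= f j) ->
  (forall i j, before u i j = (f i < f j) || (f i == f j) && before t i j) ->
  e t u.
Proof.
move=> fmono bu; apply: (class_linear_extension he) => i j tij.
have [->//|ne] := eqVneq i j; apply: ltnW; rewrite -/(before u i j) bu.
rewrite (class_order_before (congr_refl he t) tij ne) andbT.
by rewrite orbC -leq_eqVlt fmono.
Qed.

(** Two values incomparable in the order of a class are adjacent in some
    permutation of the class, right after the down-set D, and exchanging them stays
    in the class. *)
Lemma incomparable_arc t D i k : i < k -> i \notin D -> k \notin D ->
  (forall a b, class_order e t a b -> b \in D -> a \in D) ->
  (forall a, class_order e t a i -> (a == i) || (a \in D)) ->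
  (forall a, class_order e t a k -> (a == k) || (a \in D)) ->
  (i, k, [set q in between i k | q \in D], [set q in between i k | q \notin D])
    \notin congruence_arcs e.
Proof.
move=> ik iD kD Dclosed Di Dk.
have ki : (k == i) = false by rewrite -val_eqE /=; lia.
(* The ranks of i and k are 1 and 2 in some order; ties are broken as in t. *)
pose f (ci ck : nat) v := if v \in D then 0 else if v == i then ci else if v == k then ck else 3.
have fE ci ck : (f ci ck i = ci) * (f ci ck k = ck).
  by rewrite /f (negbTE iD) (negbTE kD) eqxx ki eqxx.
have fmono ci ck : ci < 3 -> ck < 3 -> forall a b, class_order e t a b -> f ci ck a <= f ci ck b.
  move=> c1 c2 a b ab; rewrite {2}/f; case: ifPn => [bD|bD]; first by rewrite /f (Dclosed _ _ ab bD).
  case: eqVneq => [eb|bi].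
    by rewrite eb in ab; case/orP: (Di a ab) => [/eqP->|aD]; rewrite ?fE // /f aD.
  case: eqVneq => [eb|bk].
    by rewrite eb in ab; case/orP: (Dk a ab) => [/eqP->|aD]; rewrite ?fE // /f aD.
  by rewrite /f; case: ifP => // _; case: ifP => [_|_]; [|case: ifP => // _]; apply: ltnW.
have [u bu] := refinement (f 1 2) t; have [u' bu'] := refinement (f 2 1) t.
have tu : e t u by apply: refinement_linear bu; apply: fmono.
have tu' : e t u' by apply: refinement_linear bu'; apply: fmono.
have sw : swapped u u' i k.
  split; rewrite ?bu ?bu' ?fE //.
  move=> a b; rewrite bu bu' /f.
  case: (boolP (a \in D)) => aD; case: (boolP (b \in D)) => bD //.
  - by case: (b == i); case: (b == k); rewrite ?andbF.
  - by case: (a == i); case: (a == k).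
  - case: (eqVneq a i) => [?|ai]; [subst a|case: (eqVneq a k) => [?|ak]; [subst a|]];
    (case: (eqVneq b i) => [?|bi]; [subst b|case: (eqVneq b k) => [?|bk]; [subst b|]]);
    by rewrite ?eqxx ?ki ?(eq_sym i k) ?ki.
have := cover_contracted he ik sw; rewrite (congr_trans he (etrans (congr_sym he _ _) tu) tu').
move/esym; suff -> : arc_at u i k = (i, k, [set q in between i k | q \in D],
    [set q in between i k | q \notin D]) by [].
congr (_, _, _, _); apply/setP=> q; rewrite !inE bu fE;
  case: (boolP (i < q < k)) => // lt; rewrite /f;
  have -> : (q == i) = false by [rewrite -val_eqE /=; lia];
  by have -> : (q == k) = false by [rewrite -val_eqE /=; lia]; case: ifP.
Qed.

(** A point f of the cone of a class may be perturbed into g without leaving this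
    cone as soon as every two coordinates that g separates are separated by a
    missing arc which f passes correctly. *)
Lemma split_levels t (f g : 'I_n -> nat) :
  (forall i j, class_order e t i j -> f i <= f j) ->
  (forall i j, f i < f j -> g i < g j) ->
  (forall x y, x < y -> f x = f y -> g x <> g y -> exists i k A B,
     [/\ (i, k, A, B) \in arcs n, (i, k, A, B) \notin congruence_arcs e,
         (x <= i) && (k <= y),
         forall q, q \in A -> f q < f x & forall q, q \in B -> f x < f q]) ->
  forall i j, class_order e t i j -> g i <= g j.
Proof.
move=> fmono fg bad.
have [u bu] := refinement f t; have [u' bu'] := refinement g t.
have tu : e t u by apply: refinement_linear bu.
pose Q (v : 'S_n) := (forall a b, f a < f b -> before v a b) /\
   (forall a b, g a = g b -> before t a b -> before v a b).
have euu' : e u u'.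
  apply: (sort_by_swaps (Q := Q)).
    move=> v v' x y [Q1 Q2] sw; rewrite bu' => gyx; have [vxy v'yx hsw] := sw.
    have gne : g y < g x.
      case/orP: gyx => // /andP[/eqP gyx tyx]; have := Q2 y x gyx tyx.
      by rewrite (before_asym vxy).
    have fxy : f x = f y.
      case: (ltngtP (f x) (f y)) => // [/fg|/Q1]; first by lia.
      by rewrite (before_asym vxy).
    split.
      case: (ltngtP x y) => [xy|yx|/val_inj exy]; last by rewrite exy before_irr in vxy.
        have [|i [k [A [B [arcA nA xk fA fB]]]]] := bad x y xy fxy; first by lia.
        apply: (swap_across_arc sw arcA nA); first by rewrite xk.
          by move=> q /fA; apply: Q1.
        by move=> q /fB; rewrite fxy; apply: Q1.
      have [|i [k [A [B [arcA nA xk fA fB]]]]] := bad y x yx (esym fxy); first by lia.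
      apply: (swap_across_arc sw arcA nA); first by rewrite xk orbT.
        by move=> q /fA; rewrite -fxy; apply: Q1.
      by move=> q /fB; apply: Q1.
    split=> a b lt; have ne1 : ~~ ((a == x) && (b == y)).
    - by apply/negP=> /andP[/eqP ea /eqP eb]; move: lt; rewrite ea eb; lia.
    - have ne2 : ~~ ((a == y) && (b == x)).
        by apply/negP=> /andP[/eqP ea /eqP eb]; move: lt; rewrite ea eb; lia.
      by rewrite -hsw //; apply: Q1.
    - by apply/negP=> /andP[/eqP ea /eqP eb]; move: lt; rewrite ea eb; lia.
    - have ne2 : ~~ ((a == y) && (b == x)).
        by apply/negP=> /andP[/eqP ea /eqP eb]; move: lt; rewrite ea eb; lia.
      by rewrite -hsw //; apply: Q2.
  split=> a b; first by rewrite bu => ->.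
  move=> gab tab; rewrite bu tab andbT; case: (ltngtP (f a) (f b)) => // /fg; lia.
move=> i j ij; have := class_order_before (congr_trans he tu euu') ij.
have [->//|ne] := eqVneq i j; move=> /(_ isT); rewrite bu'.
by case/orP=> [/ltnW//|/andP[/eqP-> _]].
Qed.

End ClassOrder.

(** * Walls of a preposet *)
Section Walls.
Variable n : nat.
Implicit Types (a b i j k q v w x y z : 'I_n) (D : {set 'I_n}) (p U V : rel 'I_n).

Definition converse p : rel 'I_n := fun x y => p y x.

Definition equivalent p : rel 'I_n := fun x y => p x y && p y x.

Definition strictly p : rel 'I_n := fun x y => p x y && ~~ p y x.

Definition covers p : rel 'I_n := fun x y =>
  strictly p x y && [forall q, p x q ==> p q y ==> (p q x || p y q)].

Definition downset p D := forall x y, p x y -> y \in D -> x \in D.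

(** U a b means that there is a wall over the open interval ]a, b[. It is
    impassable outside of any down-set which contains this interval. *)
Definition walls_block p U := forall D a b, U a b -> downset p D ->
  (forall q, a < q < b -> q \in D) ->
  forall q q', q \notin D -> q' \notin D -> q <= a -> b <= q' ->
  ~~ (p q q' || p q' q).

(** The down-set D plays the part of the letters before x and y in a linear
    extension in which the classes of x and y come next. *)
Definition walls_exist p U V := forall D x y, x < y ->
  ~~ p x y -> ~~ p y x -> x \notin D -> y \notin D -> downset p D ->
  (forall q, p q x -> p x q || (q \in D)) ->
  (forall q, p q y -> p y q || (q \in D)) ->
  (forall q, x < q < y -> ~~ equivalent p x q && ~~ equivalent p y q) ->
  exists a b, [/\ x <= a, a < b, b <= y &
    (U a b /\ forall q, a < q < b -> q \in D) \/
    (V a b /\ forall q, a < q < b -> q \notin D)].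

(** What remains of a simple congruence once its class order is forgotten: U and V
    are the pairs of ends of the missing up arcs and down arcs. Reversing the
    preposet exchanges U and V, which halves the work. *)
Definition wall_system p U V :=
  [/\ preposet p, walls_block p U, walls_block (converse p) V
    & walls_exist p U V].

Lemma equivalentC p x y : equivalent p x y = equivalent p y x.
Proof. exact: andbC. Qed.

Lemma equivalent_converse p x y : equivalent (converse p) x y = equivalent p x y.
Proof. exact: andbC. Qed.

Lemma strictly_converse p x y : strictly (converse p) x y = strictly p y x.
Proof. by []. Qed.

Lemma covers_converse p x y : covers (converse p) x y = covers p y x.
Proof.
rewrite /covers (strictly_converse p); congr (_ && _); apply: eq_forallb => q.
by rewrite /converse orbC; case: (p q x); case: (p y q).
Qed.

Lemma preposet_converse p : preposet p -> preposet (converse p).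
Proof. by case=> r t; split=> [x|x y z h1 h2]; [apply: r|apply: (t x) h2 h1]. Qed.

Lemma wall_system_converse p U V : wall_system p U V -> wall_system (converse p) V U.
Proof.
case=> pp bU bV ex; split=> //; first exact: preposet_converse.
move=> D x y xy pyx pxy xD yD up Dx Dy cl; have [refl tr] := pp.
(* The elements that come after the classes of x and y when D comes before. *)
pose D' := [set q | [&& q \notin D, ~~ equivalent p x q & ~~ equivalent p y q]].
have Dequiv z : (forall q, p z q -> p q z || (q \in D)) -> z \notin D ->
    forall q q', p q' q -> equivalent p z q' -> equivalent p z q || (q \in D).
  move=> Dz zD q q' q'q /andP[zq' q'z]; have zq := tr _ _ _ zq' q'q.
  by rewrite /equivalent zq; apply: Dz.
have [||||||a [b [xa ab by' h]]] := ex D' x y xy pxy pyx.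
- by rewrite inE /equivalent refl andbF.
- by rewrite inE /equivalent !refl !andbF.
- move=> q' q q'q; rewrite !inE => /and3P[qD nx ny]; apply/and3P; split.
  + by apply: contra qD => q'D; apply: up q'D.
  + by apply/negP=> /(Dequiv x Dx xD _ _ q'q); rewrite (negbTE nx) (negbTE qD).
  + by apply/negP=> /(Dequiv y Dy yD _ _ q'q); rewrite (negbTE ny) (negbTE qD).
- move=> q qx; case xq: (p x q) => //=; rewrite inE /equivalent xq /=.
  apply/andP; split; first by apply: contra xD => qD; apply: (up _ q).
  by apply: contra pyx => /andP[yq _]; apply: tr yq qx.
- move=> q qy; case yq: (p y q) => //=; rewrite inE /equivalent yq /= andbT.
  apply/andP; split; first by apply: contra yD => qD; apply: (up _ q).
  by apply: contra pxy => /andP[xq _]; apply: tr xq qy.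
- move=> q /cl; by rewrite !(equivalent_converse p).
exists a, b; split=> //; case: h => [[Uab h]|[Vab h]]; [right|left]; split=> // q lt.
  by have := h q lt; rewrite inE => /andP[].
have := h q lt; rewrite inE; have := cl q; rewrite !(equivalent_converse p).
have -> : x < q < y by lia. 
by move=> /(_ isT)/andP[-> ->]; rewrite !andbT negbK.
Qed.

Section Preposet.
Variable p : rel 'I_n.
Hypothesis pp : preposet p.

Let refl : reflexive p. Proof. by case: pp. Qed.
Let tr : transitive p. Proof. by case: pp. Qed.

Lemma down_smaller x y : strictly p x y -> #|[set q | p q x]| < #|[set q | p q y]|.
Proof.
case/andP=> xy nyx; apply: proper_card; rewrite properE; apply/andP; split.
  by apply/subsetP=> q; rewrite !inE => /tr->.
by apply/subsetPn; exists y; rewrite !inE.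
Qed.

Lemma covers_below x q : strictly p q x -> exists2 z, covers p z x & p q z.
Proof.
move=> qx; case: (@arg_maxnP _ q (fun z => p q z && strictly p z x)
    (fun z => #|[set w | p w z]|)) => [|z /andP[qz zx] zmax]; first by rewrite refl.
exists z => //; rewrite /covers zx; apply/forallP=> w; apply/implyP=> zw; apply/implyP=> wx.
apply: contraT; rewrite negb_or => /andP[nwz nxw].
have := zmax w; rewrite (tr qz zw) /strictly wx nxw => /(_ isT).
have sw : strictly p z w by rewrite /strictly zw.
by have := down_smaller sw; lia.
Qed.

End Preposet.

Section WallSystem.
Variables p U V : rel 'I_n.
Hypothesis wsys : wall_system p U V.

Let refl : reflexive p. Proof. by case: wsys => [[]]. Qed.
Let tr : transitive p. Proof. by case: wsys => [[]]. Qed.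

Lemma walls_blockP : walls_block p U. Proof. by case: wsys. Qed.

Lemma covers_incomparable j x y :
  covers p j x -> covers p j y -> ~~ equivalent p x y -> ~~ p x y && ~~ p y x.
Proof.
case/andP=> /andP[jx nxj] /forallP cx /andP[/andP[jy nyj] /forallP cy] ne.
have nxy : ~~ p x y.
  apply: contra ne => xy; rewrite /equivalent xy /=.
  by have := cy x; rewrite jx xy (negbTE nxj).
rewrite nxy /=; apply: contra nxy => yx.
by have := cx y; rewrite jy yx (negbTE nyj).
Qed.

Definition separates a b x y :=
  (forall q, equivalent p x q -> q <= a) /\ (forall q, equivalent p y q -> b <= q).

(** Place x and y right after the elements strictly below them. The wall between x
    and y that exists there is not in V, as j is below both and would connect its
    two sides. It contains an element of the class of j, as otherwise this class
    could be moved above the wall and again connect its two sides. *)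
Lemma upper_covers_wall_ordered j x y : x < y ->
  (forall q, x < q < y -> ~~ equivalent p x q && ~~ equivalent p y q) ->
  covers p j x -> covers p j y -> ~~ equivalent p x y ->
  exists a b, [/\ U a b, a < b, forall q, a < q < b -> strictly p q x || strictly p q y,
    exists2 q, equivalent p j q & a < q < b & separates a b x y].
Proof.
move=> xy cl cx cy ne; have /andP[nxy nyx] := covers_incomparable cx cy ne.
have [_ bU bV ex] := wsys.
pose D := [set q | strictly p q x || strictly p q y].
have Dnot q : equivalent p x q || equivalent p y q -> q \notin D.
  rewrite inE /strictly; case/orP=> /andP[h1 h2]; apply/norP; split; apply/negP=> /andP[h3 h4].
  - by rewrite h1 in h4.
  - by case/negP: nxy; apply: tr h3.
  - by case/negP: nyx; apply: tr h3.
  - by rewrite h1 in h4.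
have down : downset p D.
  move=> q q' qq'; rewrite !inE /strictly => /orP[/andP[q'x nxq']|/andP[q'y nyq']].
    rewrite (tr qq' q'x); apply/orP; left; apply: contra nxq' => xq; exact: tr xq qq'.
  rewrite (tr qq' q'y); apply/orP; right; apply: contra nyq' => yq; exact: tr yq qq'.
have [jx nxj] : p j x /\ ~~ p x j by case/andP: cx => /andP[].
have [jy nyj] : p j y /\ ~~ p y j by case/andP: cy => /andP[].
have [|||||a [b [xa ab by' h]]] := ex D x y xy nxy nyx _ _ down.
- by apply: Dnot; rewrite /equivalent refl.
- by apply: Dnot; rewrite /equivalent !refl orbT.
- by move=> q qx; rewrite inE /strictly qx /=; case: (p x q).
- by move=> q qy; rewrite inE /strictly qy /=; case: (p y q); rewrite ?orbT.
- exact: cl.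
case: h => [[Uab abD]|[Vab abD]]; last first.
  (* The elements that come after the classes of x and y. *)
  pose E := [set q | [&& q \notin D, ~~ equivalent p x q & ~~ equivalent p y q]].
  have upE : downset (converse p) E.
    move=> q q' q'q; rewrite !inE => /and3P[q'D nx ny]; apply/and3P; split.
    + by apply: contra q'D => qD; have := down q' q q'q; rewrite !inE; apply.
    + apply: contra q'D => /andP[xq qx]; have q'x := tr q'q qx.
      by move: nx; rewrite /equivalent /strictly q'x andbT => ->.
    + apply: contra q'D => /andP[yq qy]; have q'y := tr q'q qy.
      by move: ny; rewrite /equivalent /strictly q'y andbT => ->; rewrite orbT.
  have xE : x \notin E by rewrite inE /equivalent refl /= andbF.
  have yE : y \notin E by rewrite inE /equivalent !refl /= !andbF.
  have jE : j \notin E by rewrite inE inE /strictly jx nxj.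
  have ablt q : a < q < b -> q \in E.
    case/andP=> h1 h2; rewrite inE abD ?h1 //= cl //.
    by rewrite (leq_ltn_trans xa h1) (leq_trans h2 by').
  case: (leqP j a) => ja.
    by have := bV E a b Vab upE ablt j y jE yE ja by'; rewrite /converse jy orbT.
  have bj : b <= j by rewrite leqNgt; apply: contra jE => jb; apply: ablt; rewrite ja.
  by have := bV E a b Vab upE ablt x j xE jE xa bj; rewrite /converse jx.
have xD : x \notin D by apply: Dnot; rewrite /equivalent refl.
have yD : y \notin D by apply: Dnot; rewrite /equivalent !refl orbT.
exists a, b; split=> //.
- by move=> q lt; have := abD q lt; rewrite inE.
- have [/exists_inP[q jq lt]|none] := boolP [exists (q | equivalent p j q), a < q < b]; first by exists q.
  (* The class of j is maximal in D, so that removing it leaves a down-set. *)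
  pose D' := [set q in D | ~~ equivalent p j q].
  have down' : downset p D'.
    move=> q q' qq'; rewrite inE => /andP[q'D nj]; rewrite inE (down _ _ qq') //=.
    apply: contra nj => /andP[jq qj]; rewrite /equivalent (tr jq qq') /=.
    move: q'D; rewrite inE /strictly; have jq' := tr jq qq'.
    case/orP=> /andP[h1 h2].
      by case/andP: cx => _ /forallP/(_ q'); rewrite jq' h1 (negbTE h2) orbF.
    by case/andP: cy => _ /forallP/(_ q'); rewrite jq' h1 (negbTE h2) orbF.
  have abD' q : a < q < b -> q \in D'.
    move=> lt; rewrite inE abD //=; apply/negP=> jq; case/negP: none.
    by apply/exists_inP; exists q.
  have xD' : x \notin D' by rewrite inE (negbTE xD).
  have yD' : y \notin D' by rewrite inE (negbTE yD).
  have jD' : j \notin D' by rewrite inE /equivalent refl andbF.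
  case: (leqP j a) => ja.
    by have := bU D' a b Uab down' abD' j y jD' yD' ja by'; rewrite jy.
  have bj : b <= j by rewrite leqNgt; apply: contra jD' => jb; apply: abD'; rewrite ja.
  by have := bU D' a b Uab down' abD' x j xD' jD' xa bj; rewrite jx orbT.
- split=> q xq; have qD : q \notin D by [apply: Dnot; rewrite xq ?orbT].
    rewrite leqNgt; apply/negP=> aq; case: (ltnP q b) => qb.
      by move: qD; rewrite abD ?aq.
    by have := bU D a b Uab down abD x q xD qD xa qb; case/andP: xq => ->.
  rewrite leqNgt; apply/negP=> qb; case: (ltnP a q) => aq.
    by move: qD; rewrite abD ?aq.
  by have := bU D a b Uab down abD q y qD yD aq by'; case/andP: xq => _ ->.
Qed.

(** The general case follows by passing to the closest representatives of the two
    classes. *)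
Lemma upper_covers_wall_weak j x y :
  covers p j x -> covers p j y -> ~~ equivalent p x y ->
  exists a b, [/\ U a b, a < b, forall q, a < q < b -> strictly p q x || strictly p q y,
    exists2 q, equivalent p j q & a < q < b & separates a b x y \/ separates a b y x].
Proof.
move=> cx cy ne.
have eqtr z w v : equivalent p z w -> equivalent p w v -> equivalent p z v.
  by case/andP=> h1 h2 /andP[h3 h4]; rewrite /equivalent (tr h1 h3) (tr h4 h2).
have eqstr z w v : equivalent p z w -> strictly p v z = strictly p v w.
  case/andP=> h1 h2; apply/andP/andP=> [] [h3 h4]; split.
  - exact: tr h3 h1.
  - by apply: contra h4; apply: tr.
  - exact: tr h3 h2.
  - by apply: contra h4; apply: tr.
have eqcov z w v : equivalent p z w -> covers p v z -> covers p v w.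
  move=> zw; rewrite /covers (eqstr _ _ _ zw) => /andP[-> /forallP h] /=.
  case/andP: zw => zw wz; apply/forallP=> q; apply/implyP=> vq; apply/implyP=> qw.
  have := h q; rewrite vq (tr qw wz) /= => /orP[->//|zq].
  by rewrite (tr wz zq) orbT.
pose d (z w : 'I_n) := (z - w) + (w - z).
have : exists c : nat, [exists z, exists w, [&& equivalent p x z, equivalent p y w & d z w == c]].
  exists (d x y); apply/existsP; exists x; apply/existsP; exists y.
  by rewrite /equivalent !refl eqxx.
move=> exc; case: (ex_minnP exc) => c /existsP[z /existsP[w /and3P[xz yw /eqP dzw]]] cmin.
have {}cmin z' w' : equivalent p x z' -> equivalent p y w' -> d z w <= d z' w'.
  move=> xz' yw'; rewrite dzw; apply: cmin; apply/existsP; exists z'.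
  by apply/existsP; exists w'; rewrite xz' yw' eqxx.
have cz := eqcov _ _ _ xz cx; have cw := eqcov _ _ _ yw cy.
have zw : ~~ equivalent p z w.
  apply: contra ne => zw; apply: eqtr xz (eqtr _ _ _ zw _).
  by rewrite equivalentC.
have sep : forall a b, separates a b z w -> separates a b x y.
  move=> a b [h1 h2]; split=> q h; [apply: h1|apply: h2]; apply: eqtr h.
    by rewrite equivalentC.
  by rewrite equivalentC.
have sep' : forall a b, separates a b w z -> separates a b y x.
  move=> a b [h1 h2]; split=> q h; [apply: h1|apply: h2]; apply: eqtr h.
    by rewrite equivalentC.
  by rewrite equivalentC.
case: (ltngtP z w) => [ltzw|ltwz|/val_inj ezw].
- have [q /andP[zq qw]|a [b [Uab ab abD jab sepab]]] := upper_covers_wall_ordered ltzw _ cz cw zw.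
    apply/andP; split; apply/negP=> h.
      have := cmin q w (eqtr _ _ _ xz h) yw; rewrite /d; clear -zq qw; lia.
    have := cmin z q xz (eqtr _ _ _ yw h); rewrite /d; clear -zq qw; lia.
  exists a, b; split=> //; last by left; apply: sep.
  by move=> q /abD; rewrite (eqstr _ _ _ xz) (eqstr _ _ _ yw).
- rewrite equivalentC in zw.
  have [q /andP[zq qw]|a [b [Uab ab abD jab sepab]]] := upper_covers_wall_ordered ltwz _ cw cz zw.
    apply/andP; split; apply/negP=> h.
      have := cmin z q xz (eqtr _ _ _ yw h); rewrite /d; clear -zq qw; lia.
    have := cmin q w (eqtr _ _ _ xz h) yw; rewrite /d; clear -zq qw; lia.
  exists a, b; split=> //; last by right; apply: sep'.
  by move=> q /abD; rewrite (eqstr _ _ _ xz) (eqstr _ _ _ yw) orbC.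
- by rewrite ezw /equivalent refl in zw.
Qed.

End WallSystem.

Section ClosestWall.
Variables p U V : rel 'I_n.
Hypothesis wsys : wall_system p U V.

Let pp : preposet p. Proof. by case: wsys. Qed.
Let refl : reflexive p. Proof. by case: wsys => [[]]. Qed.
Let tr : transitive p. Proof. by case: wsys => [[]]. Qed.

(** An element q below x but not below j lies below another lower cover z of x, and
    the dual wall between j and z leaves q on the side of z. This wall contains an
    element of the class of x. *)
Lemma lower_class_separated j x q : covers p j x -> strictly p q x -> ~~ p q j ->
  exists2 x', equivalent p x x' &
    (forall j', equivalent p j j' -> j' < x') /\ x' < q \/
    (forall j', equivalent p j j' -> x' < j') /\ q < x'.
Proof.
move=> cj qx nqj; have [z cz qz] := covers_below pp qx.
have nzj : ~~ equivalent p j z.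
  by apply: contra nqj => /andP[_ zj]; apply: tr zj.
have wsys' := wall_system_converse wsys.
have [|||a [b [Vab ab abE [x' xx' lt] sep]]] := @upper_covers_wall_weak _ _ _ wsys' x j z.
- by rewrite (covers_converse p).
- by rewrite (covers_converse p).
- by rewrite (equivalent_converse p).
rewrite (equivalent_converse p) in xx'; exists x' => //.
have [jx xnj] : p j x /\ ~~ p x j by case/andP: cj => /andP[].
have [zx xnz] : p z x /\ ~~ p x z by case/andP: cz => /andP[].
have jcov w : p j w -> p w x -> p w j || p x w.
  by case/andP: cj => _ /forallP/(_ w) h h1 h2; move: h; rewrite h1 h2.
pose E := [set w | strictly p j w || strictly p z w].
have upE : downset (converse p) E.
  move=> w w' w'w; rewrite !inE /strictly.
  case/orP=> /andP[h1 h2].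
    rewrite (tr h1 w'w); apply/orP; left; apply: contra h2 => wj; exact: tr w'w wj.
  rewrite (tr h1 w'w); apply/orP; right; apply: contra h2 => wj; exact: tr w'w wj.
have abE' w : a < w < b -> w \in E by move=> /abE; rewrite inE.
have qE : q \notin E.
  rewrite inE; apply/norP; split; apply/negP=> /andP[h1 h2].
    case/andP: qx => qx nxq; have := jcov q h1 qx.
    by rewrite (negbTE h2) (negbTE nxq).
  by rewrite qz in h2.
have zE : z \notin E.
  rewrite inE; apply/norP; split; apply/negP=> /andP[h1 h2]; last by rewrite h1 in h2.
  by have := jcov z h1 zx; rewrite (negbTE h2) (negbTE xnz).
have := walls_blockP wsys' Vab upE abE'; rewrite /converse => block.
have qside : (q <= a) || (b <= q).
  case: (leqP q a) => //= aq; rewrite leqNgt; apply: contra qE => qb.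
  by apply: abE'; rewrite aq.
have /andP[lta ltb] := lt.

case: sep => [[hj hz]|[hz hj]].
- left; split.
    move=> j' jj'; apply: leq_ltn_trans lta; apply: hj.
    by rewrite (equivalent_converse p).
  have bz : b <= z by apply: hz; rewrite /equivalent /converse refl.
  case/orP: qside => [qa|bq]; last exact: leq_trans bq.
  by have := block q z qE zE qa bz; rewrite qz orbT.
- right; split.
    move=> j' jj'; apply: (leq_trans ltb); apply: hj.
    by rewrite (equivalent_converse p).
  have za : z <= a by apply: hz; rewrite /equivalent /converse refl.
  case/orP: qside => [qa|bq]; first exact: leq_ltn_trans lta.
  by have := block z q zE qE za bq; rewrite qz.
Qed.

(** The wall lies entirely below j: by [lower_class_separated], any other element in
    it would be separated from j by an element of the class of x or of y, and these
    classes avoid the wall. *)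
Lemma upper_covers_wall j x y :
  covers p j x -> covers p j y -> ~~ equivalent p x y ->
  exists a b, [/\ U a b, a < b, forall q, a < q < b -> p q j,
    exists2 q, equivalent p j q & a < q < b & separates p a b x y \/ separates p a b y x].
Proof.
move=> cx cy ne; have [a [b [Uab ab abD jab sep]]] := upper_covers_wall_weak wsys cx cy ne.
exists a, b; split=> //; move=> q lt; apply: contraT => nqj.
have [w qw [cw wsep]] : exists2 w, strictly p q w & covers p j w /\
    (forall w', equivalent p w w' -> (w' <= a) || (b <= w')).
  case/orP: (abD q lt) => h; [exists x|exists y] => //; split=> // w' ww';
  case: sep => [[h1 h2]|[h1 h2]]; first [by rewrite h1|by rewrite h2 ?orbT].
have [j' jj' ltj'] := jab.
have [w' /wsep ww' h] := lower_class_separated cw qw nqj.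
case: h => [[/(_ j' jj') h1 h2]|[/(_ j' jj') h1 h2]]; clear -ltj' lt h1 h2 ww'; lia.
Qed.

End ClosestWall.

End Walls.

(** * Hasse diagrams of preposets *)
Lemma connect_invariant (T : finType) (r : rel T) (P : T -> Prop) x y :
  (forall v w, P v -> r v w -> P w) -> connect r x y -> P x -> P y.
Proof.
move=> step /connectP[c]; elim: c x => [|z c IH] x /=; first by move=> _ ->.
by case/andP=> rxz pth ey Px; apply: (IH z) => //; apply: step rxz.
Qed.

Section HasseDiagram.
Variable n : nat.
Implicit Types (a b i j k q v w x y z : 'I_n) (D I J K : {set 'I_n}).
Variable p : rel 'I_n.
Hypothesis pp : preposet p.

Let refl : reflexive p. Proof. by case: pp. Qed.
Let tr : transitive p. Proof. by case: pp. Qed.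

Definition class_of x : {set 'I_n} := [set y | equivalent p x y].

Lemma equivalent_rel : {in [set: 'I_n] & &, equivalence_rel (fun i j => p i j && p j i)}.
Proof.
move=> x y z _ _ _; rewrite refl; split=> // /andP[xy yx].
by apply/andP/andP=> [] [h1 h2]; split; [exact: tr yx h1|exact: tr h2 xy|exact: tr xy h1|exact: tr h2 yx].
Qed.

Lemma equivalent_refl x : equivalent p x x. Proof. by rewrite /equivalent refl. Qed.

Lemma equivalent_trans : transitive (equivalent p).
Proof. by move=> y x z /andP[h1 h2] /andP[h3 h4]; rewrite /equivalent (tr h1 h3) (tr h4 h2). Qed.

Lemma nodesP I : reflect (exists x, I = class_of x) (I \in nodes (hasse p)).
Proof.
apply: (iffP imsetP) => [[x _ ->]|[x ->]]; exists x => //.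
  by apply/setP=> y; rewrite !inE.
by apply/setP=> y; rewrite !inE.
Qed.

Lemma class_node x : class_of x \in nodes (hasse p).
Proof. by apply/nodesP; exists x. Qed.

Lemma class_mem x : x \in class_of x.
Proof. by rewrite inE equivalent_refl. Qed.

Lemma class_eq x y : (class_of x == class_of y) = equivalent p x y.
Proof.
apply/eqP/idP=> [/setP/(_ y)|xy]; first by rewrite !inE equivalent_refl.
apply/setP=> z; rewrite !inE; apply/idP/idP; apply: equivalent_trans => //.
by rewrite equivalentC.
Qed.

Lemma class_lt_class x y : class_lt p (class_of x) (class_of y) = strictly p x y.
Proof.
rewrite /class_lt class_eq /equivalent /strictly; apply/andP/andP.
  case=> ne /exists_inP[z]; rewrite inE => /andP[xz zx] /exists_inP[w].
  rewrite inE => /andP[yw wy] zw; have xy := tr xz (tr zw wy).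
  by split=> //; move: ne; rewrite xy.
case=> xy nyx; rewrite xy (negbTE nyx); split=> //.
by apply/exists_inP; exists x; rewrite ?class_mem //; apply/exists_inP; exists y; rewrite ?class_mem.
Qed.

Lemma class_cover_class x y : class_cover p (class_of x) (class_of y) = covers p x y.
Proof.
rewrite /class_cover /covers class_lt_class; case: (boolP (strictly p x y)) => //= sxy.
apply/idP/forallP => [none q|h].
  apply/implyP=> xq; apply/implyP=> qy; apply: contraR none; rewrite negb_or => /andP[nqx nyq].
  apply/exists_inP; exists (class_of q); first exact: class_node.
  by rewrite !class_lt_class /strictly xq qy nqx.
apply/negP=> /exists_inP[K /nodesP[q ->]]; rewrite !class_lt_class => /andP[/andP[xq nqx] /andP[qy nyq]].
by have := h q; rewrite xq qy (negbTE nqx) (negbTE nyq).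
Qed.

Lemma edge_class x y : edge (hasse p) (class_of x) (class_of y) = covers p x y.
Proof.
by rewrite /edge inE /= class_cover_class inE /= -!/(nodes (hasse p)) !class_node.
Qed.

Lemma edge_nodes I J : edge (hasse p) I J -> I \in nodes (hasse p) /\ J \in nodes (hasse p).
Proof. by rewrite /edge inE inE => /andP[/andP[]]. Qed.

Lemma edgeP I J : edge (hasse p) I J ->
  exists x y, [/\ I = class_of x, J = class_of y & covers p x y].
Proof.
move=> IJ; have [/nodesP[x eI] /nodesP[y eJ]] := edge_nodes IJ.
by exists x, y; split=> //; rewrite -edge_class -eI -eJ.
Qed.

Lemma adjacentP I J : adjacent (hasse p) I J ->
  exists x y, [/\ I = class_of x, J = class_of y & covers p x y || covers p y x].
Proof.
case/orP=> /edgeP[x [y [-> -> h]]]; first by exists x, y; rewrite h.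
by exists y, x; rewrite h orbT.
Qed.

Lemma covers_above x q : strictly p x q -> exists2 z, covers p x z & p z q.
Proof.
move=> xq; have [z cz zq] := @covers_below _ (converse p) (preposet_converse pp) x q xq.
by exists z; rewrite // -(covers_converse p).
Qed.

(** In a finite order, the cover relations generate the order. *)
Lemma connect_edge x y : connect (edge (hasse p)) (class_of x) (class_of y) = p x y.
Proof.
apply/idP/idP=> [xy|].
  have [z /eqP] : exists2 z, class_of y = class_of z & p x z.
    apply: (connect_invariant (P := fun K => exists2 z, K = class_of z & p x z) _ xy); last by exists x.
    move=> K K' [z -> xz] /edgeP[v [w [/eqP ev -> cvw]]]; exists w => //.
    rewrite class_eq in ev; case/andP: ev => zv _; case/andP: cvw => /andP[vw _] _.
    exact: tr xz (tr zv vw).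
  by rewrite class_eq => /andP[_ zy] xz; apply: tr xz zy.
have [m] := ubnP #|[set v | p v y && p x v]|; elim: m x => // m IH x ltm xy.
case: (boolP (p y x)) => yx.
  suff /eqP-> : class_of x == class_of y by apply: connect0.
  by rewrite class_eq /equivalent xy yx.
have sxy : strictly p x y by rewrite /strictly xy yx.
have [z cxz zy] := covers_above sxy.
apply: (@connect_trans _ _ (class_of z)); first by apply: connect1; rewrite edge_class.
apply: IH => //; rewrite -ltnS; apply: leq_trans ltm; rewrite ltnS.
have [/andP[xz nzx] _] := andP cxz.
apply: proper_card; rewrite properE; apply/andP; split.
  by apply/subsetP=> v; rewrite !inE => /andP[-> zv]; rewrite (tr xz zv).
by apply/subsetPn; exists x; rewrite !inE ?refl ?xy ?andbT.
Qed.

Lemma hasse_partition : partition (nodes (hasse p)) [set: 'I_n].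
Proof. exact: equivalence_partitionP equivalent_rel. Qed.

Lemma edge_asym I J : edge (hasse p) I J -> ~~ edge (hasse p) J I.
Proof.
case/edgeP=> x [y [-> -> /andP[/andP[_ nyx] _]]]; rewrite edge_class.
by apply: contra nyx => /andP[/andP[]].
Qed.

End HasseDiagram.

Definition avoiding n (S : digraph n) (J : {set 'I_n}) : rel {set 'I_n} :=
  fun I I' => [&& I != J, I' != J & adjacent S I I'].

Lemma component_withoutE n (S : digraph n) (J K L : {set 'I_n}) :
  (L \in component_without S J K) =
    (L != J) && ((L \in nodes S) && connect (avoiding S J) K L).
Proof. by rewrite !inE andbA. Qed.

Section HasseConverse.
Variable n : nat.
Variable p : rel 'I_n.
Hypothesis pp : preposet p.
Implicit Types (x y : 'I_n) (I J K : {set 'I_n}).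

Let pp' : preposet (converse p) := preposet_converse pp.

Lemma class_of_converse x : class_of (converse p) x = class_of p x.
Proof. by apply/setP=> y; rewrite !inE (equivalent_converse p). Qed.

Lemma nodes_converse : nodes (hasse (converse p)) = nodes (hasse p).
Proof.
apply/setP=> I; apply/nodesP/nodesP=> [] [x ->]; exists x; by rewrite class_of_converse.
Qed.

Lemma edge_converse I J : edge (hasse (converse p)) I J = edge (hasse p) J I.
Proof.
apply/idP/idP.
  case/(edgeP pp')=> x [y [-> -> cxy]].
  by rewrite !class_of_converse (edge_class pp) -(covers_converse p).
case/(edgeP pp)=> x [y [-> -> cxy]].
by rewrite -!(class_of_converse) (edge_class pp') (covers_converse p).
Qed.

Lemma adjacent_converse : adjacent (hasse (converse p)) =2 adjacent (hasse p).
Proof. by move=> I J; rewrite /adjacent !edge_converse orbC. Qed.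

Lemma component_without_converse J K :
  component_without (hasse (converse p)) J K = component_without (hasse p) J K.
Proof.
apply/setP=> L; apply: (etrans (component_withoutE _ _ _ _)).
apply: (etrans _ (esym (component_withoutE _ _ _ _))); congr (_ && (_ && _)).
  by apply: (congr1 (fun N : {set _} => L \in N) nodes_converse).
by apply: eq_connect => I I'; congr [&& _, _ & _]; apply: adjacent_converse.
Qed.

Lemma descendant_subtrees_converse J :
  descendant_subtrees (hasse p) J = ancestor_subtrees (hasse (converse p)) J.
Proof.
rewrite /descendant_subtrees /ancestor_subtrees.
have mem M : (M \in [set M in nodes (hasse (converse p)) | edge (hasse (converse p)) J M]) =
             (M \in [set M in nodes (hasse p) | edge (hasse p) M J]).
  rewrite 2!in_set; congr (_ && _); last exact: edge_converse.
  by apply: (congr1 (fun N : {set _} => M \in N) nodes_converse).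
apply/setP=> T; apply/imsetP/imsetP=> [] [M MP ->]; exists M; rewrite ?component_without_converse //.
  by move: MP; rewrite -mem.
by move: MP; rewrite mem.
Qed.

End HasseConverse.

(** * The tree cut out by the walls *)
Section WallTree.
Variable n : nat.
Implicit Types (a b i j k m q v w x y z : 'I_n) (D I J K M : {set 'I_n}).
Variables p U V : rel 'I_n.
Hypothesis wsys : wall_system p U V.

Let pp : preposet p. Proof. by case: wsys. Qed.
Let refl : reflexive p. Proof. by case: pp. Qed.
Let tr : transitive p. Proof. by case: pp. Qed.
Notation cl := (class_of p).
Notation S := (hasse p).

(** The comparability graph outside of D, in which walls over D cannot be crossed
    (see [linked_side]). *)
Definition linked D : rel 'I_n :=
  fun x y => [&& x \notin D, y \notin D & p x y || p y x].

Definition below j : {set 'I_n} := [set q | p q j].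

Lemma below_downset j : downset p (below j).
Proof. by move=> x y xy; rewrite !inE; apply: tr. Qed.

Lemma linked_side D a b x y : U a b -> downset p D ->
  (forall q, a < q < b -> q \in D) -> connect (linked D) x y ->
  (x <= a -> y <= a) /\ (b <= x -> b <= y).
Proof.
move=> Uab down abD; have := walls_blockP wsys Uab down abD => block.
have side q : q \notin D -> (q <= a) || (b <= q).
  case: (leqP q a) => //= aq qD; rewrite leqNgt; apply: contra qD => qb.
  by apply: abD; rewrite aq.
move=> xy; split=> h.
  apply: (connect_invariant (P := fun y => y <= a) _ xy) => // v w va /and3P[vD wD vw].
  case/orP: (side w wD) => // bw; have := block v w vD wD va bw.
  by rewrite vw.
apply: (connect_invariant (P := fun y => b <= y) _ xy) => // v w va /and3P[vD wD vw].
case/orP: (side w wD) => // bw; have := block w v wD vD bw va.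
by rewrite orbC vw.
Qed.

(** A path from m in the Hasse diagram that avoids the class of j never goes below
    j. Otherwise it first enters the elements below j by going down from some x to
    some y. Then y has two upper covers, x and an element z below j; these are
    connected outside of the elements below y, through m and j, although a wall over
    the elements below y separates them. *)
Lemma upper_component_linked j m k :
  covers p j m -> connect (avoiding S (cl j)) (cl m) (cl k) ->
  connect (linked (below j)) m k /\ ~~ p k j.
Proof.
move=> cjm; have [jm nmj] : p j m /\ ~~ p m j by case/andP: cjm => /andP[].
have linked_cl x y : ~~ p x j -> equivalent p x y -> connect (linked (below j)) x y.
  move=> nxj /andP[xy yx]; apply: connect1; rewrite /linked !inE nxj xy andbT.
  by apply: contra nxj; apply: tr.
move=> mk; apply: (connect_invariant (P := fun K => forall k, K = cl k ->
    connect (linked (below j)) m k /\ ~~ p k j) _ mk) => //; last first.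
  move=> z /eqP; rewrite (class_eq pp) => mz; split; first exact: linked_cl.
  by apply: contra nmj; case/andP: mz => mz _; apply: tr.
move=> K K' IH /and3P[KJ K'J /(adjacentP pp)[x [y [eK eK' adj]]]].
have [mx nxj] := IH x eK.
have [xy|yx] : p x y \/ covers p y x.
- by case/orP: adj => [/andP[/andP[xy _] _]|h]; [left|right].
- have nyj : ~~ p y j by apply: contra nxj => yj; apply: tr xy yj.
  move=> z; rewrite eK' => /eqP; rewrite (class_eq pp) => yz; split.
    apply: connect_trans (linked_cl _ _ nyj yz).
    apply: (connect_trans mx); apply: connect1.
    by rewrite /linked !inE nxj nyj xy.
  by apply: contra nyj; case/andP: yz => yz _; apply: tr.
have [nyj|yj] := boolP (~~ p y j).
  move=> z; rewrite eK' => /eqP; rewrite (class_eq pp) => yz; split.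
    apply: connect_trans (linked_cl _ _ nyj yz).
    apply: (connect_trans mx); apply: connect1.
    by rewrite /linked !inE nxj nyj; case/andP: yx => /andP[-> _] _; rewrite orbT.
  by apply: contra nyj; case/andP: yz => yz _; apply: tr.
exfalso; rewrite negbK in yj.
have njy : ~~ p j y.
  apply: contra K'J => jy; rewrite eK' (class_eq pp) /equivalent yj jy.
  by [].
have [|z cyz zj] := @covers_above _ p pp y j; first by rewrite /strictly yj njy.
have nxz : ~~ equivalent p x z.
  by apply: contra nxj => /andP[xz _]; apply: tr xz zj.
have [a [b [Uab ab abD _ sep]]] := upper_covers_wall wsys yx cyz nxz.
have xz : connect (linked (below y)) x z.
  have off w : p y w -> ~~ p w y -> w \notin below y by rewrite inE.
  have nzy : z \notin below y by rewrite inE; case/andP: cyz => /andP[].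
  have nmy : m \notin below y by rewrite inE; apply: contra nmj => my; apply: tr my yj.
  have njy' : j \notin below y by rewrite inE.
  have mx' : connect (linked (below y)) m x.
    apply: connect_sub mx => v w /and3P[nv nw vw]; apply: connect1; rewrite /linked vw andbT.
    rewrite !inE in nv nw *; apply/andP; split.
      by apply: contra nv => vy; apply: tr vy yj.
    by apply: contra nw => vy; apply: tr vy yj.
  have sym : connect_sym (linked (below y)).
    by apply: sym_connect_sym => v w; rewrite /linked andbCA orbC.
  rewrite sym; apply: (@connect_trans _ _ j); first by apply: connect1; rewrite /linked nzy njy' zj.
  apply: (connect_trans _ mx'); apply: connect1.
  by rewrite /linked njy' nmy jm.
have [le ge] := linked_side Uab (@below_downset y) (fun q h => etrans (in_set _ _) (abD q h)) xz.
case: sep => [[hx hz]|[hz hx]].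
  have := le (hx x (equivalent_refl pp x)); have := hz z (equivalent_refl pp z).
  by clear -ab; lia.
have := ge (hx x (equivalent_refl pp x)); have := hz z (equivalent_refl pp z).
by clear -ab; lia.
Qed.

Lemma ancestor_subtrees_wall j x y :
  covers p j x -> covers p j y -> ~~ equivalent p x y ->
  exists a b, [/\ U a b, a < b, exists2 q, q \in cl j & a < q < b &
   exists2 T, T = (component_without S (cl j) (cl x), component_without S (cl j) (cl y)) &
    (forall v, v \in cover T.1 -> v <= a) /\ (forall v, v \in cover T.2 -> b <= v) \/
    (forall v, v \in cover T.2 -> v <= a) /\ (forall v, v \in cover T.1 -> b <= v)].
Proof.
move=> cx cy ne; have [a [b [Uab ab abD [q jq lt] sep]]] := upper_covers_wall wsys cx cy ne.
exists a, b; split=> //; first by exists q; rewrite // inE.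
have side z v : covers p j z -> v \in cover (component_without S (cl j) (cl z)) ->
    connect (linked (below j)) z v.
  move=> cz /bigcupP[K]; rewrite inE => /andP[_ zK] vK.
  have [] := @upper_component_linked j z v cz => //.
  suff -> : cl v = K by [].
  have /nodesP[w eK] : K \in nodes S.
    apply: (connect_invariant (P := fun K => K \in nodes S) _ zK); last exact: class_node.
    by move=> I I' _ /and3P[_ _ /(adjacentP pp)[? [? [_ -> _]]]]; apply: class_node.
  by apply/eqP; move: vK; rewrite eK inE (class_eq pp) equivalentC.
have sd z v cz vz := linked_side Uab (@below_downset j)
   (fun q h => etrans (in_set _ _) (abD q h)) (@side z v cz vz).
exists (component_without S (cl j) (cl x), component_without S (cl j) (cl y)) => //=.
case: sep => [[hx hy]|[hy hx]]; [left|right]; split=> v vT;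
  by [apply: (sd _ _ cx vT).1; apply: hx; apply: equivalent_refl
     |apply: (sd _ _ cx vT).2; apply: hx; apply: equivalent_refl
     |apply: (sd _ _ cy vT).1; apply: hy; apply: equivalent_refl
     |apply: (sd _ _ cy vT).2; apply: hy; apply: equivalent_refl].
Qed.

Lemma ancestor_subtreesP J T : J \in nodes S -> T \in ancestor_subtrees S J ->
  exists j x, [/\ J = cl j, covers p j x & T = component_without S (cl j) (cl x)].
Proof.
move=> _ /imsetP[M]; rewrite inE => /andP[_ /(edgeP pp)[j [x [eJ eM cjx]]]] ->.
by exists j, x; rewrite -eJ -eM.
Qed.

Lemma ancestor_subtrees_separated J : J \in nodes S ->
  {in ancestor_subtrees S J &, forall T1 T2, T1 != T2 -> separated J T1 T2}.
Proof.
move=> JS T1 T2 T1a T2a ne.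
have [j [x [eJ cx eT1]]] := ancestor_subtreesP JS T1a.
have [j' [y [eJ' cy eT2]]] := ancestor_subtreesP JS T2a.
have ejj : equivalent p j j' by rewrite -(class_eq pp) -eJ -eJ'.
have {}cy : covers p j y.
  by rewrite -(edge_class pp) -eJ eJ' (edge_class pp).
rewrite -eJ' -?eJ in eT2; rewrite -eJ in eT1.
have nxy : ~~ equivalent p x y.
  by apply: contra ne; rewrite -(class_eq pp) eT1 eT2 => /eqP->.
have [a [b [_ ab [q qj /andP[aq qb]] [T eT sep]]]] := ancestor_subtrees_wall cx cy nxy.
rewrite -eJ -eT1 -eT2 in eT; rewrite eT /= in sep.
apply/exists_inP; exists q; first by rewrite eJ.
case: sep => [[h1 h2]|[h2 h1]]; apply/orP; [left|right].
  apply/andP; split; apply/forall_inP=> v vT; first exact: leq_ltn_trans (h1 v vT) aq.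
  exact: leq_trans qb (h2 v vT).
apply/andP; split; apply/forall_inP=> v vT; first exact: leq_ltn_trans (h2 v vT) aq.
exact: leq_trans qb (h1 v vT).
Qed.

Lemma forbidden_up_wall c :
  (forall a b i k, U a b -> i <= a -> a < b -> b <= k -> U i k) ->
  forbidden_up_arc S c -> exists i k, [/\ i < k, c = up_arc i k & U i k].
Proof.
move=> Umono [J [L [M' [i [k [JS [La Ma] lt [/andP[iL _] /andP[kM _]] ->]]]]]].
have ik : i < k by move/forall_inP: lt => /(_ i iL)/forall_inP/(_ k kM).
exists i, k; split=> //.
have [j [x [eJ cx eT1]]] := ancestor_subtreesP JS La.
have [j' [y [eJ' cy eT2]]] := ancestor_subtreesP JS Ma.
have {}cy : covers p j y.
  by rewrite -(edge_class pp) -eJ eJ' (edge_class pp).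
rewrite -eJ' in eT2; rewrite -eJ in eT1.
have nxy : ~~ equivalent p x y.
  apply/negP; rewrite -(class_eq pp) => /eqP exy.
  have eLM : L = M' by rewrite eT1 eT2 exy.
  by move/forall_inP: lt => /(_ i iL)/forall_inP/(_ i); rewrite -eLM ltnn => /(_ iL).
have [a [b [Uab ab _ [T eT sep]]]] := ancestor_subtrees_wall cx cy nxy.
rewrite -eJ -eT1 -eT2 in eT; rewrite eT /= in sep.
case: sep => [[/(_ i iL) h1 /(_ k kM) h2]|[/(_ k kM) h1 /(_ i iL) h2]].
  exact: (Umono a b).
by clear -h1 h2 ik ab; lia.
Qed.

(** The lowest node of a cycle has two upper covers that are connected by the rest
    of the cycle, against [upper_covers_wall]. *)
Lemma hasse_acyclic (c : seq {set 'I_n}) :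
  path.cycle (adjacent S) c -> uniq c -> size c <= 2.
Proof.
move=> cyc uc; rewrite leqNgt; apply/negP=> szc.
have cn K : K \in c -> exists k, K = cl k.
  by move=> /(next_cycle cyc)/(adjacentP pp)[x [y [-> _ _]]]; exists x.
have [K0 K0c] : exists K, K \in c by case: (c) szc => // K0 c'; exists K0; rewrite inE eqxx.
have [k0 ek0] := cn K0 K0c; rewrite ek0 in K0c.
case: (arg_minnP (P := fun k => cl k \in c) (fun k => #|below k|) K0c) => j jc jmin.
(* The cycle is rotated so as to start at its lowest class. *)
have [r s' es] := rot_to jc.
have : path.cycle (adjacent S) (rot r c) by rewrite rot_cycle.
have : uniq (rot r c) by rewrite rot_uniq.
have : 2 < size (rot r c) by rewrite size_rot.
have memc K : K \in s' -> K \in c by move=> Ks; rewrite -(mem_rot r) es inE Ks orbT.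
rewrite {}es; case: s' memc => // M1 s' memc /= szs.
case/and3P; rewrite inE negb_or eq_sym => /andP[M1J Js'] M1s' us'.
rewrite rcons_path => /and3P[JM1 pth lJ].
have above M : M \in M1 :: s' -> M != cl j -> adjacent S M (cl j) ->
    exists2 m, M = cl m & covers p j m.
  move=> Mc MJ /(adjacentP pp)[m [j' [eM /eqP eJ adj]]]; exists m => //.
  rewrite (class_eq pp) in eJ.
  have cov : edge S M (cl j) || edge S (cl j) M.
    by have /eqP-> : cl j == cl j' by [rewrite (class_eq pp)]; rewrite eM !(edge_class pp).
  case/orP: cov; rewrite eM (edge_class pp) // => /andP[mj _].
  by have := jmin m; rewrite -eM memc // => /(_ isT); rewrite leqNgt (down_smaller pp mj).
have lM : last M1 s' \in M1 :: s' by apply: mem_last.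
have lJ' : last M1 s' != cl j.
  apply: contraNneq Js' => <-; move: lM; rewrite inE => /orP[/eqP e1|//].
  by case: (s') szs M1s' e1 => // z s'' _ /= h e1; case/negP: h; rewrite -{1}e1 mem_last.
have [x ex cx] : exists2 m, M1 = cl m & covers p j m.
  by apply: above; rewrite ?inE ?eqxx // /adjacent orbC.
have [y ey cy] := above _ lM lJ' lJ.
have nxy : ~~ equivalent p x y.
  rewrite -(class_eq pp) -ex -ey; case: (s') szs M1s' => // z s'' _ h.
  by apply: contra h => /eqP e1; rewrite [X in X \in _]e1 /= mem_last.
have xy : connect (avoiding S (cl j)) (cl x) (cl y).
  rewrite -ex -ey; apply/connectP; exists s' => //.
  have nJ : all (fun K => K != cl j) (M1 :: s').
    by rewrite /= M1J; apply/allP=> K Ks; apply: contraNneq Js' => <-.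
  elim: (s') M1 nJ pth {above memc JM1 lM lJ' ex M1J M1s' us' lJ ey Js' szs} => //= K s'' IH M1.
  case/and3P=> h1 h2 h3 /andP[h4 h5]; rewrite /avoiding h1 h2 h4 /=.
  by apply: IH => //=; rewrite h2.
have [a [b [Uab ab abD _ sep]]] := upper_covers_wall wsys cx cy nxy.
have [lxy _] := upper_component_linked cx xy.
have [le ge] := linked_side Uab (@below_downset j) (fun q h => etrans (in_set _ _) (abD q h)) lxy.
case: sep => [[hx hy]|[hy hx]].
  have := le (hx x (equivalent_refl pp x)); have := hy y (equivalent_refl pp y).
  by clear -ab; lia.
have := ge (hx x (equivalent_refl pp x)); have := hy y (equivalent_refl pp y).
by clear -ab; lia.
Qed.

Lemma hasse_connected :
  (forall i j, j = i.+1 :> nat -> p i j || p j i) ->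
  {in nodes S &, forall I J, connect (adjacent S) I J}.
Proof.
move=> step I J /(nodesP p)[x ->] /(nodesP p)[y ->].
have sym : connect_sym (adjacent S).
  by apply: sym_connect_sym => K L; rewrite /adjacent orbC.
have le v w : p v w -> connect (adjacent S) (cl v) (cl w).
  rewrite -(connect_edge pp); apply: connect_sub => K L KL; apply: connect1.
  by rewrite /adjacent KL.
have up d v w : w = v + d :> nat -> connect (adjacent S) (cl v) (cl w).
  elim: d w => [|d IH] w ew; first by rewrite (_ : w = v) //; apply: val_inj; rewrite /= ew addn0.
  have wn : v + d < n by have := ltn_ord w; rewrite ew; lia.
  apply: (connect_trans (IH (Ordinal wn) erefl)).
  have /step/orP[/le//|/le] : w = (Ordinal wn).+1 :> nat by rewrite /= ew addnS.
  by rewrite sym.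
case: (leqP x y) => xy; first by apply: (up (y - x)); rewrite subnKC.
by rewrite sym; apply: (up (x - y)); rewrite subnKC // ltnW.
Qed.

End WallTree.

Section WallSchroeder.
Variable n : nat.
Implicit Types (a b i j k : 'I_n).
Variables p U V : rel 'I_n.
Hypothesis wsys : wall_system p U V.
Let pp : preposet p. Proof. by case: wsys. Qed.

Lemma hasse_schroeder :
  (forall i j, j = i.+1 :> nat -> p i j || p j i) ->
  schroeder_separating_tree (hasse p).
Proof.
move=> step; split; first exact: hasse_partition.
  split.
  - by move=> I J; apply: edge_nodes.
  - by move=> I J; apply: edge_asym.
  - exact: hasse_connected wsys step.
  - exact: hasse_acyclic wsys.
move=> J JS; split; first exact: ancestor_subtrees_separated wsys _ JS.
rewrite (descendant_subtrees_converse pp).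
have JS' : J \in nodes (hasse (converse p)) by rewrite nodes_converse.
move=> T1 T2 h1 h2 h3.
have := ancestor_subtrees_separated (wall_system_converse wsys) JS' h1 h2 h3.
by [].
Qed.

(** The descendant subtrees are the ancestor subtrees of the converse preposet. *)
Lemma forbidden_down_wall c :
  (forall a b i k, V a b -> i <= a -> a < b -> b <= k -> V i k) ->
  forbidden_down_arc (hasse p) c -> exists i k, [/\ i < k, c = down_arc i k & V i k].
Proof.
move=> Vmono [J [L [M [i [k [JS [La Ma] lt [iL kM] ->]]]]]].
have [|i' [k' [ik [-> ->] h]]] := @forbidden_up_wall _ _ _ _ (wall_system_converse wsys) (up_arc i k) Vmono.
  exists J, L, M, i, k; split=> //; first by rewrite nodes_converse.
  by rewrite -(descendant_subtrees_converse pp).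
by exists i', k'.
Qed.

End WallSchroeder.

(** * Faces of the cone of a class *)
Section Cones.
Import Order.TTheory GRing.Theory Num.Theory.
Variables (R : realType) (n : nat) (e : rel 'S_n).
Hypothesis he : lattice_congruence e.
Implicit Types (p : rel 'I_n) (x : 'rV[R]_n) (s t : 'S_n).
Local Open Scope ring_scope.

Definition monotone p (f : 'I_n -> nat) : Prop := forall i j, p i j -> (f i <= f j)%N.

(** A point on which [class_order e t] is monotone lies in the chamber obtained by
    breaking its ties as in t, and this chamber belongs to the class. *)
Lemma class_coneE t x :
  class_cone e t x <-> preposet_cone (class_order e t) x.
Proof.
split=> [[s ts sx] i j /class_orderP/(_ s ts) ij|mono].
  by have := sx _ _ ij; rewrite !permKV.
(* The chamber of x nearest to the chamber of t. *)
pose r i j := (x 0 i < x 0 j) || (x 0 i == x 0 j) && before t i j.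
have [s sE] : exists s, forall i j, before s i j = r i j.
  apply: perm_of_order => [i|j i k|i j ne].
  - by rewrite /r ltxx before_irr andbF.
  - rewrite /r; case/orP=> [l1|/andP[/eqP e1 b1]]; case/orP=> [l2|/andP[/eqP e2 b2]].
    + by rewrite (lt_trans l1 l2).
    + by rewrite -e2 l1.
    + by rewrite e1 l2.
    + by rewrite e1 e2 eqxx (before_trans b1 b2) orbT.
  - by rewrite /r (before_flip t ne); case: (ltgtP (x 0 i)) => //=; case: before.
exists s.
  apply: (class_linear_extension he) => i j ij; have [->//|ne] := eqVneq i j.
  apply/ltnW; change (before s i j); rewrite sE /r.
  by have := mono i j ij; rewrite le_eqVlt (class_order_before (congr_refl he t) ij ne) andbT orbC.
move=> a b; rewrite leq_eqVlt => /orP[/eqP/val_inj->//|ab].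
have : before s (s a) (s b) by rewrite /before !pos_perm.
by rewrite sE => /orP[/ltW//|/andP[/eqP-> _]].
Qed.

Definition pairing (l x : 'rV[R]_n) : R := \sum_i l 0 i * x 0 i.

Lemma pairingD l x y : pairing l (x + y) = pairing l x + pairing l y.
Proof. by rewrite -big_split; apply: eq_bigr => i _; rewrite mxE mulrDr. Qed.

Lemma pairingZ l a x : pairing l (a *: x) = a * pairing l x.
Proof. by rewrite mulr_sumr; apply: eq_bigr => i _; rewrite mxE mulrCA. Qed.

Definition row_of (f : 'I_n -> nat) : 'rV[R]_n := \row_i (f i)%:R.

Lemma row_of_cone p f : preposet_cone p (row_of f) <-> monotone p f.
Proof. by split=> h i j /h; rewrite !mxE ler_nat. Qed.

(** Two consequences of being a face, free of real numbers. The second one says that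
    if a positive multiple of a point f of the face is, up to a constant vector, the
    middle of two points of the cone, then both lie in the face. *)
Lemma face_preposet p : congruence_preposet R e p -> exists t,
  (forall i j, class_order e t i j -> p i j) /\
  forall f g g', monotone p f -> monotone (class_order e t) g ->
    monotone (class_order e t) g' -> (forall i, g i + g' i = 4 * f i + 1)%N ->
    monotone p g /\ monotone p g'.
Proof.
case=> [[refl tr]] [t [l lpos F]]; exists t.
have Fx x : preposet_cone p x <-> (class_cone e t x /\ pairing l x = 0) by rewrite F.
split=> [i j ij|f g g' fp gt gt' eg].
  (* The indicator function of the elements above i lies in C(p). *)
  apply: contraT => nij; pose f k := nat_of_bool (p i k).
  have : monotone p f.
    by move=> a b ab; rewrite /f; case ia: (p i a) => //; rewrite (tr _ _ _ ia ab).
  move/row_of_cone/Fx=> [/class_coneE/row_of_cone/(_ i j ij)].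
  by rewrite /f refl (negbTE nij).
have pos x : preposet_cone (class_order e t) x -> 0 <= pairing l x.
  by move=> h; apply: lpos; apply/class_coneE.
(* Constant vectors and their opposites lie in every cone. *)
have one : pairing l (const_mx 1) = 0.
  have h1 : 0 <= pairing l (const_mx 1) by apply: pos => i j _; rewrite !mxE.
  have h2 : 0 <= pairing l (- 1 *: const_mx 1) by apply: pos => i j _; rewrite !mxE.
  by rewrite pairingZ mulN1r oppr_ge0 in h2; apply/eqP; rewrite eq_le h1 h2.
have sum : pairing l (row_of g) + pairing l (row_of g') = 0.
  have -> : pairing l (row_of g) + pairing l (row_of g') =
    4%:R * pairing l (row_of f) + pairing l (const_mx 1).
    rewrite -pairingD -pairingZ -pairingD; congr pairing; apply/rowP=> i.
    by rewrite !mxE -natrD eg natrD natrM.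
  by have /row_of_cone/Fx[_ ->] := fp; rewrite mulr0 one addr0.
have g0 : 0 <= pairing l (row_of g) by apply: pos; apply/row_of_cone.
have g0' : 0 <= pairing l (row_of g') by apply: pos; apply/row_of_cone.
have /andP[/eqP z /eqP z'] : (pairing l (row_of g) == 0) && (pairing l (row_of g') == 0).
  by rewrite -paddr_eq0 // sum.
split; apply/row_of_cone/Fx; split=> //; apply/class_coneE; exact/row_of_cone.
Qed.

(** The supporting functional is the sum of x_b - x_a over the relations a <= b of
    the class order that are reversed in p. *)
Lemma preposet_face p t : preposet p ->
  (forall i j, class_order e t i j -> p i j) ->
  (forall x, preposet_cone (class_order e t) x ->
     (forall a b, class_order e t a b -> p b a -> x 0 a = x 0 b) ->
     preposet_cone p x) ->
  congruence_preposet R e p.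
Proof.
move=> pp tp hface; split=> //; exists t.
pose c (ab : 'I_n * 'I_n) := class_order e t ab.1 ab.2 && p ab.2 ab.1.
pose l : 'rV[R]_n := \row_i \sum_(ab | c ab) ((i == ab.2)%:R - (i == ab.1)%:R).
have lE x : \sum_i l 0 i * x 0 i = \sum_(ab | c ab) (x 0 ab.2 - x 0 ab.1).
  transitivity (\sum_i \sum_(ab | c ab) ((i == ab.2)%:R - (i == ab.1)%:R) * x 0 i).
    by apply: eq_bigr => i _; rewrite mxE mulr_suml.
  rewrite exchange_big /=; apply: eq_bigr => ab _.
  have pick k : \sum_i (i == k)%:R * x 0 i = x 0 k.
    rewrite (bigD1 k) //= eqxx mul1r big1 ?addr0 // => i /negbTE->.
    by rewrite mul0r.
  by rewrite -[in RHS](pick ab.2) -[in RHS](pick ab.1) -sumrB; apply: eq_bigr => i _; rewrite mulrBl.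
have term x ab : preposet_cone (class_order e t) x -> c ab -> 0 <= x 0 ab.2 - x 0 ab.1.
  by move=> h /andP[ab1 _]; rewrite subr_ge0; apply: h.
exists l => [x /class_coneE h|].
  by rewrite lE; apply: sumr_ge0 => ab; apply: term.
apply/seteqP; split=> x /=.
  move=> px; split.
    by apply/class_coneE => i j /tp; apply: px.
  rewrite lE big1 // => ab /andP[h1 h2]; apply/eqP; rewrite subr_eq0 eq_le.
  by rewrite px // px //; apply: tp.
case=> /class_coneE tx; rewrite lE => /eqP; rewrite psumr_eq0; last by move=> ab; apply: term.
move/allP=> h; apply: hface => // a b ab ba; apply/eqP; rewrite eq_sym -subr_eq0.
by have := h (a, b); rewrite mem_index_enum /c ab ba; apply.
Qed.

End Cones.

(** * From preposets to admissible trees *)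
Lemma cover_interval n (p : rel 'I_n) (i k x y : 'I_n) : preposet p ->
  [|| equivalent p i k, covers p i k | covers p k i] ->
  p x y -> (x = i \/ x = k) -> p y i || p y k ->
  equivalent p i y || equivalent p k y.
Proof.
move=> [refl tr] ik xy; rewrite /equivalent => ex yik.
case/or3P: ik => [/andP[ik ki]|/andP[/andP[ik nki] /forallP/(_ y) h]|/andP[/andP[ki nik] /forallP/(_ y) h]].
- have iy : p i y by case: ex => ex; rewrite ex in xy => //; apply: tr ik xy.
  by rewrite iy; case/orP: yik => h; rewrite ?h // (tr _ _ _ h ki).
- have iy : p i y by case: ex => ex; rewrite ex in xy => //; apply: tr ik xy.
  have yk : p y k by case/orP: yik => // h'; apply: tr h' ik.
  by move: h; rewrite iy yk /= => /orP[]->; rewrite ?orbT.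
- have ky : p k y by case: ex => ex; rewrite ex in xy => //; apply: tr ki xy.
  have yi : p y i by case/orP: yik => // h'; apply: tr h' ki.
  by move: h; rewrite ky yi /= => /orP[]->; rewrite ?orbT.
Qed.

Section CoverWalls.
Variable n : nat.
Variables p U V : rel 'I_n.
Hypothesis wsys : wall_system p U V.
Implicit Types (a b i k q x y : 'I_n).

(** The wall would lie over the down-set strictly below the classes of i and k, which
    does not contain i and k. *)
Lemma no_wall_across_cover i k a b :
  [|| equivalent p i k, covers p i k | covers p k i] ->
  U a b -> i <= a -> b <= k ->
  (forall q, a < q < b ->
     [&& p q i || p q k, ~~ equivalent p i q & ~~ equivalent p k q]) -> False.
Proof.
move=> ik Uab ia bk ab; have [[refl tr] bU _ _] := wsys.
pose D := [set q | [&& p q i || p q k, ~~ equivalent p i q & ~~ equivalent p k q]].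
have conv x y : p x y -> (x = i \/ x = k) -> p y i || p y k ->
    equivalent p i y || equivalent p k y by apply: cover_interval.
have down : downset p D.
  move=> x y xy; rewrite !inE => /and3P[yik ny ny'].
  have xik : p x i || p x k by case/orP: yik => h; rewrite (tr _ _ _ xy h) ?orbT.
  rewrite xik /=; apply/andP; split.
    apply/negP=> /andP[ix _]; have := conv i y (tr _ _ _ ix xy) (or_introl erefl) yik.
    by rewrite (negbTE ny) (negbTE ny').
  apply/negP=> /andP[ix _]; have := conv k y (tr _ _ _ ix xy) (or_intror erefl) yik.
  by rewrite (negbTE ny) (negbTE ny').
have iD : i \notin D by rewrite inE /equivalent !refl /= ?andbF.
have kD : k \notin D by rewrite inE /equivalent !refl /= ?andbF.
have abD q : a < q < b -> q \in D by move=> lt; rewrite inE; apply: ab.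
have := bU D a b Uab down abD i k iD kD ia bk.
by case/or3P: ik => [/andP[-> _]|/andP[/andP[-> _] _]|/andP[/andP[-> _] _]]; rewrite ?orbT.
Qed.

End CoverWalls.

Section CongruencePreposet.
Variables (n : nat) (e : rel 'S_n).
Hypotheses (he : lattice_congruence e).
Implicit Types (a b i j k q v w x y : 'I_n) (A B D : {set 'I_n}) (p : rel 'I_n).

Definition up_wall a b := (a < b) && (up_arc a b \notin congruence_arcs e).
Definition down_wall a b := (a < b) && (down_arc a b \notin congruence_arcs e).

Lemma between_arc a b : a < b -> up_arc a b \in arcs n /\ down_arc a b \in arcs n.
Proof.
by move=> ab; split; apply/arcsP; split=> // q; rewrite !inE ?orbF // => _; rewrite inE.
Qed.

Lemma up_wall_mono a b i k : up_wall a b -> i <= a -> a < b -> b <= k -> up_wall i k.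
Proof.
move=> /andP[_ nab] ia ab bk; have ik : i < k by apply: leq_ltn_trans ia (leq_trans ab bk).
rewrite /up_wall ik; apply: (congruence_arcs_superarc he) nab.
- by case: (between_arc ab).
- by case: (between_arc ik).
rewrite /= ia ab bk subxx andbT; apply/subsetP=> q; rewrite !inE => /andP[h1 h2].
by rewrite (leq_ltn_trans ia h1) (leq_trans h2 bk).
Qed.

Lemma down_wall_mono a b i k : down_wall a b -> i <= a -> a < b -> b <= k -> down_wall i k.
Proof.
move=> /andP[_ nab] ia ab bk; have ik : i < k by apply: leq_ltn_trans ia (leq_trans ab bk).
rewrite /down_wall ik; apply: (congruence_arcs_superarc he) nab.
- by case: (between_arc ab).
- by case: (between_arc ik).
rewrite /= ia ab bk subxx /=; apply/subsetP=> q; rewrite !inE => /andP[h1 h2].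
by rewrite (leq_ltn_trans ia h1) (leq_trans h2 bk).
Qed.

Hypothesis hsimple : simple_congruence e.

(** A missing arc contains a minimal missing arc, which is an up arc or a down arc by
    simplicity. A subarc with the same ends is the arc itself, so that a shortest
    missing subarc is minimal. *)
Lemma simple_bad_arc i k A B :
  (i, k, A, B) \in arcs n -> (i, k, A, B) \notin congruence_arcs e ->
  exists a b, [/\ i <= a, a < b, b <= k &
    (up_wall a b /\ forall q, a < q < b -> q \in A) \/
    (down_wall a b /\ forall q, a < q < b -> q \in B)].
Proof.
move=> arcA bad.
pose P (c : quadruple n) := (c \in arcs n :\: congruence_arcs e) && subarc c (i, k, A, B).
pose len (c : quadruple n) := (c.1.1.2 - c.1.1.1)%N.
have P0 : P (i, k, A, B).
  by rewrite /P inE bad arcA /= !leqnn !subxx; case/arcsP: arcA => ->.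
case: (arg_minnP len P0) => [[[[a b] A'] B']] /andP[cbad /and5P[ia ab bk sA sB]] cmin.
have [|a' [b' ec]] := hsimple cbad.
  case=> [[[a2 b2] A2] B2] bad2 /and5P[aa ab2 bb sA2 sB2].
  have := cmin (a2, b2, A2, B2); rewrite /P bad2 /len /= ab2.
  rewrite (leq_trans ia aa) (leq_trans bb bk) (fintype.subset_trans sA2 sA) (fintype.subset_trans sB2 sB).
  move=> /(_ isT) => lenle.
  have ea : a2 = a by apply: val_inj => /=; clear -aa bb ab ab2 lenle; lia.
  have eb : b2 = b by apply: val_inj => /=; clear -aa bb ab ab2 lenle; lia.
  rewrite {}ea {}eb in bad2 *.
  move: bad2 cbad; rewrite !in_setD => /andP[_ /arcsP[_ AB2 dAB2]] /andP[_ /arcsP[_ AB' dAB']].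
  have eA : A2 = A'.
    apply/eqP; rewrite eqEsubset sA2; apply/subsetP=> q qA.
    have := AB' q; rewrite qA -AB2 => /esym/orP[//|/(subsetP sB2)].
    by rewrite (negbTE (dAB' q qA)).
  have eB : B2 = B'.
    apply/eqP; rewrite eqEsubset sB2; apply/subsetP=> q qB.
    have := AB' q; rewrite qB orbT -AB2 => /esym/orP[/(subsetP sA2)/dAB'|//].
    by rewrite qB.
  by rewrite eA eB.
have nab : (a, b, A', B') \notin congruence_arcs e by move: cbad; rewrite in_setD => /andP[].
exists a, b; split=> //; case: ec => ec; move: (ec) => [ea eb eA eB]; [left|right]; split.
- by rewrite /up_wall ab ea eb -ec.
- by move=> q lt; apply: (subsetP sA); rewrite eA -ea -eb inE.
- by rewrite /down_wall ab ea eb -ec.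
- by move=> q lt; apply: (subsetP sB); rewrite eB -ea -eb inE.
Qed.

Variables (p : rel 'I_n) (t : 'S_n).
Hypotheses (pp : preposet p) (tp : forall i j, class_order e t i j -> p i j).
Hypothesis face : forall f g g', monotone p f -> monotone (class_order e t) g ->
    monotone (class_order e t) g' -> (forall i, g i + g' i = 4 * f i + 1) ->
    monotone p g /\ monotone p g'.

(** The perturbations 2f + chi and 2f + 1 - chi raise the elements outside of D on
    one side of the missing arc, respectively all other elements. Both stay in the
    cone of the class by [split_levels], and their sum is 4f + 1, so both stay in the
    face, on which they contradict any relation across the arc. *)
Lemma wall_splits D (f : 'I_n -> nat) a b A B :
  monotone p f -> (forall x y, x \notin D -> y \notin D -> f x = f y) ->
  (forall x y, f x = f y -> x \in D -> y \in D) ->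
  (a, b, A, B) \in arcs n -> (a, b, A, B) \notin congruence_arcs e ->
  (forall q, a < q < b -> q \in D) ->
  (forall q x, q \in A -> x \notin D -> f q < f x) ->
  (forall q x, q \in B -> x \notin D -> f x < f q) ->
  forall q q', q \notin D -> q' \notin D -> q <= a -> b <= q' -> ~~ (p q q' || p q' q).
Proof.
move=> fmono fD fD' arcA nab abD fA fB q q' qD q'D qa bq'.
have ab : a < b by case/arcsP: arcA.
pose chi v := nat_of_bool ((v \notin D) && (b <= v)).
pose g v := 2 * f v + chi v; pose g' v := 2 * f v + (1 - chi v).
have chi1 v : chi v <= 1 by apply: leq_b1.
have bad x y : x < y -> f x = f y -> chi x <> chi y -> [/\ x \notin D, x <= a & b <= y].
  move=> xy fxy; rewrite /chi; case: (boolP (x \in D)) => xD /=.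
    by rewrite (fD' x y fxy xD).
  case: (leqP b x) => bx; first by rewrite (leq_trans bx (ltnW xy)); case: (y \in D) (fD' y x (esym fxy)) xD => // ->.
  case: (leqP b y) => by'; last by rewrite andbF.
  by split=> //; rewrite leqNgt; apply: contra xD => ax; apply: abD; rewrite ax.
have split_g (h : 'I_n -> nat) :
   (forall i j, f i < f j -> h i < h j) ->
   (forall x y, f x = f y -> h x <> h y -> chi x <> chi y) -> monotone (class_order e t) h.
  move=> fh hchi; apply: (split_levels he) fh _ => [i j /tp/fmono//|x y xy fxy hxy].
  have [xD xa by'] := bad x y xy fxy (hchi _ _ fxy hxy).
  exists a, b, A, B; split=> //; first by rewrite xa.
    by move=> z zA; apply: fA.
  by move=> z zB; apply: fB.
have [||i|gp g'p] := face (f := f) (g := g) (g' := g') fmono.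
- apply: split_g => x y; rewrite /g; last by move=> -> h1 h2; apply: h1; rewrite h2.
  by have := chi1 x; clear; lia.
- apply: split_g => x y; rewrite /g'; last by move=> -> h1 h2; apply: h1; rewrite h2.
  by have := chi1 x; clear; lia.
- by rewrite /g /g'; have := chi1 i; clear; lia.
have chiq : chi q = 0 by rewrite /chi leqNgt (leq_ltn_trans qa ab) andbF.
have chiq' : chi q' = 1 by rewrite /chi q'D bq'.
apply/negP=> /orP[/g'p|/gp]; rewrite /g' /g chiq chiq' (fD q q' qD q'D); clear; lia.
Qed.

Lemma up_walls_block : walls_block p up_wall.
Proof.
move=> D a b /andP[ab nab] down abD.
pose f v := nat_of_bool (v \notin D).
apply: (wall_splits (f := f)) nab (abD) _ _; rewrite /f.
- move=> x y xy; case: (boolP (y \in D)) => [/(down _ _ xy)->//|_]; exact: leq_b1.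
- by move=> x y -> ->.
- by move=> x y; case: (x \in D); case: (y \in D).
- by case: (between_arc ab).
- by move=> q x; rewrite inE => /abD -> ->.
- by move=> q x; rewrite inE.
Qed.

Lemma down_walls_block : walls_block (converse p) down_wall.
Proof.
move=> D a b /andP[ab nab] up abD q q' qD q'D qa bq'; rewrite orbC.
pose f v := nat_of_bool (v \in D).
apply: (wall_splits (f := f)) nab (abD) _ _ q q' qD q'D qa bq'; rewrite /f.
- by move=> x y xy; case: (boolP (x \in D)) => [/(up y x xy)->//|_].
- by move=> x y /negbTE-> /negbTE->.
- by move=> x y; case: (x \in D); case: (y \in D).
- by case: (between_arc ab).
- by move=> q0 x; rewrite inE.
- by move=> q0 x; rewrite inE => /abD -> /negbTE->.
Qed.

(** The set D' adds to D the elements equivalent to x or y that t places before x or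
    y, so that D' is a down-set of the class order. *)
Lemma incomparable_walls_exist : walls_exist p up_wall down_wall.
Proof.
have [refl tr] := pp.
move=> D x y xy nxy nyx xD yD down Dx Dy cl.
pose D' := [set q | [|| q \in D, equivalent p x q && before t q x
                      | equivalent p y q && before t q y]].
have tclosed z a b : (forall q, p q z -> p z q || (q \in D)) ->
    class_order e t a b -> equivalent p z b -> before t b z ->
    (a \in D) || (equivalent p z a && before t a z).
  move=> Dz ab /andP[zb bz] tbz; have az := tr _ _ _ (tp ab) bz.
  case/orP: (Dz a az) => [za|->//]; rewrite /equivalent za az /=; apply/orP; right.
  have [->//|nab] := eqVneq a b.
  exact: before_trans (class_order_before (congr_refl he t) ab nab) tbz.
have tbelow z a : (forall q, p q z -> p z q || (q \in D)) ->
    class_order e t a z -> [|| a == z, a \in D | equivalent p z a && before t a z].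
  move=> Dz az; have [//|naz] := eqVneq a z; have := tp az => paz.
  rewrite (class_order_before (congr_refl he t) az naz) /equivalent paz !andbT /=.
  by rewrite orbC; apply: Dz.
have arcx : (x, y, [set q in between x y | q \in D'], [set q in between x y | q \notin D'])
    \in arcs n.
  apply/arcsP; split=> // q; rewrite !inE; first by rewrite -andb_orr orbN andbT.
  by case/andP=> -> ->.
have [|a [b [xa ab by' h]]] := simple_bad_arc arcx.
  apply: (incomparable_arc he) => //.
  - by rewrite inE (negbTE xD) before_irr andbF /= /equivalent (negbTE nyx).
  - by rewrite inE (negbTE yD) before_irr andbF /= /equivalent (negbTE nxy).
  - move=> a b ab; rewrite !inE => /or3P[bD|/andP[h1 h2]|/andP[h1 h2]].
    + by rewrite (down _ _ (tp ab) bD).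
    + by case/orP: (tclosed x a b Dx ab h1 h2) => ->; rewrite ?orbT.
    + by case/orP: (tclosed y a b Dy ab h1 h2) => ->; rewrite ?orbT.
  - by move=> a /(tbelow x a Dx)/or3P[->|h|h]; rewrite ?inE ?h ?orbT.
  - by move=> a /(tbelow y a Dy)/or3P[->|h|h]; rewrite ?inE ?h ?orbT.
exists a, b; split=> //.
have lt q : a < q < b -> x < q < y.
  by case/andP=> h1 h2; rewrite (leq_ltn_trans xa h1) (leq_trans h2 by').
case: h => [[Uab h]|[Vab h]]; [left|right]; split=> // q ltq; have := h q ltq; rewrite !inE.
  have /andP[/negbTE-> /negbTE->] := cl q (lt q ltq).
  by rewrite /= orbF => /andP[].
by case/andP=> _; apply: contra => ->.
Qed.

Lemma congruence_wall_system : wall_system p up_wall down_wall.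
Proof.
split=> //; [exact: up_walls_block|exact: down_walls_block|exact: incomparable_walls_exist].
Qed.

(** The arc from i to i+1 is not missing, so i and i+1 are not incomparable in the
    class order. *)
Lemma essential_comparable : essential e ->
  forall i j, j = i.+1 :> nat -> p i j || p j i.
Proof.
move=> hess i j ij; apply: contraT; rewrite negb_or => /andP[nij nji].
have ltij : i < j by rewrite ij.
pose D := [set q | (class_order e t q i && (q != i)) || (class_order e t q j && (q != j))].
have no : between i j = set0.
  by apply/setP=> q; rewrite !inE ij; clear; lia.
have ctr := @class_order_trans _ e t.
have canti := @class_order_anti _ _ he t.
have := @incomparable_arc _ _ he t D i j ltij.
have -> : [set q in between i j | q \in D] = set0 by apply/setP=> q; rewrite inE no !inE.
have -> : [set q in between i j | q \notin D] = set0 by apply/setP=> q; rewrite inE no !inE.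
rewrite (hess i j ij) /=; apply.
- by rewrite inE eqxx andbF /=; apply: contra nij => /andP[/tp].
- by rewrite inE eqxx andbF orbF; apply: contra nji => /andP[/tp].
- move=> a b ab; rewrite !inE => /orP[/andP[bi nbi]|/andP[bj nbj]]; apply/orP; [left|right].
    rewrite (ctr _ _ _ ab bi); apply: contra nbi => /eqP ea.
    by rewrite ea in ab; rewrite (canti _ _ bi ab).
  rewrite (ctr _ _ _ ab bj); apply: contra nbj => /eqP ea.
  by rewrite ea in ab; rewrite (canti _ _ bj ab).
- by move=> a ai; rewrite inE ai; case: (a == i).
- by move=> a aj; rewrite !inE aj; case: (a == j); rewrite // ?orbT.
Qed.

Lemma mandatory_arcs_congruence c : mandatory_arc (hasse p) c -> c \in congruence_arcs e.
Proof.
case: c => [[[i k] A] B] [arcA [I [K [/and4P[IS KS iI kK] adj disj eA eB]]]].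
have eI : I = class_of p i.
  by move: iI; case/nodesP: IS => x ->; rewrite inE => xi; apply/eqP; rewrite (class_eq pp).
have eK : K = class_of p k.
  by move: kK; case/nodesP: KS => x ->; rewrite inE => xi; apply/eqP; rewrite (class_eq pp).
apply: contraT => bad; have [a [b [ia ab bk h]]] := simple_bad_arc arcA bad.
have ik : [|| equivalent p i k, covers p i k | covers p k i].
  by move: adj; rewrite /adjacent eI eK !(edge_class pp) (class_eq pp).
have wsys := congruence_wall_system.
have off q : a < q < b -> ~~ equivalent p i q && ~~ equivalent p k q.
  case/andP=> h1 h2; have /setP/(_ q) := disj; rewrite eI eK !inE.
  by rewrite (leq_ltn_trans ia h1) (leq_trans h2 bk) /= => /norP[-> ->].
have inJ q J : J \in nodes (hasse p) -> q \in J -> J = class_of p q.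
  by case/nodesP=> x ->; rewrite inE => xq; apply/eqP; rewrite (class_eq pp).
case: h => [[Uab abA]|[Vab abB]].
  case: (no_wall_across_cover wsys ik Uab ia bk) => q lt; rewrite off // andbT.
  have := abA q lt; rewrite eA inE => /andP[_ /exists_inP[J JS /andP[qJ]]].
  by rewrite (inJ q J JS qJ) eI eK !(connect_edge pp).
have ik' : [|| equivalent (converse p) i k, covers (converse p) i k | covers (converse p) k i].
  by rewrite (equivalent_converse p) !(covers_converse p) orbCA orbC -orbA orbC -orbA; move: ik; rewrite orbC -orbA.
case: (no_wall_across_cover (wall_system_converse wsys) ik' Vab ia bk) => q lt.
rewrite !(equivalent_converse p) off // andbT.
have := abB q lt; rewrite eB inE => /andP[_ /exists_inP[J JS /andP[qJ]]].
by rewrite (inJ q J JS qJ) eI eK !(connect_edge pp).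
Qed.

Lemma hasse_admissible : admissible (hasse p) e.
Proof.
have wsys := congruence_wall_system.
split; first exact: mandatory_arcs_congruence.
  by move=> c /(forbidden_up_wall wsys up_wall_mono)[i [k [_ -> /andP[]]]].
by move=> c /(forbidden_down_wall wsys down_wall_mono)[i [k [_ -> /andP[]]]].
Qed.

End CongruencePreposet.

Theorem preposet_admissible (R : realType) (n : nat) (e : rel 'S_n) p :
  lattice_congruence e -> essential e -> simple_congruence e ->
  congruence_preposet R e p -> schroeder_separating_tree (hasse p) /\ admissible (hasse p) e.
Proof.
move=> he hess hsimple cp; have [t [tp face]] := face_preposet he cp.
have [pp _] := cp; split; last exact: hasse_admissible he hsimple _ _ pp tp face.
apply: (hasse_schroeder (congruence_wall_system he hsimple pp tp face)).
exact: essential_comparable he _ _ tp hess.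
Qed.

(** * Turns in Schroeder separating trees *)
Section Tree.
Variables (n : nat) (S : digraph n).
Implicit Types (I J K L M N Q X Y : {set 'I_n}) (i j k l m q x y : 'I_n) (b : bool) (c : seq {set 'I_n}).
Hypothesis tree : directed_tree S.

(** Statements about ancestors and descendants are treated together: b tells in
    which direction the edges are read. *)
Definition dir b : rel {set 'I_n} := fun I J => if b then edge S I J else edge S J I.

Lemma adjacentC I J : adjacent S I J = adjacent S J I.
Proof. by rewrite /adjacent orbC. Qed.

Lemma dir_adjacent b I J : dir b I J -> adjacent S I J.
Proof. by rewrite /adjacent; case: b => /= ->; rewrite ?orbT. Qed.

Lemma adjacent_dir I J : adjacent S I J -> exists b, dir b I J.
Proof. by case/orP=> h; [exists true|exists false]. Qed.

Lemma dir_asym b I J : dir b I J -> ~~ dir b J I.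
Proof. by case: tree => _ h _ _; case: b => /h. Qed.

Lemma dir_neq b I J : dir b I J -> I != J.
Proof.
by apply: contraTneq => ->; apply/negP=> JJ; move: (dir_asym JJ); rewrite JJ.
Qed.

Lemma dir_nodes b I J : dir b I J -> I \in nodes S /\ J \in nodes S.
Proof. by case: tree => h _ _ _; case: b => /h[]. Qed.

Lemma adjacent_neq I J : adjacent S I J -> I != J.
Proof. by case/adjacent_dir=> b /dir_neq. Qed.

Lemma avoid_sym J : connect_sym (avoiding S J).
Proof. by apply: sym_connect_sym => I K; rewrite /avoiding andbCA adjacentC. Qed.

Lemma connect_avoid_neq J M K : M != J -> connect (avoiding S J) M K -> K != J.
Proof.
move=> MJ MK; apply: (connect_invariant (P := fun K => K != J) _ MK) => //.
by move=> v w _ /and3P[].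
Qed.

Lemma connect_avoid_nodes J M K : M \in nodes S -> connect (avoiding S J) M K -> K \in nodes S.
Proof.
move=> MS MK; apply: (connect_invariant (P := fun K => K \in nodes S) _ MK) => //.
by move=> v w _ /and3P[_ _ /adjacent_dir[b /dir_nodes[]]].
Qed.

Lemma path_avoid J M c : path (adjacent S) M c -> J \notin M :: c -> path (avoiding S J) M c.
Proof.
elim: c M => //= K c IH M /andP[MK pth]; rewrite !inE !negb_or => /and3P[JM JK Jc].
by rewrite /avoiding eq_sym JM eq_sym JK MK /= IH // inE negb_or JK.
Qed.

Lemma path_connect_avoid J M c K : path (adjacent S) M c -> J \notin M :: c ->
  K \in M :: c -> connect (avoiding S J) M K.
Proof. by move=> pth Jc Kc; apply: path_connect Kc; apply: path_avoid. Qed.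

(** Acyclicity in the form that the tree arguments take: distinct neighbors of J lie
    in distinct components without J. *)
Lemma neighbors_disconnected J M M' : adjacent S J M -> adjacent S J M' ->
  connect (avoiding S J) M M' -> M = M'.
Proof.
move=> JM JM' /connectP[c0 pth0 eM']; apply/eqP; apply: contraT => ne.
case/shortenP: pth0 eM' => c pth uc _ eM'.
have [_ _ _ acyc] := tree.
have Jc : J \notin M :: c.
  have : all (fun K => K != J) (M :: c).
    rewrite /= eq_sym adjacent_neq //=.
    by elim: (c) (M) pth {uc eM'} => //= K c' IH M1 /andP[/and3P[_ -> _] /IH].
  by move/allP=> h; apply/negP=> /h; rewrite eqxx.
have pthA : path (adjacent S) M c.
  by apply: sub_path pth => I I' /and3P[].
have cyc : path.cycle (adjacent S) (J :: M :: c).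
  by rewrite /= JM rcons_path pthA -eM' adjacentC.
have := acyc _ cyc; rewrite cons_uniq Jc uc => /(_ isT).
by case: (c) eM' => // e; rewrite e eqxx in ne.
Qed.

(** A path from M without J that met X would connect M to X. *)
Lemma avoid_both J X M L : connect (avoiding S J) M L -> ~~ connect (avoiding S J) M X ->
  connect (avoiding S X) M L.
Proof.
move=> ML nMX; suff [] : connect (avoiding S X) M L /\ connect (avoiding S J) M L by [].
apply: (connect_invariant (P := fun K => connect (avoiding S X) M K /\ connect (avoiding S J) M K) _ ML) => //.
move=> v w [h1 h2] vw; have h3 := connect_trans h2 (connect1 vw); split=> //.
apply: (connect_trans h1); apply: connect1; case/and3P: vw => _ _ vw; rewrite /avoiding vw andbT.
by apply/andP; split; apply: contra nMX => /eqP<-.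
Qed.

(** If the path is not directed, its first turn is at a node J with two neighbors N
    and N' on the same side of J; the start of the path is in the subtree of N and
    its end in the subtree of N'. *)
Lemma path_turn I c : path (adjacent S) I c -> uniq (I :: c) ->
  (exists b, path (dir b) I c) \/
  exists b J N N', [/\ J \in c, connect (dir b) I J, dir b N J && dir b N' J, N != N' &
     connect (avoiding S J) N I && connect (avoiding S J) N' (last I c)].
Proof.
elim/last_ind: c => [|c z IH]; first by left; exists true.
rewrite rcons_path -rcons_cons rcons_uniq => /andP[pth adj] /andP[zIc uc].
have [[b pthb]|[b [J [N [N' [Jc IJ dN ne /andP[cN cN']]]]]]] := IH pth uc; last first.
  right; exists b, J, N, N'; split=> //; first by rewrite mem_rcons inE Jc orbT.
  rewrite cN last_rcons /=; apply: (connect_trans cN'); apply: connect1; rewrite /avoiding adj andbT.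
  apply/andP; split; last by apply: contraNneq zIc => ->; rewrite inE Jc orbT.
  by apply: connect_avoid_neq cN'; case/andP: dN => _ /dir_neq.
have [b' dz] := adjacent_dir adj.
case: (lastP c) pth pthb uc zIc dz {IH adj} => [|c' J] pth pthb uc zIc dz.
  by left; exists b'; rewrite /= dz.
rewrite last_rcons in dz.
case: (eqVneq b b') dz => [<- dz|nb dz]; first by left; exists b; rewrite rcons_path pthb last_rcons.
right; exists b, J, (last I c'), z; rewrite rcons_path in pthb; case/andP: pthb => pthb dJ.
have dz' : dir b z J by move: nb dz; case: b b' {pthb dJ} => [] [].
split.
- by rewrite !(mem_rcons, inE) eqxx orbT.
- apply: (connect_trans _ (connect1 dJ)); apply/connectP; by exists c'.
- by rewrite dJ.
- apply: contraNneq zIc => <-; have := mem_last I c'; rewrite !inE mem_rcons inE.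
  by case/orP=> ->; rewrite ?orbT.
- rewrite last_rcons connect0 andbT avoid_sym; rewrite rcons_path in pth; case/andP: pth => pth _.
  apply: path_connect_avoid pth _ (mem_last _ _).
  by move: uc; rewrite -rcons_cons rcons_uniq => /andP[].
Qed.

Lemma simple_path I K : I \in nodes S -> K \in nodes S ->
  exists c, [/\ path (adjacent S) I c, uniq (I :: c) & K = last I c].
Proof.
move=> IS KS; have [_ _ conn _] := tree.
have /connectP[c0 pth0 eK] := conn I K IS KS.
by case/shortenP: pth0 eK => c pth uc _ eK; exists c.
Qed.

Lemma connect_dir_neg b I K : connect (dir (~~ b)) I K = connect (dir b) K I.
Proof. by rewrite connect_rev; apply: eq_connect; case: b. Qed.

Lemma first_step b I K : connect (dir b) I K -> I != K ->
  exists N, [/\ dir b I N, connect (avoiding S I) N K & connect (dir b) N K].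
Proof.
move=> /connectP[c0 pth0 eK]; case/shortenP: pth0 eK => c pth uc _ eK ne.
case: c pth uc eK => [|N c] /=; first by move=> _ _ e; rewrite e eqxx in ne.
move=> /andP[IN pth] /andP[Ic uc] eK; exists N; split=> //.
  rewrite eK; apply: path_connect_avoid (mem_last _ _) => //.
  by apply: sub_path pth => ? ?; apply: dir_adjacent.
by apply/connectP; exists c.
Qed.

Lemma dir_antisym b I K : connect (dir b) I K -> connect (dir b) K I -> I = K.
Proof.
move=> IK KI; apply/eqP; apply: contraT => ne.
have [N [IN NK _]] := first_step IK ne.
rewrite -connect_dir_neg in KI; have [N' [IN' NK' _]] := first_step KI ne.
have eN : N = N'.
  apply: neighbors_disconnected (dir_adjacent IN) (dir_adjacent IN') _.
  by apply: (connect_trans NK); rewrite avoid_sym.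
have : dir b N' I by move: IN'; case: (b).
by rewrite -eN => /dir_asym; rewrite IN.
Qed.

Lemma dir_cover b I Q K : dir b I K -> connect (dir b) I Q -> connect (dir b) Q K ->
  Q = I \/ Q = K.
Proof.
move=> IK IQ QK; have [->|ne] := eqVneq I Q; [by left|right].
have [N [IN NQ NQ']] := first_step IQ ne.
have eN : N = K.
  apply: neighbors_disconnected (dir_adjacent IN) (dir_adjacent IK) _.
  have /connectP[c pth ->] := connect_trans NQ' QK.
  apply: path_connect_avoid (mem_last _ _); first by apply: sub_path pth => ? ?; apply: dir_adjacent.
  apply/negP=> /(path_connect pth) NI; have := dir_antisym (connect1 IN) NI.
  by apply/eqP; apply: dir_neq IN.
by apply: (dir_antisym (b := b)) => //; rewrite -eN.
Qed.

Hypothesis part : partition (nodes S) [set: 'I_n].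
Hypothesis sep : forall J, J \in nodes S ->
  {in ancestor_subtrees S J &, forall T1 T2, T1 != T2 -> separated J T1 T2} /\
  {in descendant_subtrees S J &, forall T1 T2, T1 != T2 -> separated J T1 T2}.

Lemma subtree_mem J M K x : M \in nodes S -> M != J -> connect (avoiding S J) M K -> x \in K ->
  x \in cover (component_without S J M).
Proof.
move=> MS MJ MK xK; apply/bigcupP; exists K => //.
rewrite component_withoutE (connect_avoid_neq MJ MK) (connect_avoid_nodes MS MK).
exact: MK.
Qed.

Lemma subtrees_separated b J N N' : dir b N J -> dir b N' J -> N != N' ->
  separated J (component_without S J N) (component_without S J N').
Proof.
move=> NJ N'J ne; have [NS JS] := dir_nodes NJ; have [N'S _] := dir_nodes N'J.
have neT : component_without S J N != component_without S J N'.
  apply: contra ne => /eqP eT; have : N \in component_without S J N.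
    by rewrite component_withoutE NS (dir_neq NJ) connect0.
  rewrite eT component_withoutE => /and3P[_ _ cNN]; apply/eqP/esym.
  by apply: neighbors_disconnected cNN; rewrite adjacentC; apply: dir_adjacent; eassumption.
have [sa sd] := sep JS; case: b NJ N'J => NJ N'J.
  by apply: sd => //; apply/imsetP; [exists N|exists N'] => //; rewrite inE ?NS ?N'S.
by apply: sa => //; apply/imsetP; [exists N|exists N'] => //; rewrite inE ?NS ?N'S.
Qed.

(** A subtree at J is separated from any other one on the same side of J. *)
Lemma not_between b J N N' X Y Q x y q : dir b N J -> dir b N' J -> N != N' ->
  connect (avoiding S J) N X -> connect (avoiding S J) N Y -> connect (avoiding S J) N' Q ->
  x \in X -> y \in Y -> q \in Q -> ~~ (x < q < y).
Proof.
move=> NJ N'J ne NX NY N'Q xX yY qQ.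
have [NS JS] := dir_nodes NJ; have [N'S _] := dir_nodes N'J.
have mx := subtree_mem NS (dir_neq NJ) NX xX.
have my := subtree_mem NS (dir_neq NJ) NY yY.
have mq := subtree_mem N'S (dir_neq N'J) N'Q qQ.
have /exists_inP[j _ /orP[/andP[/forall_inP h1 /forall_inP h2]|/andP[/forall_inP h1 /forall_inP h2]]] :=
  subtrees_separated NJ N'J ne.
  by have := h1 y my; have := h2 q mq; clear; lia.
by have := h2 x mx; have := h1 q mq; clear; lia.
Qed.

Definition node i := pblock (nodes S) i.

Lemma node_in i : node i \in nodes S.
Proof. by apply: pblock_mem; rewrite (cover_partition part) inE. Qed.

Lemma mem_node i : i \in node i.
Proof. by rewrite mem_pblock (cover_partition part) inE. Qed.

Lemma node_eq I i : I \in nodes S -> i \in I -> node i = I.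
Proof. by case/and3P: part => _ triv _ IS iI; apply: def_pblock. Qed.

Lemma node_nonempty I : I \in nodes S -> exists i, i \in I.
Proof.
case/and3P: part => _ _ n0 IS; apply/set0Pn; apply: contraNneq n0 => <-; exact: IS.
Qed.

(** If the node of q is comparable with neither node, the simple path to it from one
    of them, chosen so as to avoid the other one, turns at some J. Then i and k are in one subtree of J and q in
    another one, which cannot separate i from k. *)
Lemma between_comparable i k q : i < q < k ->
  (node i == node k) || adjacent S (node i) (node k) ->
  exists X b, (X = node i \/ X = node k) /\ connect (dir b) X (node q).
Proof.
move=> iqk ik.
(* X is the end of the edge that is closer to q. *)
have [X [Y [c [XY pth uc eQ Yc]]]] : exists X Y c,
   [/\ (X = node i /\ Y = node k) \/ (X = node k /\ Y = node i), path (adjacent S) X c,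
       uniq (X :: c), node q = last X c & Y \notin c].
  have [c [pth uc eQ]] := simple_path (node_in i) (node_in q).
  case: (boolP (node k \in c)) => kc; last first.
    by exists (node i), (node k), c; split=> //; left.
  case/splitPr: kc pth uc eQ => c1 c2; rewrite cat_path last_cat /= => /and3P[_ _ pth].
  rewrite cat_uniq mem_cat !inE !negb_or => /andP[/and3P[_ _ ic2] /and3P[_ _ uc2]] eQ.
  by exists (node k), (node i), c2; split=> //; right.
have [[b pthb]|[b [J [N [N' [Jc XJ /andP[NJ N'J] ne /andP[cN cN']]]]]]] := path_turn pth uc.
  exists X, b; split; first by case: XY => [[-> _]|[-> _]]; [left|right].
  by rewrite eQ; apply/connectP; exists c.
rewrite -eQ in cN'.
have cNY : connect (avoiding S J) N Y.
  apply: (connect_trans cN).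
  have adjXY : (X == Y) || adjacent S X Y.
    by case: XY => [[-> ->]|[-> ->]]; rewrite // eq_sym adjacentC.
  case/orP: adjXY => [/eqP->//|adjXY]; apply: connect1; rewrite /avoiding adjXY andbT.
  apply/andP; split; first by move: uc => /andP[h _]; apply: contraNneq h => ->.
  by apply: contraNneq Yc => ->.
case: XY => [[eX eY]|[eX eY]]; rewrite eX in cN; rewrite eY in cNY.
  have := not_between NJ N'J ne cN cNY cN' (mem_node i) (mem_node k) (mem_node q).
  by rewrite iqk.
have := not_between NJ N'J ne cNY cN cN' (mem_node i) (mem_node k) (mem_node q).
by rewrite iqk.
Qed.

Definition forbidden_arc b (a : quadruple n) :=
  if b then forbidden_down_arc S a else forbidden_up_arc S a.
Definition extreme_arc b i k : quadruple n := if b then down_arc i k else up_arc i k.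

(** Take l maximal in the subtree of i, and m minimal among the larger elements of
    the subtrees on the same side of J. An integer q between them is in none of these
    subtrees. If the path from J to q turned at some X, then l and m would be in the
    subtree of J at X and q in another one, against [not_between]. *)
Lemma forbidden_between b J N N' i k : dir b N J -> dir b N' J -> N != N' ->
  connect (avoiding S J) N (node i) -> connect (avoiding S J) N' (node k) -> i < k ->
  exists l m, [/\ i <= l, l < m, m <= k, forbidden_arc b (extreme_arc b l m) &
    forall q, l < q < m -> connect (dir b) J (node q)].
Proof.
move=> NJ N'J ne Ni N'k ik.
have [NS JS] := dir_nodes NJ; have [N'S _] := dir_nodes N'J.
pose T M := component_without S J M.
have iT : i \in cover (T N) by apply: subtree_mem Ni (mem_node i) => //; apply: dir_neq NJ.
have kT : k \in cover (T N') by apply: subtree_mem N'k (mem_node k) => //; apply: dir_neq N'J.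
case: (@arg_maxnP _ i (mem (cover (T N))) (fun v : 'I_n => v : nat) iT) => l lT lmax.
have sepP M M' x y : dir b M J -> dir b M' J -> M != M' -> x \in cover (T M) -> y \in cover (T M') ->
  x < y -> forall x' y', x' \in cover (T M) -> y' \in cover (T M') -> x' < y'.
  move=> h1 h2 h3 xT yT xy x' y' x'T y'T.
  have /exists_inP[j _ /orP[/andP[/forall_inP h4 /forall_inP h5]|/andP[/forall_inP h4 /forall_inP h5]]] :=
    subtrees_separated h1 h2 h3.
    by have := h4 x' x'T; have := h5 y' y'T; clear; lia.
  by have := h5 x xT; have := h4 y yT; clear -xy; lia.
have lk : l < k by exact: (sepP _ _ _ _ NJ N'J ne iT kT ik _ _ lT kT).
pose P m := (l < m) && [exists M, dir b M J && (m \in cover (T M))].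
have Pk : P k by rewrite /P lk; apply/existsP; exists N'; rewrite N'J.
case: (@arg_minnP _ k P (fun v : 'I_n => v : nat) Pk) => m /andP[lm /existsP[M /andP[MJ mM]]] mmin.
have NM : N != M.
  by apply: contraTneq lm => eNM; rewrite -leqNgt; apply: lmax; rewrite eNM.
exists l, m; split=> //.
- exact: lmax.
- exact: mmin.
- have := sepP _ _ _ _ NJ MJ NM lT mM lm => ltT.
  have base : [/\ J \in nodes S, subtree_lt (T N) (T M), is_max (cover (T N)) l & is_min (cover (T M)) m].
    split=> //.
    - by apply/forall_inP=> x xT; apply/forall_inP=> y yT; apply: ltT.
    - by apply/andP; split=> //; apply/forall_inP=> x /lmax.
    - apply/andP; split=> //; apply/forall_inP=> y yT; apply: mmin.
      by rewrite /P (ltT _ _ lT yT); apply/existsP; exists M; rewrite MJ.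
  have [MS _] := dir_nodes MJ.
  case: base => _ b1 b2 b3.
  rewrite /forbidden_arc /extreme_arc; case: (b) NJ MJ => NJ MJ;
    exists J, (T N), (T M), l, m; split=> //; split; apply/imsetP;
    by [exists N; rewrite // inE NS|exists M; rewrite // inE MS].
- move=> q /andP[lq qm].
  (* By the choice of m, the integer q is in no subtree on the same side as N. *)
  have nq M' : dir b M' J -> ~~ connect (avoiding S J) M' (node q).
    move=> M'J; apply/negP=> M'q; have [M'S _] := dir_nodes M'J.
    have qT := subtree_mem M'S (dir_neq M'J) M'q (mem_node q).
    have : P q by rewrite /P lq; apply/existsP; exists M'; rewrite M'J.
    by move/mmin; rewrite leqNgt qm.
  have [c [pth uc eQ]] := simple_path JS (node_in q).
  case: c pth uc eQ => [|M1 c] pth uc eQ; first by rewrite eQ.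
  have Jc : J \notin M1 :: c by case/andP: uc.
  have M1c : path (adjacent S) M1 c by case/andP: pth.
  have cJ Z : Z \in M1 :: c -> connect (avoiding S J) Z (node q).
    move=> Zc; apply: (@connect_trans _ _ M1).
      by rewrite avoid_sym; apply: path_connect_avoid Zc.
    by rewrite eQ; apply: path_connect_avoid (mem_last _ _).
  have [[b' pthb]|[b' [X [N1 [N2 [Xc JX /andP[N1X N2X] ne12 /andP[cN1 cN2]]]]]]] := path_turn pth uc.
    have [eb|nb] := eqVneq b' b; first by rewrite eQ -eb; apply/connectP; exists (M1 :: c).
    case/andP: pthb => JM1 _; have : dir b M1 J by move: nb JM1; case: b' (b) => [] [].
    by move/nq; rewrite cJ // inE eqxx.
  rewrite -eQ in cN2.
  have inN1 M' (z : 'I_n) (Z : {set 'I_n}) : dir b M' J -> z \in Z -> connect (avoiding S J) M' Z -> connect (avoiding S X) N1 Z.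
    move=> M'J zZ M'Z; have nX : ~~ connect (avoiding S J) M' X.
      by apply: contra (nq _ M'J) => h; apply: (connect_trans h); apply: cJ.
    apply: (connect_trans cN1); apply: connect_trans (avoid_both M'Z nX).
    apply: connect1; rewrite /avoiding adjacentC (dir_adjacent M'J) andbT; apply/andP; split.
      by apply: contraNneq Jc => ->.
    by apply: contraNneq nX => ->; apply: connect0.
  have mem_T M' (z : 'I_n) : dir b M' J -> z \in cover (T M') -> exists2 Z : {set 'I_n}, z \in Z & connect (avoiding S X) N1 Z.
    move=> M'J /bigcupP[Z]; rewrite component_withoutE => /and3P[_ _ M'Z] zZ.
    by exists Z => //; apply: inN1 M'J zZ M'Z.
  have [Z1 lZ1 c1] := mem_T _ _ NJ lT; have [Z2 mZ2 c2] := mem_T _ _ MJ mM.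
  have := not_between N1X N2X ne12 c1 c2 cN2 lZ1 mZ2 (mem_node q).
  by rewrite lq qm.
Qed.

End Tree.

(** * From admissible trees to preposets *)
Section Reachability.
Variables (n : nat) (S : digraph n).
Implicit Types (I J K L M N Q X Y : {set 'I_n}) (i j k l m q x y : 'I_n).
Hypotheses (tree : directed_tree S) (part : partition (nodes S) [set: 'I_n]).

Definition reach : rel 'I_n := fun i j => connect (edge S) (node S i) (node S j).

Lemma reach_preposet : preposet reach.
Proof. by split=> [i|j i k]; [apply: connect0|apply: connect_trans]. Qed.

Lemma edge_antisym I K : connect (edge S) I K -> connect (edge S) K I -> I = K.
Proof. exact: (@dir_antisym _ _ tree true). Qed.

Lemma reach_equivalent i j : equivalent reach i j = (node S i == node S j).
Proof.
apply/andP/eqP=> [[ij ji]|eij]; first exact: edge_antisym.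
by rewrite /reach eij connect0.
Qed.

Lemma reach_class i : class_of reach i = node S i.
Proof.
apply/setP=> j; rewrite inE reach_equivalent; apply/eqP/idP=> [->|ji].
  exact: mem_node.
by rewrite (node_eq part _ ji) // node_in.
Qed.

Lemma reach_covers i j : covers reach i j = edge S (node S i) (node S j).
Proof.
apply/idP/idP.
  case/andP=> /andP[ij nji] /forallP h.
  have ne : node S i != node S j by apply: contra nji => /eqP eij; rewrite /reach eij connect0.
  have [N [iN _ Nj]] := @first_step _ _ true _ _ ij ne.
  have [_ NS] := dir_nodes tree iN; have [q qN] := node_nonempty part NS.
  have eN := node_eq part NS qN; have := h q; rewrite /reach eN Nj (connect1 iN) /=.
  case/orP=> [Ni|jN].
    by have := edge_antisym (connect1 iN) Ni => /eqP; rewrite (negbTE (dir_neq tree iN)).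
  by rewrite -(edge_antisym Nj jN).
move=> ij; have ne := @dir_neq _ _ tree true _ _ ij.
apply/andP; split.
  rewrite /strictly /reach (connect1 ij); apply: contra ne => ji.
  by rewrite (edge_antisym (connect1 ij) ji).
apply/forallP=> q; apply/implyP=> iq; apply/implyP=> qj.
by case: (@dir_cover _ _ tree true _ _ _ ij iq qj) => eq; rewrite /reach eq connect0 ?orbT.
Qed.

Lemma hasse_reach : hasse reach = S.
Proof.
have eN : nodes (hasse reach) = nodes S.
  apply/setP=> I; apply/nodesP/idP=> [[x ->]|IS]; first by rewrite reach_class node_in.
  have [i iI] := node_nonempty part IS.
  by exists i; rewrite reach_class (node_eq part IS iI).
have eE : edges (hasse reach) = edges S.
  apply/setP=> [[I J]]; apply/idP/idP=> IJ.
    have [x [y [-> -> cxy]]] := @edgeP _ _ reach_preposet I J IJ.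
    by rewrite !reach_class; rewrite reach_covers in cxy.
  have [IS JS] := @dir_nodes _ _ tree true _ _ IJ.
  have [i iI] := node_nonempty part IS; have [j jJ] := node_nonempty part JS.
  change (edge (hasse reach) I J).
  rewrite -(node_eq part IS iI) -(node_eq part JS jJ) -!reach_class (edge_class reach_preposet).
  by rewrite reach_covers (node_eq part IS iI) (node_eq part JS jJ).
by move: eN eE; case: (S) => N E; rewrite /hasse /= => -> ->.
Qed.

Lemma dir_reach b i j : connect (dir S b) (node S i) (node S j) = (if b then reach i j else reach j i).
Proof. by case: b => //; apply: (connect_dir_neg S true). Qed.

End Reachability.

Section Admissible.
Variables (n : nat) (e : rel 'S_n) (S : digraph n).
Hypotheses (he : lattice_congruence e) (hS : schroeder_separating_tree S) (adm : admissible S e).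
Implicit Types (I J K L M N Q X Y : {set 'I_n}) (a b i j k l m q x y : 'I_n) (s t u : 'S_n).

Let tree : directed_tree S. Proof. by case: hS. Qed.
Let part : partition (nodes S) [set: 'I_n]. Proof. by case: hS. Qed.
Let sep := let: And3 _ _ h := hS in h.
Local Notation p := (reach S).
Local Notation node := (node S).
Let pp : preposet p := reach_preposet S.
Let refl : reflexive p. Proof. by case: pp. Qed.
Let tr : transitive p. Proof. by case: pp. Qed.

Lemma tree_linear_extension : exists t, forall i j, strictly p i j -> before t i j.
Proof.
have [t bt] := refinement (fun i => #|[set q | p q i]|) 1%g.
by exists t => i j ij; rewrite bt (down_smaller pp).
Qed.

Variable t : 'S_n.
Hypothesis tlin : forall i j, strictly p i j -> before t i j.

(** The partial order obtained from p by ordering every node as in t. *)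
Definition tree_order i j := p i j && before t i j.

Lemma tree_order_strict i j : strictly p i j -> tree_order i j.
Proof. by move=> ij; rewrite /tree_order tlin // andbT; case/andP: ij. Qed.

(** Linear extensions are connected by exchanges of adjacent incomparable letters,
    and the path between the nodes of two incomparable letters turns at some J. The
    elements beyond J are all before, or all after, the two letters. *)
Lemma linear_extension_congruent s :
  (forall i j, tree_order i j -> before s i j) -> e t s.
Proof.
move=> slin; pose Q (u : 'S_n) := forall i j, tree_order i j -> before u i j.
apply: (sort_by_swaps he (Q := Q)); last by move=> i j /andP[].
move=> u u' x y ulin sw syx; have [uxy u'yx hsw] := sw.
have nT : ~~ tree_order x y by apply/negP=> /slin; rewrite (before_asym syx).
have nT' : ~~ tree_order y x by apply/negP=> /ulin; rewrite (before_asym uxy).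
have Q' : Q u'.
  move=> i j ij; rewrite -hsw; first exact: ulin.
    by apply: contra nT => /andP[/eqP<- /eqP<-].
  by apply: contra nT' => /andP[/eqP<- /eqP<-].
split=> //; have nxy : x != y := before_neq uxy.
have [npxy npyx] : ~~ p x y /\ ~~ p y x.
  rewrite /tree_order in nT nT'.
  case: (boolP (before t x y)) => txy; last first.
    have tyx := before_total nxy txy; rewrite tyx andbT in nT'; split=> //.
    by apply/negP=> pxy; have := @tlin x y; rewrite /strictly pxy nT' (negbTE txy) => /(_ isT).
  rewrite txy andbT in nT; split=> //.
  by apply/negP=> pyx; have := @tlin y x; rewrite /strictly pyx nT (before_asym txy) => /(_ isT).
have [c [pth uc eQ]] := simple_path tree (node_in part x) (node_in part y).
have [[b pthb]|[b [J [N [N' [Jc xJ /andP[NJ N'J] ne /andP[cN cN']]]]]]] := path_turn tree pth uc.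
  have : connect (dir S b) (node x) (node y) by rewrite eQ; apply/connectP; exists c.
  by rewrite dir_reach; case: b {pthb}; rewrite ?(negbTE npxy) ?(negbTE npyx).
rewrite -eQ in cN'.
have [l [m [lm cases forb btw]]] : exists l m, [/\ l < m,
    (x <= l) && (m <= y) || (y <= l) && (m <= x), forbidden_arc S b (extreme_arc b l m) &
    forall q, l < q < m -> connect (dir S b) J (node q)].
  case: (ltngtP x y) => [xy|yx|/val_inj exy]; last by rewrite exy eqxx in nxy.
    have [l [m [h1 h2 h3 h4 h5]]] := forbidden_between tree part sep NJ N'J ne cN cN' xy.
    by exists l, m; split=> //; rewrite h1 h3.
  have ne' : N' != N by rewrite eq_sym.
  have [l [m [h1 h2 h3 h4 h5]]] := forbidden_between tree part sep N'J NJ ne' cN' cN yx.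
  by exists l, m; split=> //; rewrite h1 h3 orbT.
have [_ JS] := dir_nodes tree NJ; have [z zJ] := node_nonempty part JS.
have eJ := node_eq part JS zJ.
have nJx : J != node x by apply: contraTneq uc => <-; rewrite /= Jc.
have bad : extreme_arc b l m \notin congruence_arcs e.
  by case: adm => _ h1 h2; case: (b) forb => forb; [apply: h2|apply: h1].
have strict q : l < q < m -> if b then strictly p x q else strictly p q x.
  move/btw; rewrite -eJ dir_reach; rewrite -eJ dir_reach in xJ; move: xJ.
  rewrite /strictly; case: (b) => h1 h2.
    rewrite (tr h1 h2); apply: contra nJx => qx; rewrite -eJ.
    by apply/eqP; apply: (edge_antisym tree) h1; apply: tr h2 qx.
  rewrite (tr h2 h1); apply: contra nJx => xq; rewrite -eJ.
  by apply/eqP; apply: (edge_antisym tree) h1 _; apply: tr xq h2.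
have [upA downA] := between_arc lm.
have qy q : l < q < m -> q != y.
  by rewrite -val_eqE /= => lt; move: cases lt; clear; lia.
case: (b) strict bad => strict bad.
  apply: (swap_across_arc he sw downA bad cases) => q; first by rewrite inE.
  rewrite inE => lt; have xq := ulin _ _ (tree_order_strict (strict q lt)).
  by apply: before_total; [apply: qy|apply/negP; apply: (swapped_adjacent sw xq)].
apply: (swap_across_arc he sw upA bad cases) => q; last by rewrite inE.
by rewrite inE => /strict/tree_order_strict/ulin.
Qed.

(** If j is not above i, some linear extension of the tree puts j before i: place the
    elements above i last. *)
Lemma class_order_reach i j : class_order e t i j -> p i j.
Proof.
move=> /class_orderP ij; apply: contraT => nij.
pose g v := nat_of_bool (p i v); have [s bs] := refinement g t.
have /ij : e t s.
  apply: linear_extension_congruent => x y /andP[xy txy]; rewrite bs txy andbT.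
  rewrite /g; case: (boolP (p i x)) => [ix|_]; first by rewrite (tr ix xy).
  by case: (p i y).
by rewrite leqNgt; have := bs j i; rewrite /before /g (negbTE nij) refl /= => ->.
Qed.

(** If i and k were incomparable in the class order, then [incomparable_arc] applied
    to the elements that must precede them would give a missing arc. By
    [between_comparable], this arc is mandatory. *)
Lemma class_order_comparable i k : i < k ->
  (node i == node k) || adjacent S (node i) (node k) ->
  (forall q, i < q < k -> (node q != node i) && (node q != node k)) ->
  class_order e t i k \/ class_order e t k i.
Proof.
move=> ik adj btw; apply/orP; apply: contraT; rewrite negb_or => /andP[nik nki].
have cov : [|| equivalent p i k, covers p i k | covers p k i].
  by rewrite (reach_equivalent tree) !(reach_covers tree part).
have conv x y (xy : p x y) := cover_interval pp cov xy.
have eqn v w : equivalent p v w = (node w == node v).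
  by rewrite (reach_equivalent tree) eq_sym.
pose inM q := (node q == node i) || (node q == node k).
(* What has to precede i or k: in their nodes by the class order, elsewhere by p. *)
pose D := [set q | if inM q then [&& q != i, q != k & class_order e t q i || class_order e t q k]
                   else p q i || p q k].
have inMi : inM i by rewrite /inM eqxx.
have inMk : inM k by rewrite /inM eqxx orbT.
have Mbelow x y : p x y -> inM x -> p y i || p y k -> inM y.
  move=> xy xM yik; rewrite /inM -!eqn; case/orP: xM => /eqP ex.
    by apply: (conv i y) => //; [rewrite /reach -ex|left].
  by apply: (conv k y) => //; [rewrite /reach -ex|right].
have ctr := @class_order_trans _ e t; have canti := @class_order_anti _ _ he t.
have below z x : (z = i) \/ (z = k) -> class_order e t x z -> (x == z) || (x \in D).
  move=> ez xz; have [//|nxz] := eqVneq x z; have := class_order_reach xz => pxz.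
  rewrite /= inE; case: ifP => [xM|_]; last by case: ez => <-; rewrite pxz ?orbT.
  case: ez => ez; rewrite ez in xz nxz; rewrite nxz xz ?orbT ?andbT /=.
    by apply: contra nki => /eqP<-.
  by apply: contra nik => /eqP<-.
have badarc := @incomparable_arc _ _ he t D i k ik.
have {badarc} : (i, k, [set q in between i k | q \in D], [set q in between i k | q \notin D])
    \notin congruence_arcs e.
  apply: badarc.
  - by rewrite inE inMi eqxx.
  - by rewrite inE inMk eqxx andbF.
  - move=> a b ab; have pab := class_order_reach ab; rewrite [b \in D]inE.
    case: ifPn => [bM /and3P[bi bk bik]|bM bik].
      have aik : class_order e t a i || class_order e t a k.
        by case/orP: bik => h; rewrite (ctr _ _ _ ab h) ?orbT.
      rewrite inE aik andbT; case: ifPn => aM.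
        apply/andP; split; apply/eqP=> ea; rewrite ea in ab.
          case/orP: bik => h; last by rewrite (ctr _ _ _ ab h) in nik.
          by rewrite (canti _ _ h ab) eqxx in bi.
        case/orP: bik => h; first by rewrite (ctr _ _ _ ab h) in nki.
        by rewrite (canti _ _ h ab) eqxx in bk.
      by case/orP: aik => /class_order_reach->; rewrite ?orbT.
    have aik : p a i || p a k by case/orP: bik => h; rewrite (tr pab h) ?orbT.
    rewrite inE; case: ifPn => // aM.
    by rewrite (Mbelow _ _ pab aM bik) in bM.
  - by move=> a; apply: below; left.
  - by move=> a; apply: below; right.
have arcA : (i, k, [set q in between i k | q \in D], [set q in between i k | q \notin D]) \in arcs n.
  apply/arcsP; split=> // q; rewrite !inE; first by rewrite -andb_orr orbN andbT.
  by case/andP=> -> ->.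
have nodeP (P : {set 'I_n} -> bool) q :
   [exists J in nodes S, (q \in J) && P J] = P (node q).
  apply/exists_inP/idP=> [[J JS /andP[qJ]]|Pq]; first by rewrite (node_eq part JS qJ).
  by exists (node q); rewrite ?node_in // mem_node.
case/negP; case: adm => mand _ _; apply: mand; split=> //.
have nM q : i < q < k -> inM q = false by move/btw; rewrite /inM => /andP[/negbTE-> /negbTE->].
exists (node i), (node k); split=> //.
- by rewrite !node_in // !mem_node.
- apply/setP=> q; rewrite !inE; apply: contraTF isT => /andP[/nM/negP h1 h2]; case: h1.
  have [iS kS] := (node_in part i, node_in part k).
  by rewrite /inM; case/orP: h2 => h; rewrite (node_eq part _ h) ?node_in ?eqxx ?orbT.
- apply/setP=> q; rewrite !inE (nodeP (fun J => connect (edge S) J (node i) || connect (edge S) J (node k))).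
  by case: (boolP (i < q < k)) => // /nM->.
- apply/setP=> q; rewrite !inE (nodeP (fun J => connect (edge S) (node i) J || connect (edge S) (node k) J)).
  case: (boolP (i < q < k)) => // iqk; rewrite (nM q iqk) /=; apply/idP/idP=> [nq|iq].
    have [X [b [eX]]] := between_comparable tree part sep iqk adj.
    by case: eX => ->; rewrite dir_reach; (case: b => h; [rewrite /reach in h; rewrite /= h ?orbT|move: nq; rewrite h ?orbT]).
  apply/negP=> qik; have : inM q.
    by case/orP: iq => iq; [apply: (Mbelow i)|apply: (Mbelow k)].
  by rewrite nM.
Qed.

End Admissible.

Section TreeFace.
Variables (R : realType) (n : nat) (e : rel 'S_n) (S : digraph n).
Hypotheses (he : lattice_congruence e) (hS : schroeder_separating_tree S) (adm : admissible S e).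
Implicit Types (a b i j k q : 'I_n).

(** A point of the class cone that is constant along the relations reversed in p is
    constant on every node, by going through consecutive values of the node, and
    increases along every edge, by comparing the closest values of its two ends. *)
Lemma admissible_preposet : congruence_preposet R e (reach S).
Proof.
have [part tree _] := hS.
have [t tlin] := tree_linear_extension S.
have tp := class_order_reach he hS adm tlin; have comp := class_order_comparable he hS adm tlin.
apply: (preposet_face he (reach_preposet S) tp) => x xmono xeq.
have node_const : forall d i k, k - i <= d -> i <= k -> node S i = node S k -> x 0%R i = x 0%R k.
  elim=> [|d IH] i k kid ik eik; first by congr (x _ _); apply: val_inj => /=; move: kid ik; clear; lia.
  move: ik; rewrite leq_eqVlt => /orP[/eqP/val_inj->//|ik].
  case: (boolP [exists q : 'I_n, (i < q < k) && (node S q == node S i)]) => [|none].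
    case/existsP=> q /andP[/andP[iq qk] /eqP eq].
    rewrite (IH i q) ?(IH q k) ?(ltnW iq) ?(ltnW qk) ?eq //; move: kid iq qk; clear; lia.
  have [|q lt|h|h] := comp i k ik; first by rewrite eik eqxx.
  - have nq : node S q != node S i.
      by apply: contra none => h; apply/existsP; exists q; rewrite lt.
    by rewrite nq -eik nq.
  - by apply: xeq h _; rewrite /reach eik connect0.
  - by apply/esym; apply: xeq h _; rewrite /reach eik connect0.
have {}node_const i k : node S i = node S k -> x 0%R i = x 0%R k.
  by move=> eik; case: (leqP i k) => ik; [|apply/esym]; apply: (node_const _ _ _ (leqnn _)) => //; apply: ltnW.
have edge_le i k : edge S (node S i) (node S k) -> (x 0%R i <= x 0%R k)%R.
  move=> ik; pose d (v w : 'I_n) := (v - w) + (w - v).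
  pose P (vw : 'I_n * 'I_n) := (node S vw.1 == node S i) && (node S vw.2 == node S k).
  have P0 : P (i, k) by rewrite /P !eqxx.
  case: (arg_minnP (fun vw => d vw.1 vw.2) P0) => [[v w]] /andP[/eqP /= ev /eqP /= ew] dmin.
  have {}dmin v' w' : node S v' = node S i -> node S w' = node S k -> d v w <= d v' w'.
    by move=> e1 e2; apply: (dmin (v', w')); rewrite /P /= e1 e2 !eqxx.
  rewrite -(node_const _ _ ev) -(node_const _ _ ew).
  have nwv : ~~ reach S w v.
    rewrite /reach ev ew; apply/negP=> ki.
    have eki := edge_antisym tree (connect1 ik) ki.
    by move: (@dir_neq _ _ tree true _ _ ik); rewrite eki eqxx.
  case: (ltngtP v w) => [vw|wv|/val_inj evw]; last by rewrite evw.
    have [|q /andP[vq qw]|h|h] := comp v w vw; first by rewrite ev ew /adjacent ik orbT.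
    - apply/andP; split; apply/eqP=> eq.
        by have := dmin q w (etrans eq ev) ew; rewrite /d; move: vq qw; clear; lia.
      by have := dmin v q ev (etrans eq ew); rewrite /d; move: vq qw; clear; lia.
    - exact: xmono h.
    - by rewrite (tp _ _ h) in nwv.
  have [|q /andP[wq qv]|h|h] := comp w v wv; first by rewrite ev ew /adjacent ik !orbT.
  - apply/andP; split; apply/eqP=> eq.
      by have := dmin v q ev (etrans eq ew); rewrite /d; move: wq qv; clear; lia.
    by have := dmin q w (etrans eq ev) ew; rewrite /d; move: wq qv; clear; lia.
  - by rewrite (tp _ _ h) in nwv.
  - exact: xmono h.
move=> i j ij.
have := connect_invariant (P := fun K => forall k, node S k = K -> (x 0%R i <= x 0%R k)%R) _ ij.
apply=> // [K L IH KL l el|k eki]; last by rewrite (node_const _ _ eki).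
have [KS _] := @dir_nodes _ _ tree true _ _ KL; have [k kK] := node_nonempty part KS.
have ek := node_eq part KS kK; apply: Order.POrderTheory.le_trans (IH k ek) _.
by apply: edge_le; rewrite ek el.
Qed.

End TreeFace.

Theorem proposition4p19 (R : realType) (n : nat) (hn : 0 < n) (e : rel 'S_n)
    (he : lattice_congruence e) (hess : essential e)
    (hsimple : simple_congruence e) (S : digraph n) :
  (exists p : rel 'I_n, congruence_preposet R e p /\ hasse p = S) <->
  (schroeder_separating_tree S /\ admissible S e).
Proof.
split=> [[p [cp <-]]|[hS adm]]; first exact: preposet_admissible cp.
have [part tree _] := hS; exists (reach S); split; first exact: admissible_preposet.
exact: hasse_reach.
Qed.
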